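(* Let $1\le r\le d$ be integers. Let $F(x)=\mathbb{E}_{\xi\sim\mathcal{D}}[f(x,\xi)]$, $F:\mathbb{R}^d\to\mathbb{R}$, be differentiable, bounded below with $F_*:=\inf_xF(x)>-\infty$, and $L$-smooth for some $L>0$, i.e. $\|\nabla F(x)-\nabla F(y)\|\le L\|x-y\|$ for all $x,y\in\mathbb{R}^d$. Assume $\mathbb{E}[\nabla f(x,\xi)]=\nabla F(x)$ for all $x\in\mathbb{R}^d$ and that for some $p\in(1,2]$ and $\sigma\ge0$, $\mathbb{E}[\|\nabla f(x,\xi)-\nabla F(x)\|^p]\le\sigma^p$ for all $x\in\mathbb{R}^d$. Let $T\ge1$ be an integer, $B>0$, $q>0$, $\eta>0$, $u\in(0,1)$, and set $\bar B=\lceil\max\{1,BT^q\}\rceil$, $\bar\eta=\eta T^{-u}$. Let $\{x_k\}_{k\ge0}$ be generated from $x_0\in\mathbb{R}^d$ by RS-NSGD with stepsize $\bar\eta$ and minibatch size $\bar B$, and put $\Delta_0:=F(x_0)-F_*$. Then for every $\delta\in(0,1)$, with probability at least $1-\delta$, $$\frac1T\sum_{k=0}^{T-1}\|\nabla F(x_k)\|\le\frac{2\Delta_0}{\tau\eta T^{1-u}}+17\,\frac{\frac dr\sqrt{\Delta_0L}}{\tau^2T}\log(1/\delta)+\frac{\frac dr\eta L}{\tau T^u}\left(1+12\frac{\sqrt{d/r}}{\tau}\log(1/\delta)\right)+\frac{8\sigma}{\max\{1,BT^q\}^{\frac{p-1}{p}}}.$$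
   Context: $\|\cdot\|$ is the Euclidean norm. $\nabla f(x,\xi)$ denotes the gradient in $x$ (assumed to exist and be jointly measurable). Haar matrix: a random $d\times r$ matrix $P$ equal to $\sqrt{d/r}$ times the first $r$ columns of a Haar-distributed random orthogonal matrix in $O(d)$. Thus $UP$ has the same law as $P$ for every $U\in O(d)$, $\mathbb{E}[PP^\top]=I_d$, $P^\top P=\frac dr I_r$, and $\|P^\top x\|>0$ almost surely for each fixed $x\neq0$. RS-NSGD (randomized subspace normalized SGD): $x_0$ is deterministic; at iteration $k=0,1,\dots$ one draws a Haar matrix $P_k\in\mathbb{R}^{d\times r}$ and i.i.d. samples $\xi_k^1,\dots,\xi_k^{\bar B}\sim\mathcal{D}$, all independent of each other and of the past iterations, sets $g_k=\frac1{\bar B}\sum_{j=1}^{\bar B}\nabla f(x_k,\xi_k^j)$, and updates $x_{k+1}=x_k-\bar\eta\,\frac{P_kP_k^\top g_k}{\|P_k^\top g_k\|}$ if $P_k^\top g_k\ne0$, and $x_{k+1}=x_k$ if $P_k^\top g_k=0$. The constant $\tau$ is $$\tau=\sqrt{\frac dr}\,\frac{\Gamma\left(\frac{r+1}{2}\right)\Gamma\left(\frac d2\right)}{\Gamma\left(\frac r2\right)\Gamma\left(\frac{d+1}{2}\right)}.$$ *)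

(* Defs.v *)
(* Vectors of R^d are columns, of type 'cV[R]_d. *)
From HB Require Import structures.
From mathcomp Require Export all_boot all_order all_algebra.
From mathcomp Require Export all_classical all_reals all_analysis.

Set Implicit Arguments.
Unset Strict Implicit.
Unset Printing Implicit Defensive.

Import Order.TTheory GRing.Theory Num.Theory.
Import numFieldNormedType.Exports.

Local Open Scope classical_set_scope.
Local Open Scope ring_scope.

Definition mx_borel_display : measure_display.
Proof. exact. Qed.

Section mx_borel.
Variables (R : realType) (m n : nat).

Definition mx_borel : set_system 'M[R]_(m, n) :=
  <<s [set A : set 'M[R]_(m, n) | open A] >>.

Let mx_borel0 : mx_borel set0.
Proof. exact: sigma_algebra0. Qed.

Let mx_borelC A : mx_borel A -> mx_borel (~` A).
Proof. by move=> mA; rewrite -setTD; exact: sigma_algebraCD. Qed.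

Let mx_borel_bigcup (A : (set 'M[R]_(m, n))^nat) :
  (forall i, mx_borel (A i)) -> mx_borel (\bigcup_i A i).
Proof. exact: sigma_algebra_bigcup. Qed.

HB.instance Definition _ := @isMeasurable.Build mx_borel_display 'M[R]_(m, n)
  mx_borel mx_borel0 mx_borelC mx_borel_bigcup.

End mx_borel.

Section euclidean.
Variables (R : realType) (d : nat).

(* The norm `|x| that the library puts on matrices is the sup norm. *)
Definition enorm (x : 'cV[R]_d) : R := Num.sqrt (\sum_(i < d) x i 0 ^+ 2).

Definition grad (F : 'cV[R]_d -> R) (x : 'cV[R]_d) : 'cV[R]_d :=
  \col_(i < d) 'D_(delta_mx i 0) F x.

Definition orthogonal_mx (U : 'M[R]_d) : Prop := U^T *m U = 1%:M.

End euclidean.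

Section haar.
Variables (R : realType) (d : nat).

(* The Haar distribution on O(d), seen as a law on d x d matrices carried by
   O(d); left invariance determines it because O(d) is compact. *)
Definition haar_orthogonal (mu : probability 'M[R]_d R) : Prop :=
  mu [set U | orthogonal_mx U] = 1%E /\
  forall (U : 'M[R]_d) (A : set 'M[R]_d), orthogonal_mx U -> measurable A ->
    mu ((fun Q => U *m Q) @^-1` A) = mu A.

Definition first_columns (r : nat) (hrd : (r <= d)%N) (Q : 'M[R]_d) :
    'M[R]_(d, r) :=
  colsub (widen_ord hrd) Q.

(* Only the law of the matrix is constrained: the sample space need not carry
   the full d x d orthogonal matrix. *)
Definition haar_matrix (r : nat) (hrd : (r <= d)%N) d0 (Omega : measurableType d0)
    (Pr : probability Omega R) (P : Omega -> 'M[R]_(d, r)) : Prop :=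
  exists2 mu : probability 'M[R]_d R, haar_orthogonal mu &
    forall A : set 'M[R]_(d, r), measurable A ->
      Pr (P @^-1` A) =
      mu ((fun Q => Num.sqrt (d%:R / r%:R) *: first_columns hrd Q) @^-1` A).

End haar.

Section independence.
Context {R : realType} {d0 : measure_display} {Omega : measurableType d0}.

Definition mutually_independent (Pr : probability Omega R) (I : eqType)
    (G : I -> set_system Omega) : Prop :=
  forall (s : seq I) (A : I -> set Omega), uniq s ->
    (forall i, i \in s -> G i (A i)) ->
    Pr (\bigcap_(i in [set` s]) A i) = (\prod_(i <- s) Pr (A i))%E.

Definition sigma_rv d1 (S : measurableType d1) (X : Omega -> S) :
    set_system Omega :=
  preimage_set_system setT X measurable.

Definition draws_sigma d1 (S : measurableType d1) d2 (X : measurableType d2)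
    (b : nat) (P : nat -> Omega -> S) (xi : nat -> 'I_b -> Omega -> X)
    (i : nat + nat * 'I_b) : set_system Omega :=
  match i with
  | inl k => sigma_rv (P k)
  | inr kj => sigma_rv (xi kj.1 kj.2)
  end.

End independence.

Section rs_nsgd.
Variables (R : realType) (d r : nat) (Xi : Type).

Definition minibatch_grad (g : 'cV[R]_d -> Xi -> 'cV[R]_d) (b : nat)
    (xi : 'I_b -> Xi) (x : 'cV[R]_d) : 'cV[R]_d :=
  b%:R^-1 *: \sum_(j < b) g x (xi j).

Definition rs_nsgd_step (eta : R) (P : 'M[R]_(d, r)) (g x : 'cV[R]_d) :
    'cV[R]_d :=
  if P^T *m g == 0 then x
  else x - (eta / enorm (P^T *m g)) *: (P *m P^T *m g).

Fixpoint rs_nsgd (g : 'cV[R]_d -> Xi -> 'cV[R]_d) (b : nat) (eta : R)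
    (x0 : 'cV[R]_d) (P : nat -> 'M[R]_(d, r)) (xi : nat -> 'I_b -> Xi)
    (k : nat) : 'cV[R]_d :=
  if k is k'.+1 then
    let x := rs_nsgd g eta x0 P xi k' in
    rs_nsgd_step eta (P k') (minibatch_grad g (xi k') x) x
  else x0.

End rs_nsgd.

Section constants.
Variable R : realType.

Definition Gamma (s : R) : R :=
  \int[lebesgue_measure]_(t in `]0, +oo[) (t `^ (s - 1) * expR (- t)).

Definition tau (d r : nat) : R :=
  Num.sqrt (d%:R / r%:R) *
  ((Gamma (r.+1%:R / 2) * Gamma (d%:R / 2)) /
   (Gamma (r%:R / 2) * Gamma (d.+1%:R / 2))).

Definition batch_size (B q : R) (T : nat) : nat :=
  `|Num.ceil (Num.max 1 (B * T%:R `^ q))%R|%N.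

End constants.

(* Main.v *)
(* A step from x_k makes the progress Y_k = <N, P P^T g> / |P^T g| along the true
   gradient N at x_k, and Y_k >= |P^T N| - 2 |P^T (g - N)|.  For a Haar matrix
   the mean of |P^T y| is tau |y|: left invariance turns into a recurrence
   between the moments of |P^T y| of orders m and m + 2, whose solution is pinned
   down by the Gamma quotient.  A p-th moment inequality for sums of centered
   vectors bounds the mean of |g - N| by 2 sigma b^(1/p - 1).  Hence, as long as
   |N| is bounded, which is the case along the path because the steps have length
   eta sqrt(d/r) and |N_0|^2 <= 2 L Delta0, the product of the factors
     exp (lam tau |N| - lam^2 (d/r) |N|^2 - 2 lam tau (noise) - lam Y_k)
   is a nonnegative supermartingale; Markov's inequality for it, combined with
   the descent lemma eta sum Y_k <= Delta0 + T L eta^2 (d/r) / 2, gives the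
   bound. *)
Require Import Defs.
From HB Require Import structures.
From mathcomp Require Import all_boot all_order all_algebra.
From mathcomp Require Import all_classical all_reals all_analysis.
From mathcomp Require Import measurable_realfun ring lra.
Set Implicit Arguments.
Unset Strict Implicit.
Unset Printing Implicit Defensive.
Import Order.TTheory GRing.Theory Num.Theory.
Import numFieldNormedType.Exports.
Local Open Scope classical_set_scope.
Local Open Scope ring_scope.

(** * Euclidean norm and measurability of matrices *)

(** The noise has only a p-th moment, so [g - N] must never be exponentiated. Normalization permits
    this: |Y_k| <= sqrt(d/r) |N| whatever the minibatch gives, so exp(-lam Y_k) can be expanded to
    second order and the noise enters only linearly, through the lower bound on Y_k; its first
    moment is then enough. Randomness is averaged in a fixed order: P_k last, with g_k frozen, which
    turns |P^T N| and |P^T (g - N)| into tau |N| and tau |g - N|; then the samples, with the past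
    frozen. The mean length is found without any density. Isotropy expands E |X^T (e_i + t
    e_j)|^(2n) in t, X being the unscaled columns, and yields the even moments; the odd ones, among
    them the one needed, follow by applying the same identity to polynomials that approximate the
    square root. Gamma enters only through its functional equation, log-convexity and value at 1.
    Domination of lam^2 (d/r) |N|^2 by lam tau |N| forces lam to be of order 1/M for a bound M on
    |N|, hence the factor M of log(1/delta). *)

Definition dot (R : realType) (n : nat) (x y : 'cV[R]_n) : R :=
  \sum_(i < n) x i 0 * y i 0.

Section euclidean_norm.
Variable R : realType.

Lemma dotC n (x y : 'cV[R]_n) : dot x y = dot y x.
Proof. by apply: eq_bigr => i _; rewrite mulrC. Qed.

Lemma dotDl n (x y z : 'cV[R]_n) : dot (x + y) z = dot x z + dot y z.
Proof. by rewrite /dot -big_split; apply: eq_bigr => i _; rewrite mxE mulrDl. Qed.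

Lemma dotZl n a (x y : 'cV[R]_n) : dot (a *: x) y = a * dot x y.
Proof. by rewrite /dot mulr_sumr; apply: eq_bigr => i _; rewrite mxE mulrA. Qed.

Lemma dotDr n (x y z : 'cV[R]_n) : dot x (y + z) = dot x y + dot x z.
Proof. by rewrite dotC dotDl !(dotC x). Qed.

Lemma dotZr n a (x y : 'cV[R]_n) : dot x (a *: y) = a * dot x y.
Proof. by rewrite dotC dotZl dotC. Qed.

Lemma dotNl n (x y : 'cV[R]_n) : dot (- x) y = - dot x y.
Proof. by rewrite -scaleN1r dotZl mulN1r. Qed.

Lemma dotNr n (x y : 'cV[R]_n) : dot x (- y) = - dot x y.
Proof. by rewrite dotC dotNl dotC. Qed.

Lemma dot0l n (x : 'cV[R]_n) : dot 0 x = 0.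
Proof. by rewrite /dot big1// => i _; rewrite mxE mul0r. Qed.

Lemma dotE n (x y : 'cV[R]_n) : dot x y = (x^T *m y) 0 0.
Proof. by rewrite mxE; apply: eq_bigr => i _; rewrite mxE. Qed.

Lemma dot_mull m n (A : 'M[R]_(m, n)) x y : dot (A *m x) y = dot x (A^T *m y).
Proof. by rewrite !dotE trmx_mul mulmxA. Qed.

Lemma dot_ge0 n (x : 'cV[R]_n) : 0 <= dot x x.
Proof. by apply: sumr_ge0 => i _; rewrite -expr2 sqr_ge0. Qed.

Lemma enormE n (x : 'cV[R]_n) : enorm x = Num.sqrt (dot x x).
Proof. by congr Num.sqrt; apply: eq_bigr => i _; rewrite expr2. Qed.

Lemma enorm_ge0 n (x : 'cV[R]_n) : 0 <= enorm x.
Proof. exact: sqrtr_ge0. Qed.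

Lemma sqr_enorm n (x : 'cV[R]_n) : enorm x ^+ 2 = dot x x.
Proof. by rewrite enormE sqr_sqrtr ?dot_ge0. Qed.

Lemma enorm0 n : enorm (0 : 'cV[R]_n) = 0.
Proof. by rewrite enormE dot0l sqrtr0. Qed.

Lemma enorm_eq0 n (x : 'cV[R]_n) : (enorm x == 0) = (x == 0).
Proof.
apply/eqP/eqP => [x0|->]; last exact: enorm0.
apply/matrixP => i j; rewrite ord1 mxE.
have /eqP : dot x x = 0 by rewrite -sqr_enorm x0 expr0n.
rewrite psumr_eq0 => [|k _]; last by rewrite -expr2 sqr_ge0.
by move=> /allP/(_ i (mem_index_enum i))/=; rewrite mulf_eq0 orbb => /eqP.
Qed.

Lemma enormZ n a (x : 'cV[R]_n) : enorm (a *: x) = `|a| * enorm x.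
Proof. by rewrite !enormE dotZl dotZr mulrA -expr2 sqrtrM ?sqr_ge0// sqrtr_sqr. Qed.

Lemma enormN n (x : 'cV[R]_n) : enorm (- x) = enorm x.
Proof. by rewrite -scaleN1r enormZ normrN1 mul1r. Qed.

Lemma dot_le n (x y : 'cV[R]_n) : dot x y <= enorm x * enorm y.
Proof.
have [/eqP|x0] := eqVneq (enorm x) 0.
  by rewrite enorm_eq0 => /eqP ->; rewrite dot0l enorm0 mul0r.
have [/eqP|y0] := eqVneq (enorm y) 0.
  by rewrite enorm_eq0 => /eqP ->; rewrite dotC dot0l enorm0 mulr0.
have xgt0 : 0 < enorm x by rewrite lt_neqAle eq_sym x0 enorm_ge0.
have ygt0 : 0 < enorm y by rewrite lt_neqAle eq_sym y0 enorm_ge0.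
(* Cauchy-Schwarz: the square of this vector is 2 |x| |y| (|x| |y| - <x, y>). *)
have := dot_ge0 (enorm y *: x - enorm x *: y).
rewrite !(dotDl, dotDr, dotNl, dotNr, dotZl, dotZr) -!sqr_enorm (dotC y x) => h.
rewrite -(ler_pM2l (mulr_gt0 xgt0 ygt0)).
by move: h; set a := enorm x; set b := enorm y; nra.
Qed.

Lemma normr_dot_le n (x y : 'cV[R]_n) : `|dot x y| <= enorm x * enorm y.
Proof. by rewrite ler_norml dot_le lerNl -dotNl -(enormN x) dot_le. Qed.

Lemma ler_enormD n (x y : 'cV[R]_n) : enorm (x + y) <= enorm x + enorm y.
Proof.
rewrite -(@ler_pXn2r _ 2) ?nnegrE ?addr_ge0 ?enorm_ge0//.
rewrite sqr_enorm !(dotDl, dotDr) (dotC y x) -!sqr_enorm.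
have := dot_le x y; nra.
Qed.

Lemma ler_enormB n (x y : 'cV[R]_n) : enorm x - enorm y <= enorm (x - y).
Proof. by rewrite lerBlDr (le_trans _ (ler_enormD _ _))// subrK. Qed.

Lemma normr_coord_le n (x : 'cV[R]_n) i : `|x i 0| <= enorm x.
Proof.
rewrite -sqrtr_sqr ler_wsqrtr// (bigD1 i)//= lerDl sumr_ge0// => j _.
exact: sqr_ge0.
Qed.

Lemma enorm_delta n (i : 'I_n) : enorm (delta_mx i 0 : 'cV[R]_n) = 1.
Proof.
rewrite /enorm (bigD1 i)//= mxE !eqxx expr1n big1 ?addr0 ?sqrtr1// => j ji.
by rewrite mxE (negbTE ji) expr0n.
Qed.

Lemma enorm_isometry m n (A : 'M[R]_(m, n)) c x :
  0 <= c -> A^T *m A = c%:M -> enorm (A *m x) = Num.sqrt c * enorm x.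
Proof.
move=> c0 Ac; rewrite !enormE dot_mull mulmxA Ac mul_scalar_mx dotZr.
by rewrite sqrtrM.
Qed.

End euclidean_norm.

(** * Borel measurability of matrix-valued maps *)

Section measurable_matrices.
Variable R : realType.

Lemma measurable_mx_coord m n (i : 'I_m) (j : 'I_n) :
  measurable_fun setT (fun A : 'M[R]_(m, n) => A i j).
Proof.
apply: (@measurability _ _ _ _ setT (fun A : 'M[R]_(m, n) => A i j)
  (@RGenOpens.G R)).
  exact: RGenOpens.measurableE.
move=> _ [_ [x [y ->]] <-]; apply: sub_sigma_algebra; rewrite /= setTI.
apply: open_comp; last exact: interval_open.
by move=> A _; exact: coord_continuous.
Qed.

(* Rational boxes make the topology of matrices second countable. *)
Lemma open_mx_bigcup_box m n (A : set 'M[R]_(m, n)) : open A ->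
  A = \bigcup_(p in [set p : 'M[rat]_(m, n) * rat |
        [set x : 'M[R]_(m, n) | forall i j, `|x i j - ratr (p.1 i j)| < ratr p.2] `<=` A])
      [set x : 'M[R]_(m, n) | forall i j, `|x i j - ratr (p.1 i j)| < ratr p.2].
Proof.
move=> oA; apply/seteqP; split=> [x Ax|x [p pA xp]]; last exact: pA.
have /nbhs_ballP[e /= e0 eA] : nbhs x A by apply: open_nbhs_nbhs.
have [q /andP[q0 qe]] : exists q : rat, (0 < ratr q :> R) && (ratr q < e / 2).
  by apply/rat_in_itvoo; rewrite divr_gt0.
have /choice[c cP] : forall ij : 'I_m * 'I_n, exists c : rat,
    `|x ij.1 ij.2 - ratr c| < ratr q.
  move=> ij; have [c] : exists c : rat,
      ratr c \in `](x ij.1 ij.2 - ratr q), (x ij.1 ij.2 + ratr q)[.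
    by apply: rat_in_itvoo; lra.
  rewrite in_itv/= => /andP[c1 c2]; exists c.
  by rewrite ltr_norml; apply/andP; split; lra.
exists (\matrix_(i, j) c (i, j), q) => [y|i j]; last first.
  by rewrite /= mxE; exact: (cP (i, j)).
move=> /= yc; apply: eA; split => // i j; rewrite /ball/=.
have := yc i j; rewrite !mxE; have := cP (i, j) => /= h1 h2.
rewrite (_ : x i j - y i j = (x i j - ratr (c (i, j))) - (y i j - ratr (c (i, j)))); last lra.
by rewrite (le_lt_trans (ler_normB _ _))//; lra.
Qed.

(** The Borel sets of matrices are generated by open sets, not defined as a product. An open set is
    a countable union of boxes, and a box is a finite intersection of conditions on single
    entries. *)
Lemma measurable_fun_mx d (T : measurableType d) m n (f : T -> 'M[R]_(m, n)) :
  (forall i j, measurable_fun setT (fun t => f t i j)) -> measurable_fun setT f.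
Proof.
move=> mf; apply: (@measurability _ _ _ _ setT f [set A | open A]) => //.
move=> _ [B oB <-]; rewrite setTI (open_mx_bigcup_box oB) preimage_bigcup.
rewrite bigcup_mkcond; apply: countable_bigcupT_measurable => // -[c e].
case: ifP => // _; rewrite [X in measurable X](_ : _ = \bigcap_i \bigcap_j
    ((fun t => f t i j) @^-1` [set x | `|x - ratr (c i j)| < ratr e])); last first.
  by apply/seteqP; split=> [t tc i _ j _|t tc i j]; [exact: tc|exact: tc].
apply: fin_bigcap_measurable => // i _; apply: fin_bigcap_measurable => // j _.
rewrite -[X in measurable X]setTI; apply: mf => //.
rewrite (_ : [set x | _] = ball (ratr (c i j) : R) (ratr e)); first exact: measurable_ball.
by apply/seteqP; split=> x; rewrite /ball/= distrC.
Qed.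

Context d (T : measurableType d).

Lemma measurable_coord m n (f : T -> 'M[R]_(m, n)) i j :
  measurable_fun setT f -> measurable_fun setT (fun t => f t i j).
Proof.
by move=> mf; exact: (measurableT_comp (measurable_mx_coord i j) mf).
Qed.

Lemma measurable_mulmx m n k (f : T -> 'M[R]_(m, n)) (g : T -> 'M[R]_(n, k)) :
  measurable_fun setT f -> measurable_fun setT g ->
  measurable_fun setT (fun t => f t *m g t).
Proof.
move=> mf mg; apply: measurable_fun_mx => i j.
under eq_fun do rewrite mxE.
by apply: measurable_sum => l; apply: measurable_funM; exact: measurable_coord.
Qed.

Lemma measurable_addmx m n (f g : T -> 'M[R]_(m, n)) :
  measurable_fun setT f -> measurable_fun setT g ->
  measurable_fun setT (fun t => f t + g t).
Proof.
move=> mf mg; apply: measurable_fun_mx => i j.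
under eq_fun do rewrite mxE.
by apply: measurable_funD; exact: measurable_coord.
Qed.

Lemma measurable_scalemx m n (a : T -> R) (f : T -> 'M[R]_(m, n)) :
  measurable_fun setT a -> measurable_fun setT f ->
  measurable_fun setT (fun t => a t *: f t).
Proof.
move=> ma mf; apply: measurable_fun_mx => i j.
under eq_fun do rewrite mxE.
by apply: measurable_funM => //; exact: measurable_coord.
Qed.

Lemma measurable_oppmx m n (f : T -> 'M[R]_(m, n)) :
  measurable_fun setT f -> measurable_fun setT (fun t => - f t).
Proof.
move=> mf; under eq_fun do rewrite -scaleN1r.
exact: measurable_scalemx.
Qed.

Lemma measurable_trmx m n (f : T -> 'M[R]_(m, n)) :
  measurable_fun setT f -> measurable_fun setT (fun t => (f t)^T).
Proof.
move=> mf; apply: measurable_fun_mx => i j.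
by under eq_fun do rewrite mxE; exact: measurable_coord.
Qed.

Lemma measurable_summx m n b (f : 'I_b -> T -> 'M[R]_(m, n)) :
  (forall j, measurable_fun setT (f j)) ->
  measurable_fun setT (fun t => \sum_(j < b) f j t).
Proof.
move=> mf; apply: measurable_fun_mx => i j.
under eq_fun do rewrite summxE.
by apply: measurable_sum => k; exact: measurable_coord.
Qed.

Lemma measurable_dot n (f g : T -> 'cV[R]_n) :
  measurable_fun setT f -> measurable_fun setT g ->
  measurable_fun setT (fun t => dot (f t) (g t)).
Proof.
move=> mf mg; apply: measurable_sum => l.
by apply: measurable_funM; exact: measurable_coord.
Qed.

Lemma measurable_enorm n (f : T -> 'cV[R]_n) :
  measurable_fun setT f -> measurable_fun setT (fun t => enorm (f t)).
Proof.
move=> mf; under eq_fun do rewrite enormE.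
apply: measurableT_comp; last exact: measurable_dot.
by apply: continuous_measurable_fun; exact: sqrt_continuous.
Qed.

End measurable_matrices.

(** * The quotient of Gamma functions *)

Section gamma_integral.
Variable R : realType.
Notation leb := (@lebesgue_measure R).
Implicit Types s t : R.

Let igrd s t : R := t `^ (s - 1) * expR (- t).
(** Extended-valued, because finiteness is deduced only later, from the functional equation
    itself. *)
Let eGamma s : \bar R := (\int[leb]_(t in `]0%R, +oo[) (igrd s t)%:E)%E.
(** Compact intervals exhausting ]0, +oo[, away from the singularity at 0. The right end is [n.+2]
    so that the interval is nondegenerate already at n = 0. *)
Let K (n : nat) : set R := `[n.+1%:R^-1, n.+2%:R]%classic.

Let igrd_ge0 s t : 0 <= igrd s t.
Proof. by rewrite mulr_ge0 ?powR_ge0 ?expR_ge0. Qed.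

Let measurable_igrd s (D : set R) : measurable_fun D (fun t => (igrd s t)%:E).
Proof.
apply/measurable_EFinP; apply: (@measurable_funS _ _ _ _ setT) => //.
apply: measurable_funM; first exact: measurable_powR.
by apply: measurableT_comp => //; exact: measurable_oppr.
Qed.

Let bigcup_K : \bigcup_n K n = `]0, +oo[%classic.
Proof.
apply/seteqP; split=> [t [n _]|t].
  rewrite /K/= !in_itv/= andbT => /andP[+ _]; apply: lt_le_trans.
  by rewrite invr_gt0 ltr0n.
rewrite /= in_itv/= andbT => t0.
exists (maxn (Num.truncn t^-1) (Num.truncn t)) => //; rewrite /K/= in_itv/=.
apply/andP; split.
  rewrite -[leRHS]invrK lef_pV2 ?posrE ?invr_gt0 ?ltr0n//.
  by rewrite (le_trans (ltW (truncnS_gt _)))// ler_nat ltnS leq_maxl.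
by rewrite (le_trans (ltW (truncnS_gt _)))// ler_nat ltnS ltnW// ltnS leq_maxr.
Qed.

Let ndK : nondecreasing_seq K.
Proof.
apply/nondecreasing_seqP => n; rewrite subsetEset => t; rewrite /K/= !in_itv/=.
move=> /andP[h1 h2]; apply/andP; split.
  by rewrite (le_trans _ h1)// lef_pV2 ?posrE ?ltr0n// ler_nat.
by rewrite (le_trans h2)// ler_nat.
Qed.

Let cvg_K s : (\int[leb]_(t in K n) (igrd s t)%:E)%E @[n --> \oo] --> eGamma s.
Proof.
rewrite /eGamma -bigcup_K; apply: ge0_nondecreasing_set_cvg_integral => //.
- by move=> n; exact: measurable_itv.
- by move=> n; exact: measurable_igrd.
- by move=> n t _; rewrite lee_fin igrd_ge0.
Qed.

(** The functional equation up to a boundary term, with -exp(-t) as antiderivative; the next two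
    facts make the boundary term vanish in the limit. *)
Let by_parts_K s n : 0 < s ->
  (\int[leb]_(t in K n) (igrd (s + 1) t)%:E = 
   (igrd (s + 1) n.+1%:R^-1 - igrd (s + 1) n.+2%:R)%:E +
   s%:E * \int[leb]_(t in K n) (igrd s t)%:E)%E.
Proof.
move=> s0; have ab : n.+1%:R^-1 < n.+2%:R :> R.
  by rewrite (@le_lt_trans _ _ 1)// ?ltr1n// invf_le1// ler1n.
have a0 : 0 < n.+1%:R^-1 :> R by rewrite invr_gt0 ltr0n.
have pos t : t \in `[n.+1%:R^-1 : R, n.+2%:R] -> 0 < t.
  by rewrite in_itv/= => /andP[h _]; exact: lt_le_trans h.
have within_derivable (h h' : R -> R) :
    (forall t, 0 < t -> is_derive t 1 h (h' t)) ->
    {within `[n.+1%:R^-1 : R, n.+2%:R], continuous h}.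
  move=> dh; apply: continuous_in_subspaceT => t; rewrite inE => /pos/dh[dht _].
  exact/differentiable_continuous/derivable1_diffP.
have LR_derivable (h h' : R -> R) :
    (forall t, 0 < t -> is_derive t 1 h (h' t)) ->
    derivable_oo_LRcontinuous h (n.+1%:R^-1) n.+2%:R.
  move=> dh; split=> [t /subset_itv_oo_cc/pos/dh[]//| |].
  - apply: cvg_at_right_filter; have [dht _] := dh _ a0.
    exact/differentiable_continuous/derivable1_diffP.
  - apply: cvg_at_left_filter; have [dht _] := dh n.+2%:R (ltr0Sn _ _).
    exact/differentiable_continuous/derivable1_diffP.
have dpow p t : 0 < t -> is_derive t 1 (fun t => t `^ p) (p * t `^ (p - 1)).
  exact: is_derive1_powR.
have dcpow p t : 0 < t -> is_derive t 1 (fun t => s * t `^ p) (s * (p * t `^ (p - 1))).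
  by move=> /(dpow p) d; apply: is_deriveZ.
have dexp t : is_derive t 1 (fun t => expR (- t)) (- expR (- t)).
  have := @is_derive1_comp R expR -%R t _ _ (is_derive_expR _) (is_deriveNid _ _).
  by rewrite mulrN1.
have dexpN t : 0 < t -> is_derive t 1 (fun t => - expR (- t)) (expR (- t)).
  by move=> _; rewrite -[X in is_derive _ _ _ X]opprK; exact: is_deriveN.
have := @integration_by_parts R (fun t => t `^ s) (fun t => - expR (- t))
  (fun t => s * t `^ (s - 1)) (fun t => expR (- t)) _ _ ab
  (within_derivable _ _ (dcpow _)) (LR_derivable _ _ (dpow _)) _
  (within_derivable _ _ (fun t _ => dexp t)) (LR_derivable _ _ dexpN) _.
rewrite /K /igrd addrK => ->.
- rewrite !mulrN opprK (addrC (- _)); congr (_ + _)%E.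
  rewrite -ge0_integralZl//=; last 3 first.
  + exact: measurable_igrd.
  + by move=> t _; rewrite lee_fin igrd_ge0.
  + by rewrite lee_fin ltW.
  transitivity (- \int[leb]_(x in `[n.+1%:R^-1%R, n.+2%:R])
      - (s%:E * (x `^ (s - 1) * expR (- x))%:E))%E.
    congr (- _)%E; apply: eq_integral => t _.
    by rewrite -EFinM -EFinN mulrN -mulrA.
  rewrite integral_ge0N ?oppeK// => t _.
  by rewrite -EFinM lee_fin mulr_ge0 ?igrd_ge0// ltW.
- by move=> t /subset_itv_oo_cc/pos/(dpow s) d; rewrite derive1E derive_val.
- by move=> t /subset_itv_oo_cc/pos/dexpN d; rewrite derive1E derive_val.
Qed.

Let igrdS_cvg_0 s : 0 < s -> igrd (s + 1) n.+1%:R^-1 @[n --> \oo] --> 0.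
Proof.
move=> s0; apply: (@squeeze_cvgr _ _ _ _ (fun=> 0) (fun n => n.+1%:R^-1 `^ s)).
- near=> n; rewrite igrd_ge0/= /igrd addrK ler_piMr ?powR_ge0//.
- exact: cvg_cst.
- have /cvg_at_rightP := powR_cvg0 s0; apply; split; last exact: cvg_harmonic.
  by move=> n; rewrite invr_gt0 ltr0n.
Unshelve. all: by end_near. Qed.

Let igrdS_cvg_y s : 0 < s -> igrd (s + 1) n.+2%:R @[n --> \oo] --> 0.
Proof.
(* For x = n + 2 and s <= m, the bound exp x >= x^(m+1) / (m+1)! gives x^s exp(-x) <= (m+1)! / x. *)
move=> s0; set m := (Num.truncn s).+1.
apply: (@squeeze_cvgr _ _ _ _ (fun=> 0) (fun n => m.+1`!%:R * n.+1%:R^-1)).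
- near=> n; rewrite igrd_ge0/= /igrd addrK.
  have sm : n.+2%:R `^ s <= n.+2%:R ^+ m :> R.
    by rewrite -powR_mulrn ?ler0n// ler_powR ?ler1n// ltW// truncnS_gt.
  have xe : n.+2%:R ^+ m.+1 / m.+1`!%:R <= expR n.+2%:R :> R.
    apply: le_trans (expR_ge1Dxn m (ler0n _ n.+2)).
    by rewrite lerDr ler01.
  have f0 : 0 < m.+1`!%:R :> R by rewrite ltr0n fact_gt0.
  have n0 : 0 < n.+2%:R :> R by rewrite ltr0n.
  rewrite expRN ler_pdivrMr ?expR_gt0// (le_trans sm)//.
  have : m.+1`!%:R / n.+1%:R * (n.+2%:R ^+ m.+1 / m.+1`!%:R) <=
         m.+1`!%:R / n.+1%:R * expR n.+2%:R :> R.
    by rewrite ler_wpM2l// divr_ge0// ltW.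
  apply: le_trans.
  have -> : m.+1`!%:R / n.+1%:R * (n.+2%:R ^+ m.+1 / m.+1`!%:R) =
            n.+2%:R / n.+1%:R * n.+2%:R ^+ m :> R.
    by rewrite exprS; field; rewrite gt_eqF//= gt_eqF// ltr0Sn.
  rewrite -[leLHS]mul1r.
  rewrite ler_wpM2r ?exprn_ge0 ?ler0n// ler_pdivlMr ?ltr0n// mul1r.
  by rewrite ler_nat.
- exact: cvg_cst.
- rewrite -(mulr0 m.+1`!%:R); apply: cvgMr; exact: cvg_harmonic.
Unshelve. all: by end_near. Qed.

Let eGammaS s : 0 < s -> eGamma (s + 1) = (s%:E * eGamma s)%E.
Proof.
move=> s0; rewrite -(cvg_lim _ (@cvg_K (s + 1)))//; apply: cvg_lim; first by [].
rewrite -[(s%:E * _)%E]add0e; under eq_fun do rewrite by_parts_K//.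
apply: cvgeD.
- by rewrite fin_num_adde_defr.
- apply: cvg_EFin; first exact: nearW.
  by rewrite -(subr0 0); apply: cvgB; [exact: igrdS_cvg_0|exact: igrdS_cvg_y].
- by apply: cvgeZl.
Qed.

Let eGamma_ge0 s : (0 <= eGamma s)%E.
Proof. by apply: integral_ge0 => t _; rewrite lee_fin igrd_ge0. Qed.

Let eGamma1 : eGamma 1 = 1%E.
Proof.
rewrite /eGamma integral_itv_obnd_cbnd; last exact: measurable_igrd.
transitivity (\int[leb]_(t in `[0%R, +oo[) (expR (- t))%:E)%E.
  by apply: eq_integral => t _; rewrite /igrd subrr powRr0 mul1r.
have dexpN t : is_derive t 1 (fun t => - expR (- t)) (expR (- t)).
  have := @is_derive1_comp R expR -%R t _ _ (is_derive_expR _) (is_deriveNid _ _).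
  by rewrite mulrN1 => /is_deriveN; rewrite opprK.
rewrite (@ge0_continuous_FTC2y R _ (fun t => - expR (- t)) 0 0).
- by rewrite oppr0 expR0 -EFinB opprK add0r.
- by move=> t _; exact: expR_ge0.
- apply: continuous_subspaceT => t; apply: continuous_comp; last exact: continuous_expR.
  exact: oppr_continuous.
- by rewrite -oppr0; apply: cvgN; exact: cvgr_expR.
- by move=> t _; have [] := dexpN t.
- apply: cvgN; apply: cvg_at_right_filter.
  apply: continuous_comp; last exact: continuous_expR.
  exact: oppr_continuous.
- by move=> t _; have d := dexpN t; rewrite derive1E derive_val.
Qed.

(** The functional equation transports finiteness both ways between s and s + 1, so all
    half-integers reduce to 1 and 1/2. *)
Let eGamma_fin (k : nat) : eGamma (k.+1%:R / 2) \is a fin_num.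
Proof.
have fS s : 0 < s -> (eGamma (s + 1) \is a fin_num) = (eGamma s \is a fin_num).
  move=> s0; rewrite eGammaS//; apply/idP/idP => [|fs]; last by rewrite fin_numM.
  rewrite !ge0_fin_numE ?mule_ge0 ?lee_fin ?(ltW s0)//.
  have := eGamma_ge0 s; case: (eGamma s) => [x _ _|_|//]; first exact: ltry.
  by rewrite gt0_muley ?lte_fin.
have f1 : eGamma 1 \is a fin_num by rewrite eGamma1.
have f2 : eGamma (1 + 1) \is a fin_num by rewrite fS.
suff : (eGamma (k.+1%:R / 2) \is a fin_num) /\ (eGamma (k.+2%:R / 2) \is a fin_num).
  by case.
elim: k => [|k [IH1 IH2]]; last first.
  split; first exact: IH2.
  have -> : k.+3%:R / 2 = k.+1%:R / 2 + 1 :> R.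
    by rewrite -(addn2 k.+1) natrD mulrDl divff.
  by rewrite fS ?IH1// divr_gt0.
have -> : 2 / 2 = 1 :> R by rewrite divff.
split; last exact: f1.
have h0 : 0 < 1 / 2 :> R by rewrite divr_gt0.
(* The question at 1/2 is moved to 3/2, where t^(1/2) <= 1 + t bounds the integral by that at 1 plus
   that at 2. *)
rewrite -(fS _ h0).
rewrite ge0_fin_numE//; apply: (@le_lt_trans _ _ (eGamma 1 + eGamma (1 + 1))%E).
  rewrite /eGamma -ge0_integralD//=; first last.
  - exact: measurable_igrd.
  - by move=> t _; rewrite lee_fin igrd_ge0.
  - exact: measurable_igrd.
  - by move=> t _; rewrite lee_fin igrd_ge0.
  apply: ge0_le_integral => //=.
  - by move=> t _; rewrite lee_fin igrd_ge0.
  - exact: measurable_igrd.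
  - by apply: emeasurable_funD; exact: measurable_igrd.
  move=> t; rewrite in_itv/= andbT => t0; rewrite lee_fin /igrd -mulrDl.
  rewrite ler_wpM2r ?expR_ge0// !addrK subrr powRr0 powRr1 ?(ltW t0)//.
  have [t1|/ltW t1] := leP t 1.
    rewrite (@le_trans _ _ (1 `^ (1 / 2)))//; last by rewrite powR1 lerDl ltW.
    by rewrite ge0_ler_powR ?nnegrE ?divr_ge0// ltW.
  rewrite (@le_trans _ _ (t `^ 1))//; last by rewrite powRr1 ?(ltW t0)// lerDr.
  by rewrite ler_powR// ler_pdivrMr// mul1r ler1n.
by rewrite lte_add_pinfty// ltey_eq ?f1 ?f2.
Qed.

(* log-convexity, by integrating [2 sqrt(s t) <= s + t] against
   [t^(s-1) exp(-t)]. *)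
Let eGamma_half s : 0 < s ->
  ((2 * Num.sqrt s)%:E * eGamma (s + 1 / 2) <= s%:E * eGamma s + eGamma (s + 1))%E.
Proof.
move=> s0.
rewrite /eGamma -!ge0_integralZl ?lee_fin ?mulr_ge0 ?sqrtr_ge0 ?(ltW s0)//=; last first.
- by move=> t _; rewrite lee_fin igrd_ge0.
- exact: measurable_igrd.
- by move=> t _; rewrite lee_fin igrd_ge0.
- exact: measurable_igrd.
rewrite -ge0_integralD//=; first last.
- exact: measurable_igrd.
- by move=> t _; rewrite lee_fin igrd_ge0.
- by apply: measurable_funeM; exact: measurable_igrd.
- by move=> t _; rewrite -EFinM lee_fin mulr_ge0 ?(ltW s0)// igrd_ge0.
apply: ge0_le_integral => //=.
- by move=> t _; rewrite -EFinM lee_fin mulr_ge0 ?igrd_ge0 ?mulr_ge0 ?sqrtr_ge0.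
- by apply: measurable_funeM; exact: measurable_igrd.
- by apply: emeasurable_funD; [apply: measurable_funeM|]; exact: measurable_igrd.
move=> t; rewrite in_itv/= andbT => t0.
rewrite -!EFinM -EFinD lee_fin /igrd !mulrA -mulrDl ler_wpM2r ?expR_ge0//.
have tD a b : t `^ (a + b) = t `^ a * t `^ b by rewrite powRD// (gt_eqF t0) implybT.
rewrite (_ : s + 1 / 2 - 1 = (s - 1) + 2^-1); last by rewrite mul1r addrAC.
rewrite (_ : s + 1 - 1 = (s - 1) + 1); last by rewrite addrAC.
rewrite (tD _ 2^-1) (tD _ 1) powRr1 ?(ltW t0)// powR12_sqrt ?(ltW t0)//.
rewrite [leRHS](_ : _ = t `^ (s - 1) * (s + t)); last by ring.
rewrite [leLHS](_ : _ = t `^ (s - 1) * (2 * Num.sqrt s * Num.sqrt t)); last by ring.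
rewrite ler_wpM2l ?powR_ge0//.
have := sqr_ge0 (Num.sqrt s - Num.sqrt t).
have := sqr_sqrtr (ltW s0); have := sqr_sqrtr (ltW t0).
by move: (Num.sqrt s) (Num.sqrt t) => a b; nra.
Qed.

(** Shifted by one so that every index gives a positive argument. *)
Let gamma k : R := Gamma (k.+1%:R / 2).

Let gammaE k : (gamma k)%:E = eGamma (k.+1%:R / 2).
Proof. by rewrite /gamma /Gamma /Rintegral fineK// eGamma_fin. Qed.

Let gamma_ge0 k : 0 <= gamma k.
Proof. by rewrite -lee_fin gammaE eGamma_ge0. Qed.

Let gammaSS k : gamma k.+2 = k.+1%:R / 2 * gamma k.
Proof.
have s0 : 0 < k.+1%:R / 2 :> R by rewrite divr_gt0.
apply: EFin_inj; rewrite EFinM !gammaE -(eGammaS s0).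
by rewrite -(addn2 k.+1) natrD mulrDl divff.
Qed.

(** At s = (k+1)/2 the functional equation makes the right side of [eGamma_half] equal to 2 s
    [gamma k]; it remains to divide by 2 sqrt s. *)
Let gammaS_le k : gamma k.+1 <= Num.sqrt (k.+1%:R / 2) * gamma k.
Proof.
set s := k.+1%:R / 2; have s0 : 0 < s by rewrite divr_gt0.
suff : 2 * Num.sqrt s * gamma k.+1 <= s * gamma k + gamma k.+2.
  have q0 : 0 < Num.sqrt s by rewrite sqrtr_gt0.
  have sE : s = Num.sqrt s * Num.sqrt s by rewrite -expr2 sqr_sqrtr ?(ltW s0).
  rewrite gammaSS -/s {2 3}sE => h; rewrite -(ler_pM2l (mulr_gt0 (ltr0Sn R 1) q0)).
  by apply: le_trans h _; rewrite le_eqVlt; apply/orP; left; apply/eqP; ring.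
have g0 : eGamma s = (gamma k)%:E by rewrite gammaE.
have g1 : eGamma (s + 1 / 2) = (gamma k.+1)%:E.
  have -> : s + 1 / 2 = k.+2%:R / 2 by rewrite /s -(addn1 k.+1) natrD mulrDl.
  by rewrite gammaE.
have g2 : eGamma (s + 1) = (gamma k.+2)%:E.
  have -> : s + 1 = k.+3%:R / 2 by rewrite /s -(addn2 k.+1) natrD mulrDl divff.
  by rewrite gammaE.
by have := eGamma_half s0; rewrite g0 g1 g2 -!EFinM -EFinD lee_fin.
Qed.

(** All that the identification of the Gamma quotient uses: the value at 1, positivity in the weak
    sense, the functional equation and one consequence of log-convexity. *)
Lemma Gamma_half_recurrence :
  [/\ Gamma (2 / 2) = 1 :> R,
      forall k, 0 <= Gamma (k.+1%:R / 2) :> R,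
      forall k, Gamma (k.+3%:R / 2) = k.+1%:R / 2 * Gamma (k.+1%:R / 2) :> R &
      forall k, Gamma (k.+2%:R / 2) <=
                Num.sqrt (k.+1%:R / 2) * Gamma (k.+1%:R / 2) :> R].
Proof.
split; [|exact: gamma_ge0|exact: gammaSS|exact: gammaS_le].
by apply: EFin_inj; rewrite (gammaE 1) divff// eGamma1.
Qed.

End gamma_integral.

(** * Asymptotic characterization of the Gamma quotient *)

Section gamma_quotient.
Variable R : realType.

Let gamma (k : nat) : R := Gamma (k.+1%:R / 2).

#[local] Opaque Gamma.

Let gamma1 : gamma 1 = 1.
Proof. by have [] := Gamma_half_recurrence R. Qed.

Let gamma_ge0 k : 0 <= gamma k.
Proof. by have [_ h _ _] := Gamma_half_recurrence R; exact: h. Qed.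

Let gammaSS k : gamma k.+2 = k.+1%:R / 2 * gamma k.
Proof. by have [_ _ h _] := Gamma_half_recurrence R; exact: h. Qed.

Let gammaS_le k : gamma k.+1 <= Num.sqrt (k.+1%:R / 2) * gamma k.
Proof. by have [_ _ _ h] := Gamma_half_recurrence R; exact: h. Qed.

(** The recurrence carries positivity from [gamma 1] to the odd indices; at an even index,
    [gammaS_le] bounds a positive quantity by a multiple of [gamma] there. *)
Let gamma_gt0 k : 0 < gamma k.
Proof.
have odd_gt0 m : 0 < gamma m.*2.+1.
  elim: m => [|m IH]; last by rewrite doubleS gammaSS mulr_gt0 ?divr_gt0.
  by rewrite gamma1.
rewrite -(odd_double_half k); case: (odd k); rewrite ?add1n ?add0n//.
have := lt_le_trans (odd_gt0 k./2) (gammaS_le _).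
by rewrite pmulr_rgt0// sqrtr_gt0 divr_gt0.
Qed.

Let rat k := gamma k.+1 / gamma k.

Let ratSS k : rat k.+2 = k.+2%:R / k.+1%:R * rat k.
Proof.
rewrite /rat !gammaSS; field.
by rewrite -!(natrD _ 1) ?pnatr_eq0 !gt_eqF ?gamma_gt0.
Qed.

Let rat_gt0 k : 0 < rat k.
Proof. by rewrite divr_gt0 ?gamma_gt0. Qed.

Let sqr_rat_le k : rat k ^+ 2 <= k.+1%:R / 2.
Proof.
have h0 : 0 <= k.+1%:R / 2 :> R by rewrite divr_ge0.
rewrite -[leRHS](sqr_sqrtr h0) ler_pXn2r ?nnegrE ?sqrtr_ge0 ?(ltW (rat_gt0 k))//.
by rewrite ler_pdivrMr ?gamma_gt0// gammaS_le.
Qed.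

(** Since [rat k] times [rat k.+1] is (k+1)/2, the upper bound at k + 1 is a lower bound at k. *)
Let sqr_rat_ge k : k.+1%:R ^+ 2 / 2 / k.+2%:R <= rat k ^+ 2.
Proof.
have e : rat k * rat k.+1 = k.+1%:R / 2.
  by rewrite /rat gammaSS; field; rewrite !gt_eqF ?gamma_gt0.
have := sqr_rat_le k.+1; rewrite ler_pdivrMr ?ltr0n//.
rewrite -(ler_pM2l (exprn_gt0 2 (rat_gt0 k))) -exprMn e => h.
have -> : k.+1%:R ^+ 2 / 2 = 2 * (k.+1%:R / 2) ^+ 2 :> R by field.
by have := ltr0n R k.+2; lra.
Qed.

(* The Gamma quotient is the only solution of the moment recurrence which is
   asymptotic to 1, as in the Bohr-Mollerup theorem. *)
Lemma gamma_quotient_unique (r d : nat) (k : nat -> R) :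
    (0 < r)%N -> (r <= d)%N ->
    (forall m, (r + m.*2)%:R / (d + m.*2)%:R <= k m <= 1) ->
    (forall m, k m.+1 = (r + m.*2.+1)%:R * (d + m.*2)%:R /
                        ((d + m.*2.+1)%:R * (r + m.*2)%:R) * k m) ->
  tau R d r = Num.sqrt (d%:R / r%:R) * k 0%N.
Proof.
case: r => // r; case: d => // d _ rd kb kS.
rewrite /tau; congr (_ * _).
rewrite -/(gamma r.+1) -/(gamma d) -/(gamma r) -/(gamma d.+1).
have kgt0 m : 0 < k m.
  by case/andP: (kb m) => + _; apply: lt_le_trans; rewrite divr_gt0// ltr0n.
(* [c] compares [k 0] with the value that the Gamma quotient predicts. By [cE] it keeps the same
   form after a shift of both indices by 2m, so letting m grow determines it. *)
pose c := k 0%N * rat d / rat r.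
have c0 : 0 < c by exact: divr_gt0 (mulr_gt0 (kgt0 _) (rat_gt0 _)) (rat_gt0 _).
have cE m : c = k m * rat (d + m.*2) / rat (r + m.*2).
  elim: m => [|m IH]; first by rewrite !addn0.
  rewrite IH doubleS !addnS !ratSS kS !addnS !addSn; field.
  by rewrite -!natrD !nat1r !pnatr_eq0 (gt_eqF (rat_gt0 _)).
suff c1 : c = 1.
  have -> : k 0%N = c * (rat r / rat d).
    rewrite /c mulrA divfK; last by rewrite (gt_eqF (rat_gt0 r)).
    by rewrite mulfK// (gt_eqF (rat_gt0 d)).
  by rewrite c1 mul1r /rat invf_div mulf_div.
have arch (a b : R) : (forall m : nat, m%:R * a <= b) -> a <= 0.
  move=> h; rewrite leNgt; apply/negP => a0.
  have := h (Num.truncn (b / a)).+1; rewrite -ler_pdivlMr// leNgt => /negP; apply.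
  exact: truncnS_gt.
suff c2 : c ^+ 2 = 1 by apply/eqP; rewrite -(@eqrXn2 _ 2) ?expr1n ?c2 ?(ltW c0).
pose e : R := d%:R - r%:R; have e0 : 0 <= e by rewrite subr_ge0 ler_nat.
(* Both ends tend to 1 with an error of order 1/x. They combine the bounds on [k m] with those on
   [rat] at the two shifted indices, where the larger dimension is x + e. *)
have bnd m : let x := (r.+1 + m.*2)%:R in
    x / (x + e + 1) <= c ^+ 2 <= (x + e) * (x + 1) / x ^+ 2.
  move=> x; have x0 : 0 < x by rewrite ltr0n.
  have dE : (d.+1 + m.*2)%:R = x + e by rewrite /x /e !natrD -!natr1; ring.
  have := kb m; rewrite dE -/x => /andP[k1 k2].
  have := sqr_rat_le (d + m.*2); have := sqr_rat_ge (d + m.*2).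
  have := sqr_rat_le (r + m.*2); have := sqr_rat_ge (r + m.*2).
  rewrite -!addSn -(natr1 (r.+1 + _)%N) -(natr1 (d.+1 + _)%N) dE -/x.
  rewrite (cE m); move: (rat_gt0 (r + m.*2)) (rat_gt0 (d + m.*2)) (kgt0 m) k1 k2.
  move: (rat _) (rat _) (k m) => a b z a0 b0 z0 z1 z2 a1 a2 b1 b2.
  clearbody x e.
  have xe0 : 0 < x + e by rewrite ltr_wpDr.
  have xe1 : 0 < x + e + 1 by rewrite ltr_wpDr.
  have x1 : 0 < x + 1 by rewrite ltr_wpDr.
  rewrite !exprMn exprVn ler_pdivlMr ?exprn_gt0// ler_pdivrMr ?exprn_gt0//.
  apply/andP; split.
    apply: (@le_trans _ _ (x / (x + e + 1) * (x / 2))).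
      by rewrite ler_wpM2l// divr_ge0// ltW.
    rewrite [leLHS](_ : _ = (x / (x + e)) ^+ 2 * ((x + e) ^+ 2 / 2 / (x + e + 1))); last first.
      by field; rewrite !gt_eqF.
    rewrite ler_pM// ?exprn_ge0 ?divr_ge0 ?mulr_ge0 ?exprn_ge0 ?(ltW xe0) ?(ltW xe1)
        ?(ltW x0)//.
    by rewrite ler_pXn2r ?nnegrE ?divr_ge0 ?(ltW x0) ?(ltW xe0) ?(ltW z0).
  apply: (@le_trans _ _ ((x + e) * (x + 1) / x ^+ 2 * (x ^+ 2 / 2 / (x + 1)))); last first.
    by rewrite ler_wpM2l// divr_ge0 ?exprn_ge0 ?mulr_ge0// ltW.
  rewrite [leRHS](_ : _ = 1 * ((x + e) / 2)); last by field; rewrite !gt_eqF.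
  by rewrite ler_pM ?exprn_ge0 ?(ltW z0) ?(ltW b0)// exprn_ile1 ?(ltW z0).
have xm m : m%:R <= (r.+1 + m.*2)%:R :> R.
  by rewrite ler_nat -addnn addnA leq_addl.
apply/eqP; rewrite eq_le; apply/andP; split.
- rewrite -subr_le0; apply: (arch _ (2 * e + 1)) => m.
  have := bnd m; have := xm m; set x := ((r.+1 + m.*2)%:R : R) => mx /andP[_].
  have x1 : 1 <= x by rewrite ler1n.
  clearbody x e.
  rewrite ler_pdivlMr ?exprn_gt0 ?(lt_le_trans _ x1)// => h.
  have [h0|/ltW h0] := leP (c ^+ 2 - 1) 0.
    by have := mulr_ge0_le0 (ler0n R m) h0; lra.
  have : x * (c ^+ 2 - 1) <= 2 * e + 1.
    rewrite -(@ler_pM2l _ x) ?(lt_le_trans _ x1)//.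
    by move: h; move: (c ^+ 2) => q; nra.
  by apply: le_trans; rewrite ler_wpM2r.
- rewrite -subr_le0; apply: (arch _ (c ^+ 2 * (e + 1))) => m.
  have := bnd m; have := xm m; set x := ((r.+1 + m.*2)%:R : R) => mx /andP[+ _].
  have x1 : 1 <= x by rewrite ler1n.
  clearbody x e.
  rewrite ler_pdivrMr => [h|]; last by lra.
  have [h0|/ltW h0] := leP (1 - c ^+ 2) 0.
    have := mulr_ge0_le0 (ler0n R m) h0; have := sqr_ge0 c.
    by move: (c ^+ 2) => q q0 q1; nra.
  have : x * (1 - c ^+ 2) <= c ^+ 2 * (e + 1).
    by move: h; move: (c ^+ 2) => q; nra.
  by apply: le_trans; rewrite ler_wpM2r.
Qed.

End gamma_quotient.

(** * Mean length of the projection by a Haar matrix *)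

Section bounded_expectation.
Context d (T : measurableType d) (R : realType).
Variables (nu : probability T R) (G : set T).
Hypotheses (mG : measurable G) (nuG : nu G = 1%E).

(** Boundedness is asked only on [G], which has full measure: the functions of interest are
    polynomials in the entries of a matrix, bounded on the matrices with orthonormal columns but not
    off them. *)
Definition bounded_measurable (f : T -> R) :=
  measurable_fun setT f /\ exists K : R, forall x, G x -> `|f x| <= K.

Definition expect (f : T -> R) : R := \int[nu]_(x in G) f x.

Lemma bounded_measurable_cst c : bounded_measurable (fun=> c).
Proof. by split=> //; exists `|c|. Qed.

Lemma bounded_measurableD f g : bounded_measurable f -> bounded_measurable g ->
  bounded_measurable (fun x => f x + g x).
Proof.
move=> [mf [K fK]] [mg [L gL]]; split; first exact: measurable_funD.
exists (K + L) => x Gx; rewrite (le_trans (ler_normD _ _))// lerD ?fK ?gL//.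
Qed.

Lemma bounded_measurableM f g : bounded_measurable f -> bounded_measurable g ->
  bounded_measurable (fun x => f x * g x).
Proof.
move=> [mf [K fK]] [mg [L gL]]; split; first exact: measurable_funM.
by exists (K * L) => x Gx; rewrite normrM ler_pM ?fK ?gL.
Qed.

Lemma bounded_measurableZ c f : bounded_measurable f ->
  bounded_measurable (fun x => c * f x).
Proof. exact/bounded_measurableM/bounded_measurable_cst. Qed.

Lemma bounded_measurableB f g : bounded_measurable f -> bounded_measurable g ->
  bounded_measurable (fun x => f x - g x).
Proof.
move=> bf bg; under eq_fun do rewrite -mulN1r.
by apply: bounded_measurableD => //; exact: bounded_measurableZ.
Qed.

Lemma bounded_measurableX f n : bounded_measurable f ->
  bounded_measurable (fun x => f x ^+ n).
Proof.
move=> bf; elim: n => [|n IH]; first exact: bounded_measurable_cst.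
by under eq_fun do rewrite exprS; exact: bounded_measurableM.
Qed.

Lemma bounded_measurable_sum n (f : 'I_n -> T -> R) :
  (forall i, bounded_measurable (f i)) ->
  bounded_measurable (fun x => \sum_(i < n) f i x).
Proof.
elim: n f => [|n IH] f bf.
  by under eq_fun do rewrite big_ord0; exact: bounded_measurable_cst.
under eq_fun do rewrite big_ord_recl.
by apply: bounded_measurableD => //; exact: IH.
Qed.

Lemma bounded_measurable_integrable f :
  bounded_measurable f -> nu.-integrable G (EFin \o f).
Proof.
move=> [mf [K fK]]; apply: measurable_bounded_integrable => //.
- exact: le_lt_trans (probability_le1 nu mG) (ltry _).
- exact: measurable_funTS.
- exists K; split=> [|y Ky x Gx]; first exact: num_real.
  by apply: le_trans (fK _ Gx) _; exact: ltW.
Qed.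

Lemma expect_cst c : expect (fun=> c) = c.
Proof.
rewrite /expect Rintegral_cst//.
have -> : fine (nu G) = 1 :> R by move: nuG => /= ->.
by rewrite mulr1.
Qed.

Lemma expectD f g : bounded_measurable f -> bounded_measurable g ->
  expect (fun x => f x + g x) = expect f + expect g.
Proof. by move=> bf bg; apply: RintegralD => //; exact: bounded_measurable_integrable. Qed.

Lemma expectB f g : bounded_measurable f -> bounded_measurable g ->
  expect (fun x => f x - g x) = expect f - expect g.
Proof. by move=> bf bg; apply: RintegralB => //; exact: bounded_measurable_integrable. Qed.

Lemma expectZ c f : bounded_measurable f ->
  expect (fun x => c * f x) = c * expect f.
Proof. by move=> bf; apply: RintegralZl => //; exact: bounded_measurable_integrable. Qed.

Lemma expect_sum n (f : 'I_n -> T -> R) :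
  (forall i, bounded_measurable (f i)) ->
  expect (fun x => \sum_(i < n) f i x) = \sum_(i < n) expect (f i).
Proof.
elim: n f => [|n IH] f bf.
  by under eq_fun do rewrite big_ord0; rewrite expect_cst big_ord0.
under eq_fun do rewrite big_ord_recl.
rewrite big_ord_recl expectD ?IH//.
exact: bounded_measurable_sum.
Qed.

Lemma eq_expect f g : (forall x, G x -> f x = g x) -> expect f = expect g.
Proof. by move=> fg; apply: eq_Rintegral => x /[1!inE] /fg. Qed.

Lemma le_expect f g : bounded_measurable f -> bounded_measurable g ->
  (forall x, G x -> f x <= g x) -> expect f <= expect g.
Proof. by move=> bf bg fg; apply: le_Rintegral => //;
    exact: bounded_measurable_integrable. Qed.

Lemma normr_expect_le f K : bounded_measurable f ->
  (forall x, G x -> `|f x| <= K) -> `|expect f| <= K.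
Proof.
move=> bf fK; rewrite ler_norml -(expect_cst K) -(expect_cst (- expect _)) expect_cst.
apply/andP; split; last first.
  by apply: le_expect => // [|x /fK]; [exact: bounded_measurable_cst|rewrite ler_norml =>
      /andP[]].
rewrite -mulN1r -expectZ; last exact: bounded_measurable_cst.
apply: le_expect => //; first exact/bounded_measurableZ/bounded_measurable_cst.
by move=> x /fK; rewrite ler_norml mulN1r => /andP[].
Qed.

Lemma expect_bounded_cvg (f_ : nat -> T -> R) (f : T -> R) (K : R) :
  (forall n, measurable_fun setT (f_ n)) -> measurable_fun setT f ->
  (forall n x, G x -> `|f_ n x| <= K) ->
  (forall x, G x -> f_ n x @[n --> \oo] --> f x) ->
  expect (f_ n) @[n --> \oo] --> expect f.
Proof.
move=> mf_ mf fK ff.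
have [] := @dominated_convergence _ _ _ nu G mG (fun n => EFin \o f_ n) (EFin \o f)
  (EFin \o cst K) _ _ _ _ _.
- by move=> n; apply/measurable_EFinP/measurable_funTS.
- by apply/measurable_EFinP/measurable_funTS.
- by apply: aeW => x Gx; apply: cvg_EFin; [exact: nearW|exact: ff].
- exact/bounded_measurable_integrable/bounded_measurable_cst.
- by apply: aeW => x Gx n; rewrite /= lee_fin fK.
move=> iF _ h; rewrite /expect /Rintegral; apply: fine_cvg.
by rewrite fineK//; exact: integrable_fin_num.
Qed.

End bounded_expectation.

(* Increases to the square root on [0, 1]; the first-order operator behind the
   moment recurrence, known on polynomials, passes to the limit because
   [s * (sqrt_poly n)^`().[s]] also converges, to [sqrt s / 2]. *)
Fixpoint sqrt_poly (R : realType) (n : nat) : {poly R} :=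
  if n is n'.+1 then
    sqrt_poly R n' + 2^-1 *: ('X - sqrt_poly R n' ^+ 2)
  else 0.

Section sqrt_poly.
Variable R : realType.
Let x (s : R) n := (sqrt_poly R n).[s ^+ 2].
Let y (s : R) n := s ^+ 2 * (sqrt_poly R n)^`().[s ^+ 2].

Let xS s n : x s n.+1 = x s n + (s ^+ 2 - x s n ^+ 2) / 2.
Proof. by rewrite /x /= !hornerE; ring. Qed.

Let yS s n : y s n.+1 = y s n * (1 - x s n) + s ^+ 2 / 2.
Proof.
rewrite /y /x /= derivD derivZ derivB derivX expr2 derivM !hornerE.
by field.
Qed.

(** For v in [0, s] the error after one step is (s - v)(1 - (s + v)/2), which is nonnegative because
    s + v <= 2. The bound of [y] by [x] makes both sequences uniformly bounded, as dominated
    convergence requires. *)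
Lemma sqrt_poly_bounds s n : 0 <= s -> s <= 1 ->
  [/\ 0 <= x s n, x s n <= s, 0 <= y s n & y s n <= x s n].
Proof.
move=> s0 s1; elim: n => [|n [x0 xs y0 yx]].
  by rewrite /x /y /= deriv0 !horner0 mulr0.
have x1 : x s n <= 1 by apply: le_trans s1.
rewrite xS yS; move: (x s n) (y s n) x0 xs y0 yx x1 => v w v0 vs w0 wv v1.
split.
- by rewrite addr_ge0// divr_ge0// subr_ge0 ler_pXn2r ?nnegrE.
- rewrite -subr_ge0 (_ : _ - _ = (s - v) * (1 - (s + v) / 2)); last by field.
  by apply: mulr_ge0; lra.
- by rewrite addr_ge0 ?mulr_ge0 ?subr_ge0// divr_ge0// exprn_ge0.
- rewrite -subr_ge0 (_ : _ - _ = (v - w) * (1 - v) + v ^+ 2 / 2); last by field.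
  by rewrite addr_ge0 ?mulr_ge0 ?subr_ge0// divr_ge0// exprn_ge0.
Qed.

(** The error of [x] contracts by 1 - (s + v)/2 <= 1 - s/2. That of [y] contracts by 1 - s and
    receives at most s q from the error of [x], q being the n-th power of 1 - s/2; the constant 4
    absorbs this, as 4 q (1 - s) + s q <= 4 q (1 - s/2). *)
Let errors s n : 0 <= s -> s <= 1 -> s - x s n <= s * (1 - s / 2) ^+ n /\
  `|y s n - s / 2| <= 4 * (1 - s / 2) ^+ n.
Proof.
move=> s0 s1; have rho0 : 0 <= 1 - s / 2 by lra.
elim: n => [|n [ex ey]].
  rewrite /x /y /= deriv0 !horner0 !expr0 mulr0 subr0 sub0r normrN.
  by split; [lra|rewrite ger0_norm; lra].
have [x0 xs y0 yx] := sqrt_poly_bounds n s0 s1.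
have q0 : 0 <= (1 - s / 2) ^+ n by rewrite exprn_ge0.
rewrite xS yS !(exprS (1 - s / 2)).
move: (x s n) (y s n) (_ ^+ n) x0 xs y0 yx ex ey q0 => v w q v0 vs w0 wv ev ew q0.
split.
  rewrite (_ : s - _ = (s - v) * (1 - (s + v) / 2)); last by field.
  rewrite (_ : s * _ = s * q * (1 - s / 2)); last by ring.
  by apply: ler_pM; lra.
rewrite (_ : _ - s / 2 = (w - s / 2) * (1 - s) + (s - v) * (w - s / 2 + s / 2)); last first.
  by field.
have w1 : `|w - s / 2 + s / 2| <= 1.
  by rewrite subrK ger0_norm//; lra.
rewrite (le_trans (ler_normD _ _))// !normrM (@ger0_norm _ (1 - s)); last lra.
rewrite (@ger0_norm _ (s - v)); last lra.
have h1 : `|w - s / 2| * (1 - s) <= 4 * q * (1 - s) by apply: ler_wpM2r; lra.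
have h2 : (s - v) * `|w - s / 2 + s / 2| <= s * q.
  by rewrite -[leRHS]mulr1; apply: ler_pM => //; lra.
have h3 : 0 <= s * q by rewrite mulr_ge0.
by lra.
Qed.

Lemma sqrt_poly_cvg s : 0 <= s -> s <= 1 ->
  x s n @[n --> \oo] --> s /\ y s n @[n --> \oo] --> s / 2.
Proof.
(* At s = 0 the geometric rate degenerates to 1, but the bounds then force both sequences to
   vanish. *)
move=> s0 s1; have [sE|sN0] := eqVneq s 0.
  have x0 n : x s n = 0.
    by have [h1 h2 _ _] := sqrt_poly_bounds n s0 s1; apply/eqP;
        rewrite eq_le h1 -[in leRHS]sE h2.
  have y0 n : y s n = 0.
    by have [_ _ h1 h2] := sqrt_poly_bounds n s0 s1; apply/eqP; rewrite eq_le h1 -(x0 n) h2.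
  rewrite (_ : x s = fun=> 0); last exact/funext.
  rewrite (_ : y s = fun=> 0); last exact/funext.
  by rewrite sE mul0r; split; exact: cvg_cst.
have rho : `|1 - s / 2| < 1.
  have s_gt0 : 0 < s by rewrite lt_neqAle eq_sym sN0.
  by rewrite ger0_norm; lra.
have cvg_of (u : nat -> R) (l : R) : (forall n, `|u n - l| <= 4 * (1 - s / 2) ^+ n) ->
    u n @[n --> \oo] --> l.
  move=> ul; apply/subr_cvg0; apply: norm_cvg0.
  apply: (@squeeze_cvgr _ _ _ _ (fun=> 0) (fun n => 4 * (1 - s / 2) ^+ n)).
  - by apply: nearW => n; rewrite normr_ge0 ul.
  - exact: cvg_cst.
  - by rewrite -(mulr0 4); apply: cvgMr; exact: cvg_expr.
split; apply: cvg_of => n; last by have [] := errors n s0 s1.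
have [x0 xs _ _] := sqrt_poly_bounds n s0 s1; have [h _] := errors n s0 s1.
rewrite distrC ger0_norm ?subr_ge0//; apply: le_trans h _.
by apply: ler_wpM2r; [rewrite exprn_ge0//; lra|lra].
Qed.

End sqrt_poly.

(** * Reflections and matrices with orthogonal columns *)

Section stiefel.
Variable R : realType.

Lemma dot_delta n i (y : 'cV[R]_n) : dot (delta_mx i 0) y = y i 0.
Proof.
rewrite /dot (bigD1 i)//= mxE !eqxx mul1r big1 ?addr0// => j ji.
by rewrite mxE (negbTE ji) mul0r.
Qed.

(** The reflection along v = x - y. Equal lengths give <v, v> = 2 <v, x>, so x is sent to x - v.
    This is how left invariance reaches every pair of vectors of the same length. *)
Lemma householder n (x y : 'cV[R]_n) : enorm x = enorm y ->
  exists2 U : 'M[R]_n, orthogonal_mx U & U *m x = y.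
Proof.
move=> xy; have [->|xNy] := eqVneq x y.
  by exists 1%:M; rewrite ?mul1mx// /orthogonal_mx trmx1 mulmx1.
pose v := x - y; pose c := dot v v.
have c0 : c != 0 by rewrite /c -sqr_enorm sqrf_eq0 enorm_eq0 subr_eq0.
pose W := v *m v^T; have Wz z : W *m z = dot v z *: v.
  by rewrite -mulmxA [v^T *m z]mx11_scalar -dotE mul_mx_scalar.
have WT : W^T = W by rewrite trmx_mul trmxK.
have WW : W *m W = c *: W by rewrite mulmxA Wz -scalemxAl.
exists (1%:M - (2 / c) *: W).
  have -> : orthogonal_mx (1%:M - (2 / c) *: W) =
      ((1%:M - (2 / c) *: W) *m (1%:M - (2 / c) *: W) = 1%:M).
    by rewrite /orthogonal_mx !linearB /= trmx1 linearZ /= WT.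
  rewrite mulmxBl mul1mx mulmxBr mulmx1 -scalemxAl -scalemxAr WW !scalerA.
  have -> : 2 / c * (2 / c) * c = 2 / c + 2 / c by field.
  by rewrite scalerDl opprB addrK subrK.
rewrite mulmxBl mul1mx -scalemxAl Wz scalerA.
suff -> : 2 / c * dot v x = 1 by rewrite scale1r /v subKr.
have cE : c = 2 * dot v x.
  rewrite /c /v !(dotDl, dotDr, dotNl, dotNr) (dotC y x).
  by have := sqr_enorm x; rewrite xy sqr_enorm => ->; ring.
have -> : 2 / c * dot v x = c / c by rewrite {2}cE; ring.
by rewrite divff.
Qed.

Lemma orthogonal_trmx n (U : 'M[R]_n) : orthogonal_mx U -> orthogonal_mx U^T.
Proof. by rewrite /orthogonal_mx trmxK => /mulmx1C. Qed.

(** By duality with the isometry: |X^T y|^2 = <y, X X^T y> <= |y| sqrt c |X^T y|. *)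
Lemma enorm_trmx_le n m (X : 'M[R]_(n, m)) c y : 0 <= c ->
  X^T *m X = c%:M -> enorm (X^T *m y) <= Num.sqrt c * enorm y.
Proof.
move=> c0 XX; have [->|p0] := eqVneq (enorm (X^T *m y)) 0.
  by rewrite mulr_ge0 ?sqrtr_ge0 ?enorm_ge0.
have {p0}p0 : 0 < enorm (X^T *m y) by rewrite lt_neqAle eq_sym p0 enorm_ge0.
rewrite -(ler_pM2r p0) -expr2 sqr_enorm dot_mull trmxK.
rewrite (le_trans (dot_le _ _))// (enorm_isometry _ c0 XX).
by rewrite mulrCA mulrA.
Qed.

End stiefel.

(** With a, b, c entries of X X^T, the base is |X^T (e_i + t e_j)|^2. What matters is that [K] does
    not depend on the coefficients, hence not on X. Where the truncated exponents [n.-1] and [n.-2]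
    differ from n - 1 and n - 2, their numerical factors vanish. *)
Lemma exprn_second_order (R : realType) n : exists2 K : R, 0 <= K &
  forall a b c t : R, `|a| <= 1 -> `|b| <= 1 -> `|c| <= 1 -> `|t| <= 1 ->
  `|(a + 2 * b * t + c * t ^+ 2) ^+ n -
    (a ^+ n + n%:R * a ^+ n.-1 * (2 * b) * t +
     (n%:R * a ^+ n.-1 * c + 2 * n%:R * n.-1%:R * b ^+ 2 * a ^+ n.-2) * t ^+ 2)|
  <= K * `|t| ^+ 3.
Proof.
elim: n => [|n [K K0 IH]].
  exists 0 => // a b c t _ _ _ _.
  by rewrite [X in `|X|](_ : _ = 0) ?normr0 ?mul0r// !expr0 /=; ring.
(* [C] bounds the terms of order at least 3 created by multiplying the expansion by the base; the
   factor 4 of [K] bounds the base itself. *)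
pose C : R := 2 * n%:R + 3 * (n%:R + 2 * n%:R * n.-1%:R).
exists (4 * K + C); first by rewrite addr_ge0 ?mulr_ge0// !addr_ge0// mulr_ge0//
    addr_ge0// !mulr_ge0.
move=> a b c t a1 b1 c1 t1.
set A1 := n%:R * a ^+ n.-1 * (2 * b).
set A2 := n%:R * a ^+ n.-1 * c + 2 * n%:R * n.-1%:R * b ^+ 2 * a ^+ n.-2.
have := IH a b c t a1 b1 c1 t1; rewrite -/A1 -/A2.
set E := (X in `|X|) => EK.
have -> : (a + 2 * b * t + c * t ^+ 2) ^+ n.+1 -
    (a ^+ n.+1 + n.+1%:R * a ^+ n.+1.-1 * (2 * b) * t +
     (n.+1%:R * a ^+ n.+1.-1 * c + 2 * n.+1%:R * n.+1.-1%:R * b ^+ 2 * a ^+ n.+1.-2) * t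
         ^+ 2) =
   E * (a + 2 * b * t + c * t ^+ 2) + t ^+ 3 * (A1 * c + 2 * b * A2 + t * (A2 * c)).
  rewrite /E /A1 /A2 [in LHS]exprS; move: ((a + 2 * b * t + c * t ^+ 2) ^+ n) => q.
  case: n {IH EK E A1 A2 C} => [|[|n]] /=; rewrite -?natr1 ?exprS; ring.
have an k : `|a ^+ k| <= 1 by rewrite normrX exprn_ile1.
have A1b : `|A1| <= 2 * n%:R.
  rewrite (_ : A1 = 2 * n%:R * (a ^+ n.-1 * b)); last by rewrite /A1; ring.
  rewrite normrM ger0_norm ?mulr_ge0// -[leRHS]mulr1 ler_wpM2l ?mulr_ge0//.
  by rewrite normrM mulr_ile1 ?normr_ge0.
have A2b : `|A2| <= n%:R + 2 * n%:R * n.-1%:R.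
  rewrite (le_trans (ler_normD _ _))// lerD//.
    rewrite -mulrA normrM ger0_norm// -[leRHS]mulr1 ler_wpM2l//.
    by rewrite normrM mulr_ile1 ?normr_ge0.
  rewrite -(mulrA (2 * n%:R * n.-1%:R)) normrM ger0_norm ?mulr_ge0//.
  rewrite -[leRHS]mulr1 ler_wpM2l ?mulr_ge0//.
  by rewrite normrM mulr_ile1 ?normr_ge0// normrX exprn_ile1.
have q4 : `|a + 2 * b * t + c * t ^+ 2| <= 4.
  rewrite (le_trans (ler_normD _ _))// (_ : 4 = 1 + 2 + 1); last by ring.
  rewrite lerD ?(le_trans (ler_normD _ _)) ?lerD//.
    rewrite !normrM ger0_norm// -mulrA -[leRHS]mulr1 ler_wpM2l//.
    by rewrite mulr_ile1 ?normr_ge0.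
  by rewrite normrM mulr_ile1 ?normr_ge0// normrX exprn_ile1.
rewrite (le_trans (ler_normD _ _))// [leRHS]mulrDl lerD//.
  rewrite normrM (le_trans (ler_pM _ _ EK q4))// le_eqVlt; apply/orP; left.
  by apply/eqP; ring.
rewrite normrM normrX mulrC ler_wpM2r ?exprn_ge0//.
rewrite (le_trans (ler_normD _ _))// /C.
have h1 : `|A1 * c| <= 2 * n%:R.
  by rewrite normrM -[leRHS]mulr1 ler_pM.
have h2 : `|2 * b * A2| <= 2 * (n%:R + 2 * n%:R * n.-1%:R).
  rewrite !normrM ger0_norm// -mulrA ler_wpM2l// -[leRHS]mul1r ler_pM//.
have h3 : `|t * (A2 * c)| <= n%:R + 2 * n%:R * n.-1%:R.
  rewrite !normrM -[leRHS]mul1r ler_pM ?mulr_ge0//.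
  by rewrite -[leRHS]mulr1 ler_pM.
by have := ler_normD (A1 * c) (2 * b * A2); lra.
Qed.

Lemma measurable_stiefel (R : realType) d r (c : R) :
  measurable [set X : 'M[R]_(d, r) | X^T *m X = c%:M].
Proof.
have -> : [set X : 'M[R]_(d, r) | X^T *m X = c%:M] = \bigcap_(i : 'I_r) \bigcap_(j : 'I_r)
    ((fun X : 'M[R]_(d, r) => (X^T *m X) i j) @^-1` [set (c%:M : 'M[R]_r) i j]).
  apply/seteqP; split=> [X GX i _ j _|X h]; first by rewrite /= GX.
  by apply/matrixP => i j; exact: h.
apply: fin_bigcap_measurable => // i _; apply: fin_bigcap_measurable => // j _.
rewrite -[X in measurable X]setTI.
suff h : measurable_fun setT (fun X : 'M[R]_(d, r) => (X^T *m X) i j).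
  by apply: h => //; exact: measurable_set1.
apply: measurable_coord; apply: measurable_mulmx; last exact: measurable_id.
exact/measurable_trmx/measurable_id.
Qed.

(** * Moments under a left-invariant law on orthonormal frames *)

Section invariant_law.
Variables (R : realType) (d r : nat) (nu : probability 'M[R]_(d, r) R).
Hypothesis nu_inv : forall (U : 'M[R]_d) (A : set 'M[R]_(d, r)),
  orthogonal_mx U -> measurable A -> nu ((fun X => U *m X) @^-1` A) = nu A.
Let G := [set X : 'M[R]_(d, r) | X^T *m X = 1%:M].
Hypothesis nuG : nu G = 1%E.

Let measurable_G : measurable G.
Proof. exact: measurable_stiefel. Qed.

Let measurable_trmx_mul (y : 'cV[R]_d) :
  measurable_fun setT (fun X : 'M[R]_(d, r) => X^T *m y).
Proof. by apply: measurable_mulmx => //; exact/measurable_trmx/measurable_id. Qed.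

(** If U is orthogonal with U x = y, then X^T y = (U^T X)^T x, and U^T X has the law of X. *)
Lemma integral_trmx_mul_enorm (f : 'cV[R]_r -> \bar R) x y :
    measurable_fun setT f -> (forall z, 0 <= f z)%E -> enorm x = enorm y ->
  (\int[nu]_X f (X^T *m x) = \int[nu]_X f (X^T *m y))%E.
Proof.
move=> mf f0 /householder[U oU <-].
have mU : measurable_fun setT (fun X : 'M[R]_(d, r) => U^T *m X).
  by apply: measurable_mulmx; [exact: measurable_cst|exact: measurable_id].
transitivity (\int[pushforward nu (fun X => U^T *m X)]_X f (X^T *m x))%E.
  apply: eq_measure_integral => A mA _.
  by rewrite /pushforward; symmetry; apply: nu_inv => //; exact: orthogonal_trmx.
rewrite ge0_integral_pushforward//=; last first.
  by apply: measurableT_comp.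
rewrite preimage_setT; apply: eq_integral => X _ /=.
by rewrite trmx_mul trmxK mulmxA.
Qed.

Notation bm := (bounded_measurable G).
Notation E := (expect nu G).

Lemma expect_setT (f : 'M[R]_(d, r) -> R) : measurable_fun setT f ->
  (forall X, 0 <= f X) -> (\int[nu]_X (f X)%:E = \int[nu]_(X in G) (f X)%:E)%E.
Proof.
move=> mf f0; rewrite (@ge0_negligible_integral _ _ _ nu setT (~` G))//=.
- by rewrite setTD setCK.
- exact: measurableC.
- by apply/measurable_EFinP.
- by move=> X _; rewrite lee_fin.
- by move: nuG => /= nuG'; rewrite probability_setC// nuG' subee.
Qed.

Variable i0 : 'I_d.
Let e (i : 'I_d) : 'cV[R]_d := delta_mx i 0.
(** Entry (i, j) of the projection X X^T. Its trace is r, and idempotence makes the squares of a row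
    sum to the diagonal entry; these are the two facts behind [sum_diag] and [sum_sqr_row]. *)
Let S i j (X : 'M[R]_(d, r)) := dot (X^T *m e i) (X^T *m e j).
Let a := S i0 i0.
Let M n := E (fun X => a X ^+ n).

Let S_le1 i j X : G X -> `|S i j X| <= 1.
Proof.
move=> GX; rewrite (le_trans (normr_dot_le _ _))// mulr_ile1 ?enorm_ge0//.
- by have := enorm_trmx_le (e i) ler01 GX; rewrite sqrtr1 mul1r enorm_delta.
- by have := enorm_trmx_le (e j) ler01 GX; rewrite sqrtr1 mul1r enorm_delta.
Qed.

Let bmS i j : bm (S i j).
Proof.
split; last by exists 1 => X; exact: S_le1.
by apply: measurable_dot; exact: measurable_trmx_mul.
Qed.

Let a_ge0 X : 0 <= a X. Proof. exact: dot_ge0. Qed.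

Let a_le1 X : G X -> a X <= 1.
Proof. by move=> /(S_le1 i0 i0); exact/le_trans/ler_norm. Qed.

Let sum_diag X : G X -> \sum_i S i i X = r%:R.
Proof.
move=> GX; transitivity (\tr (X^T *m X)); last by rewrite GX mxtrace1.
rewrite mxtrace_mulC /mxtrace; apply: eq_bigr => i _.
by rewrite /S -colE /dot mxE; apply: eq_bigr => k _; rewrite !mxE.
Qed.

Let sum_sqr_row X : G X -> \sum_i S i0 i X ^+ 2 = a X.
Proof.
move=> GX; have Xi z : enorm (X *m z) = enorm z.
  by rewrite (enorm_isometry _ ler01 GX) sqrtr1 mul1r.
rewrite /a /S -sqr_enorm -Xi sqr_enorm; apply: eq_bigr => i _.
rewrite -expr2; congr (_ ^+ 2).
by rewrite dotC dot_mull trmxK dot_delta.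
Qed.

Let expect_pow n y :
  E (fun X => dot (X^T *m y) (X^T *m y) ^+ n) = dot y y ^+ n * M n.
Proof.
have mp z : measurable_fun setT (fun X : 'M[R]_(d, r) => dot (X^T *m z) (X^T *m z) ^+ n).
  by apply: measurable_funX; apply: measurable_dot; exact: measurable_trmx_mul.
have p0 k (z : 'cV[R]_k) : 0 <= dot z z ^+ n by rewrite exprn_ge0 ?dot_ge0.
transitivity (E (fun X => dot y y ^+ n * a X ^+ n)); last first.
  by rewrite expectZ//; exact/bounded_measurableX/bmS.
rewrite /expect /Rintegral -!expect_setT//; last 2 first.
- by apply: measurable_funM => //; exact: mp.
- by move=> X; rewrite mulr_ge0 ?p0 ?exprn_ge0.
congr fine; pose f (z : 'cV[R]_r) := (dot z z ^+ n)%:E.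
rewrite (@integral_trmx_mul_enorm f y (enorm y *: e i0)).
- apply: eq_integral => X _; rewrite /f -scalemxAr dotZl dotZr mulrA -expr2.
  by rewrite sqr_enorm exprMn.
- apply/measurable_EFinP; apply: measurable_funX.
  by apply: measurable_dot; exact: measurable_id.
- by move=> z; rewrite lee_fin.
- by rewrite enormZ enorm_delta mulr1 ger0_norm ?enorm_ge0.
Qed.

(** Both sides are the coefficient of t^2 in E |X^T (e_i0 + t e_j)|^(2n), which isotropy evaluates
    as (1 + t^2)^n [M n]. *)
Let expect_second_order n j : j != i0 ->
  E (fun X => n%:R * a X ^+ n.-1 * S j j X +
     2 * n%:R * n.-1%:R * S i0 j X ^+ 2 * a X ^+ n.-2) = n%:R * M n.
Proof.
move=> ji; have [K K0 HK] := exprn_second_order R n.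
set A2 := (X in E X); pose A1 X := n%:R * a X ^+ n.-1 * (2 * S i0 j X).
have bA1 : bm A1.
  by do ?[exact: bmS|apply: bounded_measurableM|apply: bounded_measurableX|
    exact: bounded_measurable_cst].
have bA2 : bm A2.
  by do ?[exact: bmS|apply: bounded_measurableD|apply: bounded_measurableM|
    apply: bounded_measurableX|exact: bounded_measurable_cst].
have bpow k : bm (fun X => a X ^+ k) by exact/bounded_measurableX/bmS.
have M0 : 0 <= M n.
  by apply: Rintegral_ge0 => X _; rewrite exprn_ge0.
have M1 : M n <= 1.
  rewrite -(expect_cst measurable_G nuG 1); apply: le_expect => //.
    exact: bounded_measurable_cst.
  by move=> X GX; rewrite exprn_ile1 ?a_le1.
have key t : `|t| <= 1 -> `|t * E A1 + t ^+ 2 * (E A2 - n%:R * M n)| <= 2 * K * `|t| ^+ 3.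
  move=> t1.
  have yy : dot (e i0 + t *: e j) (e i0 + t *: e j) = 1 + t ^+ 2.
    rewrite !(dotDl, dotDr, dotZl, dotZr) -!sqr_enorm !enorm_delta (dotC (e j)).
    by rewrite dot_delta !mxE eq_sym (negbTE ji)/=; ring.
  pose g X := (a X + 2 * S i0 j X * t + S j j X * t ^+ 2) ^+ n.
  have gE : E g = (1 + t ^+ 2) ^+ n * M n.
    rewrite -yy -expect_pow; apply: eq_expect => X _; congr (_ ^+ n).
    rewrite mulmxDr -scalemxAr !(dotDl, dotDr, dotZl, dotZr) /a /S.
    by rewrite (dotC (X^T *m e j)); ring.
  have bg : bm g.
    by do ?[exact: bmS|apply: bounded_measurableX|apply: bounded_measurableD|apply:
        bounded_measurableM
    |exact: bounded_measurable_cst].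
  pose h X := a X ^+ n + A1 X * t + A2 X * t ^+ 2.
  have bh : bm h.
    by do ?[exact: bA1|exact: bA2|exact: bpow|apply: bounded_measurableD|apply:
        bounded_measurableM
    |exact: bounded_measurable_cst].
  have gh : `|E (fun X => g X - h X)| <= K * `|t| ^+ 3.
    apply: normr_expect_le => //; first exact: bounded_measurableB.
    by move=> X GX; apply: HK => //; exact: S_le1.
  have hE : E h = M n + t * E A1 + t ^+ 2 * E A2.
    have bt f u : bm f -> bm (fun X => f X * u).
      by move=> bf; apply: bounded_measurableM => //; exact: bounded_measurable_cst.
    have Et f u : bm f -> E (fun X => f X * u) = u * E f.
      by move=> bf; rewrite -expectZ//; apply: eq_expect => X _; rewrite mulrC.
    rewrite /h expectD//; [|by apply: bounded_measurableD => //; exact: bt|exact: bt].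
    by rewrite expectD ?Et//; exact: bt.
  rewrite expectB// gE hE in gh.
  (* The same expansion with these coefficients is that of (1 + t^2)^n. *)
  have := HK 1 0 1 t; rewrite normr1 normr0 => /(_ (lexx _) ler01 (lexx _) t1).
  rewrite (_ : _ - _ = (1 + t ^+ 2) ^+ n - (1 + n%:R * t ^+ 2)); last first.
    by rewrite !expr1n expr0n /= !mulr0 !mul0r !addr0 !mul1r !mulr1.
  set q := (1 + t ^+ 2) ^+ n in gh * => h1.
  have h2 : `|(q - (1 + n%:R * t ^+ 2)) * M n| <= K * `|t| ^+ 3.
    by rewrite normrM (ger0_norm M0) -[leRHS]mulr1 ler_pM.
  have -> : t * E A1 + t ^+ 2 * (E A2 - n%:R * M n) =
      (q - (1 + n%:R * t ^+ 2)) * M n - (q * M n - (M n + t * E A1 + t ^+ 2 * E A2)).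
    by ring.
  by apply: le_trans (ler_normB _ _) _; lra.
set D := E A2 - n%:R * M n in key.
suff : D = 0 by move/eqP; rewrite subr_eq0 => /eqP.
(* Adding the estimates at t and -t cancels the odd term in [E A1], leaving t^2 D = O(t^3). *)
have DK t : 0 < t -> t <= 1 -> `|D| <= 2 * K * t.
  move=> t0 t1; have h1 := key t; have h2 := key (- t).
  rewrite normrN in h2; rewrite (gtr0_norm t0) in h1 h2.
  have {}h1 := h1 t1; have {}h2 := h2 t1.
  rewrite -(ler_pM2l (exprn_gt0 2 t0)) -{1}(gtr0_norm (exprn_gt0 2 t0)) -normrM.
  have : `|2 * (t ^+ 2 * D)| <= 2 * K * t ^+ 3 + 2 * K * t ^+ 3.
    apply: le_trans (lerD h1 h2); apply: le_trans (ler_normD _ _).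
    by rewrite le_eqVlt; apply/orP; left; apply/eqP; congr `|_|; ring.
  by rewrite (normrM 2) (@ger0_norm _ 2)// => h3; lra.
apply/eqP; rewrite -normr_le0 leNgt; apply/negP => D0.
(* Small enough that 2 K t < |D|; the summand 1 covers K = 0. *)
pose t := Num.min 1 (`|D| / (4 * K + 1)).
have K1 : 0 < 4 * K + 1 by rewrite ltr_wpDl ?mulr_ge0.
have t0 : 0 < t by rewrite lt_min ltr01 divr_gt0.
have t1 : t <= 1 by rewrite ge_min lexx.
have tD : t * (4 * K + 1) <= `|D| by rewrite -ler_pdivlMr// ge_min lexx orbT.
by have := DK t t0 t1; nra.
Qed.

(** [expect_second_order] at order m + 1 is summed over j. The d - 1 indices other than i0
    contribute equally, the term at i0 is explicit, and the trace and the row sums of X X^T evaluate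
    the total. *)
Lemma moment_recurrence m : (r + m.*2)%:R * M m = (d + m.*2)%:R * M m.+1.
Proof.
have bpow k : bm (fun X => a X ^+ k) by exact/bounded_measurableX/bmS.
have bA2 j : bm (fun X => m.+1%:R * a X ^+ m * S j j X +
     2 * m.+1%:R * m%:R * S i0 j X ^+ 2 * a X ^+ m.-1).
  by do ?[exact: bmS|apply: bounded_measurableD|apply: bounded_measurableM|
    apply: bounded_measurableX|exact: bounded_measurable_cst].
have sumE : \sum_j E (fun X => m.+1%:R * a X ^+ m * S j j X +
     2 * m.+1%:R * m%:R * S i0 j X ^+ 2 * a X ^+ m.-1) =
   m.+1%:R * ((r%:R + 2 * m%:R) * M m).
  rewrite -expect_sum// mulrA -expectZ//; apply: eq_expect => X GX.
  rewrite big_split/= -mulr_sumr sum_diag//.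
  under [X in _ + X]eq_bigr do rewrite mulrAC -mulrA mulrA mulrAC.
  rewrite -mulr_suml -mulr_sumr sum_sqr_row//.
  case: (m) => [|k]; rewrite /= ?exprS; ring.
move: sumE; rewrite (bigD1 i0)//=.
under eq_bigr => j ji do rewrite (expect_second_order m.+1 ji).
rewrite sumr_const cardC1 card_ord.
have -> : E (fun X => m.+1%:R * a X ^+ m * S i0 i0 X +
     2 * m.+1%:R * m%:R * S i0 i0 X ^+ 2 * a X ^+ m.-1) =
    m.+1%:R * (1 + 2 * m%:R) * M m.+1.
  rewrite -expectZ//; apply: eq_expect => X _; rewrite -/a.
  case: (m) => [|k]; rewrite /= ?exprS; ring.
have d0 : (0 < d)%N by case: (i0) => k; exact: leq_trans.
have dE : d.-1%:R = d%:R - 1 :> R by rewrite -{2}(prednK d0) -natr1 addrK.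
rewrite -[X in _ + X = _]mulr_natr dE => h.
have m0 : m.+1%:R != 0 :> R by rewrite pnatr_eq0.
apply: (mulfI m0); rewrite -muln2 !natrD natrM.
rewrite !(mulrC m%:R) -h.
by move: (M m.+1) => q; ring.
Qed.

(** [moment_recurrence] is the case of a monomial; linearity gives the rest. For r < d it is
    integration by parts against the Beta(r/2, (d-r)/2) density, in a form that never mentions the
    density. *)
Let expect_horner h :
  E (fun X => 2 * (1 - a X) * (a X * h^`().[a X]) + (r%:R - d%:R * a X) * h.[a X]) = 0.
Proof.
have bpoly (p : {poly R}) : bm (fun X => p.[a X]).
  under eq_fun do rewrite horner_coef.
  apply: bounded_measurable_sum => i; apply: bounded_measurableZ.
  exact/bounded_measurableX/bmS.
have bm1 p : bm (fun X => 2 * (1 - a X) * (a X * p^`().[a X]) + (r%:R - d%:R * a X) * p.[a X]).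
  by do ?[exact: bmS|exact: bpoly|apply: bounded_measurableB|apply: bounded_measurableD|
    apply: bounded_measurableM|exact: bounded_measurable_cst].
rewrite -(coefK h) poly_def.
apply: (big_ind (fun h : {poly R} => E (fun X => 2 * (1 - a X) * (a X * h^`().[a X]) +
   (r%:R - d%:R * a X) * h.[a X]) = 0)).
- rewrite -[RHS](expect_cst measurable_G nuG 0); apply: eq_expect => X _.
  by rewrite deriv0 !horner0 !mulr0 addr0.
- move=> p q p0 q0; rewrite -[RHS]addr0 -{1}p0 -q0 -expectD//.
  by apply: eq_expect => X _; rewrite derivD !hornerD; ring.
- move=> i _; rewrite -[RHS](mulr0 h`_i).
  transitivity (h`_i * E (fun X => (r + i.*2)%:R * a X ^+ i - (d + i.*2)%:R * a X ^+ i.+1)).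
    have bpow k : bm (fun X => a X ^+ k) by exact/bounded_measurableX/bmS.
    rewrite -expectZ//; last by apply: bounded_measurableB; exact: bounded_measurableZ.
    apply: eq_expect => X _; rewrite derivZ derivXn !hornerZ hornerMn !hornerXn.
    rewrite -muln2 !natrD !natrM -mulr_natl.
    case: (nat_of_ord i) => [|k]; rewrite /= ?exprS; ring.
  have bpow k : bm (fun X => a X ^+ k) by exact/bounded_measurableX/bmS.
  congr (_ * _); rewrite expectB//; try exact: bounded_measurableZ.
  by rewrite !expectZ// -!/(M _) moment_recurrence subrr.
Qed.

Let q X := Num.sqrt (a X).
Let N m := E (fun X => a X ^+ m * q X).

Let q0 X : 0 <= q X. Proof. exact: sqrtr_ge0. Qed.

Let sqr_q X : q X ^+ 2 = a X. Proof. by rewrite sqr_sqrtr. Qed.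

Let q_le1 X : G X -> q X <= 1.
Proof. by move=> /a_le1 a1; rewrite -sqrtr1 ler_wsqrtr. Qed.

Let bmq : bm q.
Proof.
split; last by exists 1 => X GX; rewrite ger0_norm ?q_le1.
rewrite (_ : q = fun X => enorm (X^T *m e i0)).
  by apply: measurable_enorm; exact: measurable_trmx_mul.
by apply/funext => X; rewrite enormE.
Qed.

(** The identity of [expect_horner] for h(a) = a^m sqrt a, where a h'(a) = (m + 1/2) h(a). This h is
    no polynomial, so [sqrt_poly] replaces the square root and dominated convergence takes the
    limit. *)
Let half_moment_recurrence m :
  (r + m.*2.+1)%:R * N m = (d + m.*2.+1)%:R * N m.+1.
Proof.
pose h n := 'X^m * sqrt_poly R n.
pose x n X := (sqrt_poly R n).[q X ^+ 2].
pose y n X := q X ^+ 2 * (sqrt_poly R n)^`().[q X ^+ 2].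
(* The integrand of [expect_horner] at h = a^m v, with w standing for a times the derivative of
   v. *)
pose F (v w : R) X := 2 * (1 - a X) * (m%:R * a X ^+ m * v + a X ^+ m * w) +
    (r%:R - d%:R * a X) * (a X ^+ m * v).
have FE n : (fun X => 2 * (1 - a X) * (a X * (h n)^`().[a X]) +
    (r%:R - d%:R * a X) * (h n).[a X]) = (fun X => F (x n X) (y n X) X).
  apply/funext => X; rewrite /F /h /x /y sqr_q derivM derivXn.
  rewrite !(hornerE, hornerXn, hornerMn) -mulr_natl.
  case: (m) => [|k]; rewrite /= ?exprS; ring.
have bpow k : bm (fun X => a X ^+ k) by exact/bounded_measurableX/bmS.
have bpoly (p : {poly R}) : bm (fun X => p.[q X ^+ 2]).
  under eq_fun do rewrite horner_coef.
  apply: bounded_measurable_sum => i; apply: bounded_measurableZ.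
  exact/bounded_measurableX/bounded_measurableX/bmq.
have bF (v w : 'M[R]_(d, r) -> R) : bm v -> bm w -> bm (fun X => F (v X) (w X) X).
  move=> bv bw.
  by do ?[exact: bmS|exact: bv|exact: bw|exact: bpow|apply: bounded_measurableB|apply:
      bounded_measurableD|
    apply: bounded_measurableM|exact: bounded_measurable_cst].
have by_ n : bm (y n).
  by apply: bounded_measurableM; [exact/bounded_measurableX/bmq|exact: bpoly].
have bx n : bm (x n) by exact: bpoly.
have bq2 : bm (fun X => q X / 2).
  by apply: bounded_measurableM; [exact: bmq|exact: bounded_measurable_cst].
have : E (fun X => F (q X) (q X / 2) X) = 0.
  have cvgF : E (fun X => F (x n X) (y n X) X) @[n --> \oo] -->
      E (fun X => F (q X) (q X / 2) X).
    apply: (@expect_bounded_cvg _ _ _ nu G measurable_G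
      (fun n X => F (x n X) (y n X) X) (fun X => F (q X) (q X / 2) X)
      (2 * (m%:R + 1) + (r%:R + d%:R)) _ _ _ _).
    - by move=> n; have [] := bF _ _ (bx n) (by_ n).
    - by have [] := bF _ _ bmq bq2.
    - move=> n X GX.
      have [x0 xq y0 yx] := sqrt_poly_bounds n (q0 X) (q_le1 GX).
      have {}xq : x n X <= 1 := le_trans xq (q_le1 GX).
      have {}yx : y n X <= 1 := le_trans yx xq.
      rewrite -/(x n X) in x0; rewrite -/(y n X) in y0.
      have a1 := a_le1 GX; have a0 := a_ge0 X.
      have p0 : 0 <= a X ^+ m by rewrite exprn_ge0.
      have p1 : a X ^+ m <= 1 by rewrite exprn_ile1.
      have l1 u v : 0 <= u -> u <= 1 -> 0 <= v -> v <= 1 -> `|u * v| <= 1 :> R.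
        by move=> u0 u1 v0 v1; rewrite ger0_norm ?mulr_ge0// mulr_ile1.
      rewrite (le_trans (ler_normD _ _))// lerD//.
        rewrite normrM normrM (@ger0_norm _ 2)// -mulrA ler_wpM2l//.
        rewrite -[leRHS]mul1r ler_pM//; first by rewrite ger0_norm ?subr_ge0// lerBlDr lerDl.
        rewrite (le_trans (ler_normD _ _))// lerD ?l1//.
        rewrite -mulrA normrM ger0_norm// -[leRHS]mulr1 ler_wpM2l// l1//.
      rewrite normrM -[leRHS]mulr1 ler_pM ?l1//.
      rewrite (le_trans (ler_normB _ _))// lerD ?ger0_norm ?mulr_ge0//.
      by rewrite -[leRHS]mulr1 ler_wpM2l.
    - move=> X GX; have [cx cy] := sqrt_poly_cvg (q0 X) (q_le1 GX).
      rewrite /F; apply: cvgD; apply: cvgMr; last exact: cvgMr.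
      by apply: cvgD; exact: cvgMr.
  rewrite -(cvg_lim _ cvgF)//; apply: cvg_lim => //.
  apply: cvg_near_cst; apply: nearW => n.
  by rewrite -FE expect_horner.
rewrite (_ : (fun X => F (q X) (q X / 2) X) = fun X =>
    (r + m.*2.+1)%:R * (a X ^+ m * q X) - (d + m.*2.+1)%:R * (a X ^+ m.+1 * q X)); last first.
  apply/funext => X; rewrite /F exprS -muln2 !natrD -!natr1 natrM.
  by field.
have bN k : bm (fun X => a X ^+ k * q X) by exact: bounded_measurableM.
rewrite expectB//; try exact: bounded_measurableZ.
by rewrite !expectZ// => /eqP; rewrite subr_eq0 => /eqP.
Qed.

Hypotheses (r_gt0 : (0 < r)%N) (rd : (r <= d)%N).

Let M_gt0 m : 0 < M m.
Proof.
elim: m => [|m IH].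
  rewrite (_ : M 0 = 1) ?ltr01// -[RHS](expect_cst measurable_G nuG 1).
  by apply: eq_expect => X _; rewrite expr0.
have d0 : (0 < d)%N := leq_trans r_gt0 rd.
rewrite -(@pmulr_rgt0 _ (d + m.*2)%:R) ?ltr0n ?addn_gt0 ?d0//.
by rewrite -moment_recurrence mulr_gt0// ltr0n addn_gt0 r_gt0.
Qed.

(** The sequence fed to [gamma_quotient_unique] is E[a^m sqrt a] / E[a^m]. Its bounds are a^(m+1) <=
    a^m sqrt a <= a^m, valid as 0 <= a <= 1, and its recurrence is the quotient of the two moment
    recurrences. *)
Lemma tau_invariant_law : tau R d r = Num.sqrt (d%:R / r%:R) * E q.
Proof.
have d0 : (0 < d)%N := leq_trans r_gt0 rd.
have bpow k : bm (fun X => a X ^+ k) by exact/bounded_measurableX/bmS.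
have bN k : bm (fun X => a X ^+ k * q X) by exact: bounded_measurableM.
rewrite (@gamma_quotient_unique R r d (fun m => N m / M m))//.
- congr (_ * _); rewrite (_ : M 0 = 1) ?divr1.
    by apply: eq_expect => X _; rewrite expr0 mul1r.
  rewrite -[RHS](expect_cst measurable_G nuG 1).
  by apply: eq_expect => X _; rewrite expr0.
- move=> m; rewrite ler_pdivlMr// ler_pdivrMr// mul1r.
  have -> : (r + m.*2)%:R / (d + m.*2)%:R * M m = M m.+1.
    rewrite mulrAC moment_recurrence mulrC mulKf// pnatr_eq0 -lt0n addn_gt0 d0//.
  apply/andP; split; apply: le_expect => // X GX.
    rewrite exprSr ler_wpM2l ?exprn_ge0// -{1}sqr_q expr2.
    by rewrite -[leRHS]mulr1 ler_wpM2l ?q_le1.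
  by rewrite -[leRHS]mulr1 ler_wpM2l ?exprn_ge0 ?q_le1.
- move=> m.
  have NE : N m.+1 = (r + m.*2.+1)%:R / (d + m.*2.+1)%:R * N m.
    by rewrite mulrAC half_moment_recurrence mulrC mulKf// pnatr_eq0 addnS.
  have ME : M m.+1 = (r + m.*2)%:R / (d + m.*2)%:R * M m.
    by rewrite mulrAC moment_recurrence mulrC mulKf// pnatr_eq0 -lt0n addn_gt0 d0.
  rewrite NE ME; move: (N m) (M m) (M_gt0 m) => n v v0.
  have dm : (d + m.*2)%:R != 0 :> R by rewrite pnatr_eq0 -lt0n addn_gt0 d0.
  have rm : (r + m.*2)%:R != 0 :> R by rewrite pnatr_eq0 -lt0n addn_gt0 r_gt0.
  have dm1 : (d + m.*2.+1)%:R != 0 :> R by rewrite pnatr_eq0 addnS.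
  move: ((d + m.*2)%:R : R) ((r + m.*2)%:R : R) ((d + m.*2.+1)%:R : R)
    ((r + m.*2.+1)%:R : R) dm rm dm1 => A B C A' dm rm dm1.
  by field; rewrite dm rm dm1 (gt_eqF v0).
Qed.

Lemma integral_enorm_trmx y :
  (\int[nu]_X (enorm (X^T *m y))%:E = (enorm y * E q)%:E)%E.
Proof.
rewrite (@integral_trmx_mul_enorm (fun z => (enorm z)%:E) y (enorm y *: e i0)).
- transitivity (\int[nu]_X (enorm y * q X)%:E)%E.
    apply: eq_integral => X _; rewrite -scalemxAr enormZ ger0_norm ?enorm_ge0//.
  rewrite expect_setT; [|by apply: measurable_funM => //; have [] := bmq|
    by move=> X; rewrite mulr_ge0 ?enorm_ge0].
  have bq := bounded_measurableZ (enorm y) bmq.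
  rewrite -expectZ// /expect /Rintegral fineK//.
  by apply: integrable_fin_num => //; exact: bounded_measurable_integrable bq.
- by apply/measurable_EFinP; apply: measurable_enorm; exact: measurable_id.
- by move=> z; rewrite lee_fin enorm_ge0.
- by rewrite enormZ enorm_delta mulr1 ger0_norm ?enorm_ge0.
Qed.

(** The mean of sqrt a lies between the mean of a, which is positive, and 1. *)
Lemma tau_bounds : 0 < tau R d r <= Num.sqrt (d%:R / r%:R).
Proof.
have d0 : (0 < d)%N := leq_trans r_gt0 rd.
have s0 : 0 < Num.sqrt (d%:R / r%:R) :> R by rewrite sqrtr_gt0 divr_gt0 ?ltr0n.
rewrite tau_invariant_law; apply/andP; split.
  rewrite mulr_gt0// (lt_le_trans (M_gt0 1))//; apply: le_expect => //.
    exact/bounded_measurableX/bmS.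
  move=> X GX; rewrite expr1 -sqr_q expr2.
  by rewrite -[leRHS]mulr1 ler_wpM2l ?q_le1.
rewrite -[leRHS]mulr1 ler_wpM2l ?(ltW s0)//.
rewrite -(expect_cst measurable_G nuG 1); apply: le_expect => //.
exact: bounded_measurable_cst.
Qed.

End invariant_law.

(** * Transfer to Haar matrices *)

Section haar_matrix.
Variables (R : realType) (d r : nat).
Hypotheses (r_gt0 : (0 < r)%N) (rd : (r <= d)%N).

Let i0 : 'I_d := Ordinal (leq_trans r_gt0 rd).

Let probability_sup1 d0 (T : measurableType d0) (mu : probability T R) (A B : set T) :
  measurable A -> measurable B -> A `<=` B -> mu A = 1%E -> mu B = 1%E.
Proof.
move=> mA mB AB muA; apply/eqP; rewrite eq_le probability_le1//= -muA.
by apply: le_measure; rewrite ?inE.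
Qed.

Let trmxZ (c : R) (X : 'M[R]_(d, r)) : (c *: X)^T = c *: X^T.
Proof. by apply/matrixP => i j; rewrite !mxE. Qed.

Let measurable_first_columns :
  measurable_fun setT (@first_columns R d r rd).
Proof.
apply: measurable_fun_mx => i j; under eq_fun do rewrite mxE.
exact: measurable_mx_coord.
Qed.

(** Only the law of [P] is known, so everything is computed under the law of the unscaled columns.
    Taking columns commutes with multiplication on the left, hence that law inherits left
    invariance. *)
Lemma haar_matrix_invariant_law d0 (Omega : measurableType d0)
    (Pr : probability Omega R) (P : Omega -> 'M[R]_(d, r)) :
  haar_matrix rd Pr P -> exists2 nu : probability 'M[R]_(d, r) R,
    (forall (U : 'M[R]_d) A, orthogonal_mx U -> measurable A ->
      nu ((fun X => U *m X) @^-1` A) = nu A) /\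
    nu [set X | X^T *m X = 1%:M] = 1%E &
    forall A : set 'M[R]_(d, r), measurable A ->
      Pr (P @^-1` A) = nu ((fun X => Num.sqrt (d%:R / r%:R) *: X) @^-1` A).
Proof.
move=> [mu [mu1 muU] PE].
pose fc : {mfun 'M[R]_d >-> 'M[R]_(d, r)} :=
  HB.pack (@first_columns R d r rd) (isMeasurableFun.Build _ _ _ _ _ measurable_first_columns).
exists (distribution mu fc); last by move=> A mA; rewrite PE.
split=> [U A oU mA|].
  rewrite /distribution /pushforward -[RHS](muU U)//; last first.
    by rewrite -[X in measurable X]setTI; exact: measurable_first_columns.
  have UE Q : U *m first_columns rd Q = first_columns rd (U *m Q).
    by apply/matrixP => i j; rewrite !mxE; apply: eq_bigr => k _; rewrite !mxE.
  by congr (mu _); apply/seteqP; split=> Q /=; rewrite UE.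
apply: (probability_sup1 _ _ _ mu1); rewrite /orthogonal_mx.
- exact: measurable_stiefel.
- rewrite -[X in measurable X]setTI; apply: measurable_first_columns => //.
  exact: measurable_stiefel.
- move=> Q QQ /=; apply/matrixP => i j.
  have := congr1 (fun A : 'M[R]_d => A (widen_ord rd i) (widen_ord rd j)) QQ.
  rewrite !mxE => <-; apply: eq_bigr => k _; by rewrite !mxE.
Qed.

Section haar_expectation.
Context d0 (Omega : measurableType d0) (Pr : probability Omega R).
Variable P : {RV Pr >-> 'M[R]_(d, r)}.
Hypothesis haarP : haar_matrix rd Pr P.

Lemma haar_matrix_stiefel :
  Pr [set w | (P w)^T *m P w = (d%:R / r%:R)%:M] = 1%E.
Proof.
have [nu [_ nu1] PE] := haar_matrix_invariant_law haarP.
rewrite (PE [set X | X^T *m X = _]); last exact: measurable_stiefel.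
apply: (probability_sup1 _ _ _ nu1).
- exact: measurable_stiefel.
- rewrite -[X in measurable X]setTI; apply: measurable_scalemx => //.
  exact: measurable_stiefel.
- move=> X /= XX; rewrite trmxZ -scalemxAl -scalemxAr XX scalerA -expr2.
  by rewrite sqr_sqrtr ?divr_ge0// scalemx1.
Qed.

Lemma integral_haar_matrix_enorm y :
  (\int[Pr]_w (enorm ((P w)^T *m y))%:E = (tau R d r * enorm y)%:E)%E.
Proof.
have [nu [nuU nu1] PE] := haar_matrix_invariant_law haarP.
set c := Num.sqrt (d%:R / r%:R) in PE *.
have mc : measurable_fun setT (fun X : 'M[R]_(d, r) => c *: X).
  by apply: measurable_scalemx => //; exact: measurable_id.
have mf : measurable_fun setT (fun X : 'M[R]_(d, r) => (enorm (X^T *m y))%:E).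
  apply/measurable_EFinP; apply: measurable_enorm; apply: measurable_mulmx => //.
  exact/measurable_trmx/measurable_id.
have f0 (X : 'M[R]_(d, r)) : (0 <= (enorm (X^T *m y))%:E)%E.
  by rewrite lee_fin enorm_ge0.
transitivity (\int[pushforward Pr P]_X (enorm (X^T *m y))%:E)%E.
  by rewrite ge0_integral_pushforward.
transitivity (\int[pushforward nu (fun X => c *: X)]_X (enorm (X^T *m y))%:E)%E.
  by apply: eq_measure_integral => A mA _; exact: PE.
rewrite ge0_integral_pushforward//= preimage_setT.
rewrite (tau_invariant_law nuU nu1 i0)// -/c -mulrA.
rewrite [X in _ = (c * X)%:E]mulrC EFinM -(integral_enorm_trmx nuU nu1 i0).
rewrite -ge0_integralZl//; last by rewrite lee_fin sqrtr_ge0.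
apply: eq_integral => X _.
by rewrite trmxZ -scalemxAl enormZ ger0_norm ?sqrtr_ge0.
Qed.

Lemma haar_tau_bounds : 0 < tau R d r <= Num.sqrt (d%:R / r%:R).
Proof.
have [nu [nuU nu1] _] := haar_matrix_invariant_law haarP.
exact: (tau_bounds nuU nu1 i0).
Qed.

End haar_expectation.
End haar_matrix.

(** * Independent draws *)

Section past.
Context {R : realType} {d0 : measure_display} {Omega : measurableType d0}.
Variables (Pr : probability Omega R) (I : eqType) (G : I -> set_system Omega).
Hypotheses (mG : forall i, G i `<=` measurable) (sG : forall i, sigma_algebra setT (G i)).
Hypothesis indG : mutually_independent Pr G.

Definition family_sigma (J : pred I) : set_system Omega :=
  \bigcup_(i in [set i | J i]) G i.

(** The union of the sigma-algebras is not stable under intersection; its finite meets form the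
    pi-system on which measures can be compared. *)
Let finite_meets (J : pred I) : set_system Omega :=
  [set A | exists s : seq I, exists F : I -> set Omega, [/\ uniq s, all J s,
    forall i, i \in s -> G i (F i) & A = \bigcap_(i in [set` s]) F i]].

Let GT i : G i setT.
Proof. by have [g0 gD _] := sG i; rewrite -(setD0 setT); exact: gD. Qed.

Let GI i A B : G i A -> G i B -> G i (A `&` B).
Proof.
move=> GA GB; have : (<<s G i >>) (A `&` B).
  apply: (@measurableI _ (g_sigma_algebraType (G i))); exact: sub_sigma_algebra.
by rewrite sigma_algebra_id.
Qed.

Let finite_meets_setI J : setI_closed (finite_meets J).
Proof.
move=> _ _ [s [F [us Js GF ->]]] [s' [F' [us' Js' GF' ->]]].
(* Independence is stated for lists without repetition, so an index common to both lists must be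
   merged: each family is extended by [setT] off its list, and the two sets are intersected inside
   [G i]. *)
pose H (t : seq I) (F : I -> set Omega) i := if i \in t then F i else setT.
exists (undup (s ++ s')), (fun i => H s F i `&` H s' F' i); split.
- exact: undup_uniq.
- apply/allP => i; rewrite mem_undup mem_cat => /orP[/(allP Js)|/(allP Js')]//.
- move=> i _; apply: GI; rewrite /H; case: ifP => // ?; [exact: GF|exact: GF'].
- apply/seteqP; split=> w /=.
    move=> [ws ws'] i _; split; rewrite /H; case: ifP => // ?; [exact: ws|exact: ws'].
  move=> h; split=> i si; have := h i; rewrite /= mem_undup mem_cat si ?orbT => /(_ isT);
    by rewrite /H si => -[].
Qed.

(** For fixed B, both sides are finite measures in A. Mutual independence along the list extended by
    j makes them agree on [finite_meets], and a measure is determined by a pi-system. *)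
Lemma independent_family_sigma (J : pred I) j A B : ~~ J j ->
  (<<s family_sigma J >>) A -> G j B -> Pr (A `&` B) = (Pr A * Pr B)%E.
Proof.
move=> Jj sA GB.
have mB : measurable B by exact: mG GB.
have sub : family_sigma J `<=` finite_meets J.
  move=> C [i /= Ji GC]; exists [:: i], (fun=> C); split=> //=.
  - by rewrite Ji.
  - by move=> k; rewrite inE => /eqP ->.
  - apply/seteqP; split=> [w Cw k _ //|w /(_ i)]; apply; exact: mem_head.
have {}sA : (<<s finite_meets J >>) A by exact: (sub_smallest2r _ sub).
pose PB : {nonneg R} := NngNum (fine_ge0 (measure_ge0 Pr B)).
have PrB : Pr B = PB%:num%:E by rewrite /= fineK// fin_num_measure.
transitivity (mscale PB Pr A); last by rewrite /mscale/= -/(PB%:num) PrB muleC.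
transitivity (mrestr Pr mB A); first by [].
apply: (@g_sigma_algebra_measure_unique _ _ _ (finite_meets J) _ (fun=> setT)) => //.
- move=> _ [s [F [us Js GF ->]]]; apply: fin_bigcap_measurable => //.
  by move=> i /GF /mG.
- by move=> _; exists [::], (fun=> setT); split=> //; apply/seteqP; split.
- exact: bigcup_const.
- move=> _ [s [F [us Js GF ->]]].
  have js : j \notin s by apply: contra Jj => /(allP Js).
  suff : Pr (\bigcap_(i in [set` s]) F i `&` B) =
      (Pr B * Pr (\bigcap_(i in [set` s]) F i))%E by rewrite PrB => h; exact: h.
  pose F' i := if i == j then B else F i.
  have F'E i : i \in s -> F' i = F i.
    by rewrite /F'; case: eqP => // ->; rewrite (negbTE js).
  have := indG (s := j :: s) (A := F'); rewrite /= js us => /(_ isT) ind.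
  rewrite (_ : _ `&` B = \bigcap_(i in [set` j :: s]) F' i); last first.
    apply/seteqP; split=> [w [Fw Bw] i|w h].
      rewrite /= inE => /predU1P[->|si]; first by rewrite /F' eqxx.
      by rewrite F'E//; exact: Fw.
    split; last by have := h j (mem_head _ _); rewrite /F' eqxx.
    by move=> i si; rewrite -F'E//; apply: h; rewrite /= inE si orbT.
  rewrite ind; last first.
    move=> i; rewrite inE => /predU1P[->|si]; first by rewrite /F' eqxx.
    by rewrite F'E//; exact: GF.
  rewrite big_cons {1}/F' eqxx; congr (_ * _)%E.
  rewrite [LHS](eq_big_seq (fun i => Pr (F i))) => [|i si]; last by rewrite F'E.
  by rewrite indG.
- by move=> _; exact: le_lt_trans (probability_le1 Pr (measurableI _ _ measurableT mB))
    (ltry _).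
Qed.

End past.

(** * Integration over a fresh draw with the rest frozen *)

Section freezing.
Context {R : realType} {d0 : measure_display} {Omega : measurableType d0}.
Context d1 (S1 : measurableType d1) d2 (S2 : measurableType d2).
Variables (Pr : probability Omega R) (X : Omega -> S1) (Y : Omega -> S2).
Hypotheses (mX : measurable_fun setT X) (mY : measurable_fun setT Y).
Hypothesis indXY : forall A B, measurable A -> measurable B ->
  Pr (X @^-1` A `&` Y @^-1` B) = (Pr (X @^-1` A) * Pr (Y @^-1` B))%E.

(** Takes the place of conditional expectation: independence makes the joint law a product measure,
    and Tonelli integrates the bound proved for each frozen x. *)
Lemma le_integral_frozen (f : S1 * S2 -> \bar R) (g : S1 -> \bar R) :
  measurable_fun setT f -> (forall z, 0 <= f z)%E -> measurable_fun setT g ->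
  (forall x, \int[Pr]_w f (x, Y w) <= g x)%E ->
  (\int[Pr]_w f (X w, Y w) <= \int[Pr]_w g (X w))%E.
Proof.
move=> mf f0 mg fg.
have mXY : measurable_fun setT (fun w => (X w, Y w)) by exact: measurable_fun_pair.
pose X' : {mfun Omega >-> S1} := HB.pack X (isMeasurableFun.Build _ _ _ _ _ mX).
pose Y' : {mfun Omega >-> S2} := HB.pack Y (isMeasurableFun.Build _ _ _ _ _ mY).
pose Z : {mfun Omega >-> (S1 * S2)%type} :=
  HB.pack (fun w => (X w, Y w)) (isMeasurableFun.Build _ _ _ _ _ mXY).
pose PX := distribution Pr X'; pose PY := distribution Pr Y'.
have -> : (\int[Pr]_w f (X w, Y w) = \int[distribution Pr Z]_z f z)%E.
  by rewrite ge0_integral_pushforward.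
rewrite (eq_measure_integral (PX \x PY)%E); last first.
  move=> A mA _; symmetry; apply: product_measure_unique => //.
rewrite fubini_tonelli1//.
have -> : (\int[Pr]_w g (X w) = \int[PX]_x g x)%E.
  rewrite ge0_integral_pushforward// => x _.
  by apply: le_trans (fg x); exact: integral_ge0.
apply: ge0_le_integral => //.
- by move=> x _; exact: integral_ge0.
- exact: measurable_fun_fubini_tonelli_F.
- move=> x _; apply: le_trans (fg x); rewrite /fubini_F ge0_integral_pushforward//.
  exact/measurableT_comp/measurable_pair1.
Qed.

End freezing.

Section draw.
Context {R : realType} {d0 : measure_display} {Omega : measurableType d0}.
Variables (Pr : probability Omega R) (I : eqType) (G : I -> set_system Omega).
Hypotheses (mG : forall i, G i `<=` measurable) (sG : forall i, sigma_algebra setT (G i)).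
Hypothesis indG : mutually_independent Pr G.

(* The sample space with the sigma-algebra generated by the draws in [J]. *)
Definition known (J : pred I) := g_sigma_algebraType (family_sigma G J).

Lemma measurable_known (J : pred I) d1 (S1 : measurableType d1)
    (X : known J -> S1) :
  measurable_fun setT X -> measurable_fun setT (X : Omega -> S1).
Proof.
move=> mX _ A mA; rewrite setTI.
have /= := mX measurableT A mA; rewrite setTI.
apply: smallest_sub; first exact: sigma_algebra_measurable.
by move=> B [i _ /mG].
Qed.

Lemma sub_known (J K : pred I) d1 (S1 : measurableType d1) (X : Omega -> S1) :
  subpred J K -> measurable_fun setT (X : known J -> S1) ->
  measurable_fun setT (X : known K -> S1).
Proof.
move=> JK mX _ A mA; have sub : family_sigma G J `<=` family_sigma G K.
  by move=> B [i /= Ji GB]; exists i => //=; exact: JK.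
by have := mX measurableT A mA; exact: (sub_smallest2r _ sub).
Qed.

Lemma known_draw (J : pred I) j d2 (S2 : measurableType d2) (Y : Omega -> S2) :
  G j = sigma_rv Y -> J j -> measurable_fun setT (Y : known J -> S2).
Proof.
move=> GY Jj _ A mA; apply: sub_sigma_algebra; exists j => //=.
by rewrite GY; exists A.
Qed.

Lemma le_integral_draw (J : pred I) j d1 (S1 : measurableType d1)
    d2 (S2 : measurableType d2) (X : Omega -> S1) (Y : Omega -> S2)
    (f : S1 * S2 -> \bar R) (g : S1 -> \bar R) :
  ~~ J j -> G j = sigma_rv Y -> measurable_fun setT (X : known J -> S1) ->
  measurable_fun setT f -> (forall z, 0 <= f z)%E -> measurable_fun setT g ->
  (forall x, \int[Pr]_w f (x, Y w) <= g x)%E ->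
  (\int[Pr]_w f (X w, Y w) <= \int[Pr]_w g (X w))%E.
Proof.
move=> Jj GY mX; apply: le_integral_frozen.
- exact: measurable_known mX.
- move=> _ A mA; rewrite setTI; apply: (mG (i := j)); rewrite GY.
  by exists A => //; rewrite setTI.
- move=> A B mA mB; apply: (independent_family_sigma mG sG indG Jj).
    by have /= := mX measurableT A mA; rewrite setTI.
  by rewrite GY; exists B => //; rewrite setTI.
Qed.

End draw.

(** * Moment and descent inequalities *)

Section elementary_inequalities.
Variable R : realType.
Implicit Types x y s b p : R.

(** The concave power lies below its tangent at 1. *)
Lemma powR_bernoulli y q : 0 <= y -> 0 < q -> q <= 1 -> y `^ q <= 1 + q * (y - 1).
Proof.
move=> y0 q0 q1; have [->|yN0] := eqVneq y 0; first by rewrite powR0 ?gt_eqF//; lra.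
have {yN0 y0}y0 : 0 < y by rewrite lt_neqAle eq_sym yN0.
have m0 : 0 < y `^ q by rewrite powR_gt0.
have h1 : 1 + (1 - q) * ln y <= y / y `^ q.
  have -> : y / y `^ q = expR ((1 - q) * ln y).
    by rewrite mulrBl mul1r expRD expRN lnK ?posrE// /powR (gt_eqF y0).
  exact: expR_ge1Dx.
have h2 : 1 - q * ln y <= (y `^ q)^-1.
  have -> : (y `^ q)^-1 = expR (- (q * ln y)) by rewrite expRN /powR (gt_eqF y0).
  exact: expR_ge1Dx.
(* In the combination of [h1] and [h2] with weights q and 1 - q the logarithms cancel. *)
have h3 : 1 <= (1 + q * (y - 1)) / y `^ q.
  have -> : (1 + q * (y - 1)) / y `^ q = q * (y / y `^ q) + (1 - q) * (y `^ q)^-1 by ring.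
  have := ler_wpM2l (ltW q0) h1.
  have q2 : 0 <= 1 - q by lra.
  by have := ler_wpM2l q2 h2; lra.
by move: h3; rewrite ler_pdivlMr// mul1r.
Qed.

(** The case |a| = 1 of a bound on |a + b|^p, with s = <a, b>. For b <= 1 Bernoulli suffices, as b^2
    <= b^p. For b > 1 the factor b^2 is extracted first, and the linear terms are absorbed by b <=
    b^p. *)
Lemma powR_second_order_bound p b s : 1 < p -> p <= 2 -> 0 <= b -> `|s| <= b ->
  (1 + 2 * s + b ^+ 2) `^ (p / 2) <= 1 + p * s + (1 + p) * b `^ p.
Proof.
move=> p1 p2 b0; rewrite ler_norml => /andP[sb1 sb2].
have bern y : 0 <= y -> y `^ (p / 2) <= 1 + p / 2 * (y - 1).
  by move=> y0; apply: powR_bernoulli => //; lra.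
have sq0 : 0 <= 1 + 2 * s + b ^+ 2 by have := sqr_ge0 (1 - b); lra.
have bp0 : 0 <= b `^ p by exact: powR_ge0.
have [b1|b1] := leP b 1.
  apply: le_trans (bern _ sq0) _.
  have : b ^+ 2 <= b `^ p.
    have [->|bN0] := eqVneq b 0; first by rewrite expr0n powR_ge0.
    have {bN0}b0' : 0 < b by rewrite lt_neqAle eq_sym bN0.
    by rewrite -powR_mulrn// ger_powR ?b0'.
  by nra.
have b0' : 0 < b by lra.
have b2 : 0 < b ^+ 2 by rewrite exprn_gt0.
have -> : 1 + 2 * s + b ^+ 2 = b ^+ 2 * (1 + (1 + 2 * s) / b ^+ 2).
  by field; rewrite gt_eqF.
have q0 : 0 <= 1 + (1 + 2 * s) / b ^+ 2.
  have -> : 1 + (1 + 2 * s) / b ^+ 2 = (1 + 2 * s + b ^+ 2) / b ^+ 2.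
    by field; rewrite gt_eqF.
  by rewrite divr_ge0// ltW.
rewrite powRM//; last exact: ltW.
have -> : (b ^+ 2) `^ (p / 2) = b `^ p.
  by rewrite -powR_mulrn// -powRrM; congr (_ `^ _); field.
apply: (@le_trans _ _ (b `^ p * (1 + p / 2 * ((1 + 2 * s) / b ^+ 2)))).
  by rewrite ler_wpM2l//; apply: le_trans (bern _ q0) _; rewrite le_eqVlt; apply/orP; left;
      apply/eqP; ring.
pose k := b `^ p / b ^+ 2.
have bk : b `^ p = k * b ^+ 2 by rewrite /k divfK// gt_eqF.
have bb : b <= b `^ p.
  by rewrite -{1}(powRr1 b0) ler_powR ?ltW.
have k0 : 0 <= k by rewrite divr_ge0// ltW.
have k1 : k <= 1.
  by rewrite ler_pdivrMr// mul1r -powR_mulrn// ler_powR// ltW.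
have -> : b `^ p * (1 + p / 2 * ((1 + 2 * s) / b ^+ 2)) =
    b `^ p + p * k / 2 + p * k * s.
  by rewrite /k; field; rewrite gt_eqF.
have h1 : p * (1 - k) * (- s) <= p * (1 - k) * b.
  by rewrite ler_wpM2l; [lra|rewrite mulr_ge0; lra|lra].
have h2 : p * k * 1 <= p * k * b by rewrite ler_wpM2l; [lra|rewrite mulr_ge0; lra|lra].
have h3 : p * b <= p * b `^ p by rewrite ler_wpM2l//; lra.
have h4 : 0 <= p * k by rewrite mulr_ge0//; lra.
by nra.
Qed.

(** Squaring exp(x/2) <= 1 / (1 - x/2) leaves a polynomial inequality, whose defect x^2 (1 - 3x +
    x^2) / 4 is nonnegative in the given range. *)
Lemma expR_second_order x : `|x| <= 4^-1 -> expR x <= 1 + x + x ^+ 2.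
Proof.
rewrite ler_norml => /andP[x1 x2].
have h : expR (- (x / 2)) >= 1 - x / 2 by exact: expR_ge1Dx.
have h0 : 0 < 1 - x / 2 by lra.
have e0 : 0 < expR (x / 2) by exact: expR_gt0.
have ee : expR (x / 2) * expR (- (x / 2)) = 1 by rewrite -expRD subrr expR0.
have h1 : expR (x / 2) * (1 - x / 2) <= 1 by rewrite -[leRHS]ee ler_wpM2l// ltW.
have -> : expR x = expR (x / 2) ^+ 2 by rewrite expr2 -expRD; congr expR; field.
move: (expR (x / 2)) e0 h1 => e e0 h1.
have h2 : (e * (1 - x / 2)) ^+ 2 <= 1 by rewrite exprn_ile1// mulr_ge0// ltW.
rewrite -(ler_pM2r (exprn_gt0 2 h0)) -exprMn; apply: le_trans h2 _.
rewrite -subr_ge0 (_ : _ - 1 = x ^+ 2 / 4 * (1 - 3 * x + x ^+ 2)); last by field.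
by rewrite mulr_ge0 ?divr_ge0 ?sqr_ge0//; nra.
Qed.

End elementary_inequalities.

Section vector_inequality.
Variable R : realType.

(** The previous bound rescaled by |a|. The term in <a, b> is kept exactly because it averages to
    zero when b is centered; at a = 0 it is zero whatever the value of the power. *)
Lemma powR_enormD_le n (a b : 'cV[R]_n) (p : R) : 1 < p -> p <= 2 ->
  enorm (a + b) `^ p <=
  enorm a `^ p + p * enorm a `^ (p - 2) * dot a b + (1 + p) * enorm b `^ p.
Proof.
move=> p1 p2; have [->|aN0] := eqVneq a 0.
  rewrite add0r enorm0 dot0l mulr0 addr0 powR0; last by lra.
  by rewrite add0r ler_peMl ?powR_ge0//; lra.
have a0 : 0 < enorm a by rewrite lt_neqAle eq_sym enorm_eq0 aN0 enorm_ge0.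
set A := enorm a in a0 *.
pose be := enorm b / A; pose s := dot a b / A ^+ 2.
have be0 : 0 <= be by rewrite divr_ge0 ?enorm_ge0// ltW.
have sb : `|s| <= be.
  rewrite /s normrM normfV (ger0_norm (sqr_ge0 A)) ler_pdivrMr ?exprn_gt0//.
  rewrite /be (_ : enorm b / A * A ^+ 2 = A * enorm b) ?normr_dot_le//.
  by field; rewrite gt_eqF.
have := powR_second_order_bound p1 p2 be0 sb.
have nE : enorm (a + b) = A * Num.sqrt (1 + 2 * s + be ^+ 2).
  rewrite -[A in RHS](ger0_norm (ltW a0)) -sqrtr_sqr -sqrtrM ?sqr_ge0//.
  rewrite enormE; congr Num.sqrt; rewrite !(dotDl, dotDr) (dotC b a) -!sqr_enorm -/A.
  by rewrite /s /be; field; rewrite gt_eqF.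
have w0 : 0 <= 1 + 2 * s + be ^+ 2.
  by move: sb; rewrite ler_norml => /andP[]; have := sqr_ge0 (1 - be); lra.
rewrite nE powRM ?sqrtr_ge0 ?(ltW a0)// -powR12_sqrt// -powRrM mulrC.
have -> : 2^-1 * p = p / 2 by rewrite mulrC.
move=> /(ler_wpM2l (powR_ge0 A p)); rewrite mulrC => h.
apply: le_trans h _.
have -> : A `^ (p - 2) = A `^ p / A ^+ 2.
  by rewrite powRB ?(gt_eqF a0) ?implybT// powR_mulrn// ltW.
have -> : enorm b `^ p = A `^ p * be `^ p.
  by rewrite -powRM ?(ltW a0)// /be mulrCA divff ?gt_eqF// mulr1.
by rewrite le_eqVlt; apply/orP; left; apply/eqP; rewrite /s; ring.
Qed.

End vector_inequality.

(** * Smooth functions and the descent lemma *)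

Section descent.
Variables (R : realType) (d : nat) (F : 'cV[R]_d -> R) (L : R).
Hypothesis dF : forall x, differentiable F x.
Hypothesis lipF : forall x y, enorm (grad F x - grad F y) <= L * enorm (x - y).

Lemma derive_grad x v : 'D_v F x = dot (grad F x) v.
Proof.
have vE : v = \sum_i v i 0 *: (delta_mx i 0 : 'cV[R]_d).
  apply/matrixP => i j; rewrite ord1 summxE (bigD1 i)//= !mxE !eqxx mulr1 big1 ?addr0//.
  by move=> k ki; rewrite !mxE eq_sym (negbTE ki) mulr0.
rewrite deriveE// [in LHS]vE linear_sum; apply: eq_bigr => i _.
by rewrite linearZ /= -deriveE// mxE mulrC.
Qed.

Lemma is_derive_line x v (t : R) :
  is_derive t 1 (fun t : R => F (x + t *: v)) (dot (grad F (x + t *: v)) v).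
Proof.
rewrite -derive_grad.
have E : (fun h : R => h^-1 *: (((fun t : R => F (x + t *: v)) \o shift t) (h *: (1 : R))
    - F (x + t *: v))) =
    (fun h : R => h^-1 *: ((F \o shift (x + t *: v)) (h *: v) - F (x + t *: v))).
  apply/funext => h /=; congr (_ *: (F _ - _)).
  by rewrite [h *: 1]mulr1 scalerDl addrCA.
by split; rewrite /derivable /derive ?E//; exact: diff_derivable.
Qed.

(** The mean value theorem is applied to [psi], the restriction to the segment minus its linear and
    quadratic parts; the Lipschitz gradient makes its derivative nonpositive on ]0, 1[. *)
Lemma smooth_descent x v :
  F (x + v) <= F x + dot (grad F x) v + L / 2 * enorm v ^+ 2.
Proof.
pose psi (t : R) := F (x + t *: v) - t * dot (grad F x) v - L / 2 * t ^+ 2 * enorm v ^+ 2.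
pose dpsi (t : R) := dot (grad F (x + t *: v)) v - dot (grad F x) v - L * t * enorm v ^+ 2.
have dpsiP (t : R) : is_derive t (1 : R) psi (dpsi t).
  have h1 := is_derive_line x v t.
  have h2 : is_derive t (1 : R) (fun t : R => t * dot (grad F x) v) (dot (grad F x) v).
    by apply: is_derive_eq; rewrite ?scaler0 ?addr0 ?add0r ?[_ *: 1]mulr1.
  have h3 : is_derive t (1 : R) (fun t : R => L / 2 * t ^+ 2 * enorm v ^+ 2)
      (L * t * enorm v ^+ 2).
    apply: is_derive_eq; rewrite /GRing.scale/=.
    by field.
  exact: is_deriveB.
have [] := @MVT R psi dpsi 0 1 ltr01 (fun t _ => dpsiP t).
  by apply: derivable_within_continuous => t _; have [] := dpsiP t.
move=> c; rewrite in_itv/= => /andP[c0 c1]; rewrite subr0 mulr1.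
rewrite /psi scale0r scale1r !mul0r expr0n/= mulr0 mul0r !subr0 !addr0 expr1n mul1r mulr1 => E.
have : dpsi c <= 0.
  rewrite /dpsi -dotNl -dotDl subr_le0 (le_trans (dot_le _ _))//.
  rewrite expr2 mulrA ler_wpM2r ?enorm_ge0// (le_trans (lipF _ _))//.
  by rewrite addrAC subrr add0r enormZ ger0_norm ?mulrA// ltW.
by rewrite -E; lra.
Qed.

(** The descent bound at the minimizer -grad/L of its right side cannot fall below m. *)
Lemma sqr_grad_le (m : R) x : 0 < L -> (forall y, m <= F y) ->
  enorm (grad F x) ^+ 2 <= 2 * L * (F x - m).
Proof.
move=> L0 mF; have := le_trans (mF _) (smooth_descent x (- L^-1 *: grad F x)).
rewrite dotZr enormZ normrN (ger0_norm (_ : 0 <= L^-1)) ?invr_ge0 ?(ltW L0)//.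
rewrite -sqr_enorm exprMn; move: (enorm _ ^+ 2) => q.
have -> : L / 2 * (L^-1 ^+ 2 * q) = q / (2 * L) by field; rewrite gt_eqF.
have -> : - L^-1 * q = - 2 * (q / (2 * L)) by field; rewrite gt_eqF.
move=> h; rewrite -ler_pdivrMl ?mulr_gt0// mulrC.
by lra.
Qed.

Lemma lipschitz_grad_coord i x y :
  `|grad F x i 0 - grad F y i 0| <= L * enorm (x - y).
Proof.
apply: le_trans (lipF x y); have := normr_coord_le (grad F x - grad F y) i.
by rewrite !mxE.
Qed.

End descent.

Lemma lipschitz_continuous (R : realType) d (g : 'cV[R]_d -> R) (K : R) :
  0 <= K -> (forall x y, `|g x - g y| <= K * enorm (x - y)) -> continuous g.
Proof.
move=> K0 gK x; apply/(@cvgrPdist_lt _ _ _ (nbhs x) (nbhs_filter x)) => eps eps0.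
(* The topology is that of the sup norm, and the Euclidean norm is at most d times it; the summand 1
   keeps the denominator positive. *)
pose de := eps / (K * d%:R + 1).
have D0 : 0 < K * d%:R + 1 by rewrite ltr_wpDl// mulr_ge0.
have de0 : 0 < de by rewrite divr_gt0.
apply/nbhs_ballP; exists de => //= y [_ xy].
apply: le_lt_trans (gK _ _) _.
have : enorm (x - y) <= d%:R * de.
  have dd0 : 0 <= d%:R * de by rewrite mulr_ge0 ?(ltW de0).
  rewrite -(ger0_norm dd0) -sqrtr_sqr /enorm; apply: ler_wsqrtr.
  apply: (@le_trans _ _ (\sum_(i < d) de ^+ 2)).
    apply: ler_sum => i _; rewrite -real_normK ?num_real//.
    rewrite ler_pXn2r ?nnegrE ?(ltW de0)// !mxE; apply: ltW.
    exact: (xy i 0).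
  rewrite sumr_const card_ord -[leLHS]mulr_natl [leRHS]exprMn ler_wpM2r ?sqr_ge0//.
  by rewrite -natrX ler_nat; case: (d) => // k; rewrite expnS leq_pmulr.
move=> h; apply: le_lt_trans (ler_wpM2l K0 h) _.
rewrite mulrA /de mulrA ltr_pdivrMr// mulrC ltr_pM2l//.
by rewrite ltrDl.
Qed.

Lemma continuous_mx_measurable (R : realType) m n (g : 'M[R]_(m, n) -> R) :
  continuous g -> measurable_fun setT g.
Proof.
move=> cg; apply: (@measurability _ _ _ _ setT g (@RGenOpens.G R)).
  exact: RGenOpens.measurableE.
move=> _ [_ [x [y ->]] <-]; apply: sub_sigma_algebra; rewrite /= setTI.
apply: open_comp; last exact: interval_open.
by move=> A _; exact: cg.
Qed.

Lemma probability_integral_cst d (T : measurableType d) (R : realType)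
  (Q : probability T R) (c : R) : (\int[Q]_x c%:E = c%:E)%E.
Proof.
transitivity (c%:E * Q setT)%E; last by rewrite probability_setT mule1.
exact: (integral_cst Q measurableT c%:E).
Qed.

(** * The p-th moment of a sum with one more centered term *)

Section centered_vectors.
Variables (R : realType) (n : nat).
Context dX (Xi : measurableType dX).
Variables (D : probability Xi R) (X : Xi -> 'cV[R]_n) (p sp : R).
Hypotheses (p1 : 1 < p) (p2 : p <= 2).
Hypothesis mX : measurable_fun setT X.
Hypothesis iX : forall i, D.-integrable setT (fun z => (X z i 0)%:E).
Hypothesis X_centered : forall i, (\int[D]_z (X z i 0)%:E = 0)%E.
Hypothesis Xp : (\int[D]_z (enorm (X z) `^ p)%:E <= sp%:E)%E.

Let measurable_powR_enorm (f : Xi -> 'cV[R]_n) : measurable_fun setT f ->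
  measurable_fun setT (fun z => (enorm (f z) `^ p)%:E).
Proof.
move=> mf; apply/measurable_EFinP.
by apply: (measurableT_comp (measurable_powR p)); exact: measurable_enorm.
Qed.

Lemma integral_dot_centered v :
  D.-integrable setT (fun z => (dot v (X z))%:E) /\
  (\int[D]_z (dot v (X z))%:E = 0)%E.
Proof.
have E : (fun z => (dot v (X z))%:E) =
    (fun z => \sum_(i < n) ((v i 0)%:E * (X z i 0)%:E))%E.
  by apply/funext => z; rewrite /dot -sumEFin.
rewrite E; split; first by apply: integrable_sum => // i _; exact: integrableZl.
rewrite integral_sum//; last by move=> i; exact: integrableZl.
by rewrite big1// => i _; rewrite integralZl// X_centered mule0.
Qed.

(** The linear term of [powR_enormD_le] integrates to zero, so each new sample adds a constant to
    the p-th moment: growth is linear in the number of samples, although p may be less than 2. *)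
Lemma integral_powR_shift v :
  (\int[D]_z (enorm (v + X z) `^ p)%:E <= (enorm v `^ p + (1 + p) * sp)%:E)%E.
Proof.
have p0 : 0 <= 1 + p by rewrite addr_ge0// ltW// (lt_trans _ p1).
pose lin z := p * enorm v `^ (p - 2) * dot v (X z).
have [idot dot0] := integral_dot_centered v.
have ilin : D.-integrable setT (EFin \o lin).
  exact: (integrableZl measurableT (p * enorm v `^ (p - 2)) idot).
have lin0 : (\int[D]_z (lin z)%:E = 0)%E.
  by under eq_integral do rewrite /lin EFinM; rewrite integralZl// dot0 mule0.
have mXp := measurable_powR_enorm mX.
have sp_fin : (\int[D]_z (enorm (X z) `^ p)%:E < +oo)%E by exact: le_lt_trans Xp (ltry _).
have iXp : D.-integrable setT (fun z => ((1 + p) * enorm (X z) `^ p)%:E).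
  apply: (@integrableZl _ _ _ D setT measurableT (1 + p) (fun z => (enorm (X z) `^ p)%:E)).
  apply/integrableP; split=> //.
  rewrite (eq_integral (fun z => (enorm (X z) `^ p)%:E))// => z _.
  by rewrite /= ger0_norm ?powR_ge0.
have icst : D.-integrable setT (EFin \o cst (enorm v `^ p)).
  apply: measurable_bounded_integrable => //; first by rewrite /= probability_setT ltry.
  exact: bounded_cst.
apply: (@le_trans _ _ (\int[D]_z ((enorm v `^ p)%:E + (lin z)%:E +
    ((1 + p) * enorm (X z) `^ p)%:E))%E).
  apply: ge0_le_integral => //.
  - by move=> z _; rewrite lee_fin powR_ge0.
  - by apply: measurable_powR_enorm; apply: measurable_addmx => //; exact: measurable_cst.
  - apply: emeasurable_funD; last exact: measurable_int iXp.
    apply: emeasurable_funD; last exact: measurable_int ilin.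
    exact: measurable_int icst.
  - by move=> z _; rewrite -!EFinD lee_fin; exact: powR_enormD_le.
have icl := integrableD measurableT icst ilin.
rewrite (integralD measurableT icl iXp) (integralD measurableT icst ilin).
rewrite [X in (_ + X + _)%E]lin0 adde0.
rewrite [X in (X + _)%E](probability_integral_cst D).
rewrite EFinD; apply: leeD2l.
under eq_integral do rewrite EFinM.
rewrite ge0_integralZl//; last by move=> z _; rewrite lee_fin powR_ge0.
by rewrite [leRHS]EFinM lee_wpmul2l.
Qed.

End centered_vectors.

(** * One normalized step with a Haar matrix *)

Section subspace_step.
Variables (R : realType) (d r : nat).

(** When P^T g = 0 the division by zero returns 0, in agreement with the step that does not move. *)
Definition progress (P : 'M[R]_(d, r)) (g y : 'cV[R]_d) : R :=
  dot y (P *m (P^T *m g)) / enorm (P^T *m g).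

Lemma rs_nsgd_stepE eta P g x : @rs_nsgd_step R d r eta P g x =
  x - (eta / enorm (P^T *m g)) *: (P *m (P^T *m g)).
Proof.
rewrite /rs_nsgd_step; case: eqP => [->|_]; last by rewrite mulmxA.
by rewrite mulmx0 scaler0 subr0.
Qed.

Lemma progressE (P : 'M[R]_(d, r)) g y :
  progress P g y = dot (P^T *m y) (P^T *m g) / enorm (P^T *m g).
Proof. by rewrite /progress dot_mull trmxK. Qed.

(** With u = P^T y and v = P^T g, <u, v> / |v| = |v| - <v - u, v> / |v| >= |v| - |v - u| >= |u| - 2
    |v - u|. For v = 0 the left side is -|u|. *)
Lemma progress_lower (P : 'M[R]_(d, r)) g y :
  enorm (P^T *m y) - 2 * enorm (P^T *m (g - y)) <= progress P g y.
Proof.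
rewrite progressE mulmxBr.
move: (P^T *m y) (P^T *m g) => u v.
have uv := ler_enormB u v; rewrite -(enormN (u - v)) opprB in uv.
have e0 := enorm_ge0 (v - u); have n0 := enorm_ge0 u.
have [v0|v0] := eqVneq (enorm v) 0.
  by move: uv; rewrite v0 invr0 mulr0; lra.
have {}v0 : 0 < enorm v by rewrite lt_neqAle eq_sym v0 enorm_ge0.
rewrite ler_pdivlMr//.
have : dot u v = enorm v ^+ 2 - dot (v - u) v.
  by rewrite sqr_enorm dotDl dotNl; ring.
move=> ->; have := dot_le (v - u) v.
have : (enorm u - enorm (v - u)) * enorm v <= enorm v * enorm v.
  by rewrite ler_wpM2r ?(ltW v0)//; lra.
by lra.
Qed.

Lemma normr_progress_le (P : 'M[R]_(d, r)) c g y :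
  0 <= c -> P^T *m P = c%:M -> `|progress P g y| <= Num.sqrt c * enorm y.
Proof.
move=> c0 PP; rewrite progressE; apply: le_trans (enorm_trmx_le y c0 PP).
have [->|v0] := eqVneq (enorm (P^T *m g)) 0.
  by rewrite invr0 mulr0 normr0 enorm_ge0.
have {}v0 : 0 < enorm (P^T *m g) by rewrite lt_neqAle eq_sym v0 enorm_ge0.
by rewrite normrM normfV (gtr0_norm v0) ler_pdivrMr// normr_dot_le.
Qed.

Lemma rs_nsgd_step_length (P : 'M[R]_(d, r)) c eta g :
  0 <= c -> P^T *m P = c%:M -> 0 <= eta ->
  enorm ((eta / enorm (P^T *m g)) *: (P *m (P^T *m g))) <= eta * Num.sqrt c.
Proof.
move=> c0 PP eta0; rewrite enormZ (enorm_isometry _ c0 PP).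
rewrite ger0_norm ?divr_ge0 ?enorm_ge0// -mulrA ler_wpM2l// mulrCA.
have [->|v0] := eqVneq (enorm (P^T *m g)) 0.
  by rewrite !mulr0 sqrtr_ge0.
by rewrite mulVf// mulr1.
Qed.

Context d0 (Omega : measurableType d0) (Pr : probability Omega R).
Variable P : {RV Pr >-> 'M[R]_(d, r)}.
Hypotheses (r_gt0 : (0 < r)%N) (rd : (r <= d)%N).
Hypothesis haarP : haar_matrix rd Pr P.

Let dr : R := d%:R / r%:R.
Let t := tau R d r.

Lemma measurable_progress d1 (T : measurableType d1)
    (Q : T -> 'M[R]_(d, r)) (g y : T -> 'cV[R]_d) :
  measurable_fun setT Q -> measurable_fun setT g -> measurable_fun setT y ->
  measurable_fun setT (fun w => progress (Q w) (g w) (y w)).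
Proof.
move=> mQ mg my; have mQg : measurable_fun setT (fun w => (Q w)^T *m g w).
  by apply: measurable_mulmx => //; exact: measurable_trmx.
apply: measurable_funM.
  by apply: measurable_dot => //; exact: measurable_mulmx.
under eq_fun do rewrite -powR_inv1 ?enorm_ge0//.
by apply: (measurableT_comp (measurable_powR (-1))); exact: measurable_enorm.
Qed.

(** exp(-z) <= 1 - z + z^2 at z = lam Y, with the lower bound on Y in the linear term and |Y| <=
    sqrt(d/r) |y| in the quadratic one; the lengths of P^T y and P^T (g - y) then average to tau
    times the lengths. *)
Lemma integral_expR_progress (lam : R) g y : 0 < lam ->
  lam * Num.sqrt dr * enorm y <= 4^-1 ->
  (\int[Pr]_w (expR (- (lam * progress (P w) g y)))%:E <=
   (1 - lam * t * enorm y + lam ^+ 2 * dr * enorm y ^+ 2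
    + 2 * lam * t * enorm (g - y))%:E)%E.
Proof.
move=> lam0 small.
have dr0 : 0 <= dr by rewrite divr_ge0.
have mP : measurable_fun setT P by [].
have mPv v : measurable_fun setT (fun w => (enorm ((P w)^T *m v))%:E).
  apply/measurable_EFinP; apply: measurable_enorm; apply: measurable_mulmx => //.
  exact: measurable_trmx.
have mexp : measurable_fun setT (fun w => (expR (- (lam * progress (P w) g y)))%:E).
  apply/measurable_EFinP; apply: measurableT_comp => //.
  apply: measurableT_comp => //; apply: measurable_funM => //.
  exact: measurable_progress.
pose A : R := 1 + lam ^+ 2 * dr * enorm y ^+ 2.
have A0 : 0 <= A.
  by rewrite addr_ge0//; exact: mulr_ge0 (mulr_ge0 (sqr_ge0 _) dr0) (sqr_ge0 _).
(* The negative term in |P^T y| is moved to the left, so that only nonnegative functions are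
   integrated. The pointwise comparison holds on the almost sure event that P has orthogonal
   columns. *)
pose f w : \bar R := ((expR (- (lam * progress (P w) g y)))%:E +
   (lam * enorm ((P w)^T *m y))%:E)%E.
pose h w : \bar R := (A%:E + (2 * lam * enorm ((P w)^T *m (g - y)))%:E)%E.
have l0 : 0 <= lam := ltW lam0.
have fh : (\int[Pr]_w f w <= \int[Pr]_w h w)%E.
  pose S := [set w | (P w)^T *m P w = dr%:M].
  have mS : measurable S.
    rewrite -[S]setTI; apply: (mP measurableT [set X | X^T *m X = dr%:M]).
    exact: measurable_stiefel.
  have S1 : Pr S = 1%E by exact: haar_matrix_stiefel haarP.
  have SC : Pr (~` S) = 0 by rewrite probability_setC// S1 subee.
  have f0 w : (0 <= f w)%E.
    by rewrite /f -EFinD lee_fin addr_ge0 ?expR_ge0// mulr_ge0 ?enorm_ge0.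
  have h0 w : (0 <= h w)%E.
    by rewrite /h -EFinD lee_fin addr_ge0// mulr_ge0 ?enorm_ge0// mulr_ge0.
  have mf : measurable_fun setT f.
    apply: emeasurable_funD => //; under eq_fun do rewrite EFinM.
    exact: measurable_funeM.
  have mh : measurable_fun setT h.
    apply: emeasurable_funD => //; under eq_fun do rewrite EFinM.
    exact: measurable_funeM.
  rewrite (@ge0_negligible_integral _ _ _ Pr setT (~` S))//; last exact: measurableC.
  rewrite [leRHS](@ge0_negligible_integral _ _ _ Pr setT (~` S))//; last exact: measurableC.
  rewrite setTD setCK; apply: ge0_le_integral => //.
  - exact: measurable_funTS.
  - exact: measurable_funTS.
  move=> w Sw; rewrite /f /h -!EFinD lee_fin.
  have Yb := normr_progress_le g y dr0 Sw.
  have Yl := progress_lower (P w) g y.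
  move: (progress (P w) g y) Yb Yl => Y Yb Yl.
  have lYb : `|- (lam * Y)| <= 4^-1.
    rewrite normrN normrM (ger0_norm l0); apply: le_trans small.
    by rewrite -mulrA ler_wpM2l.
  have Y2 : Y ^+ 2 <= dr * enorm y ^+ 2.
    rewrite -{1}(sqr_sqrtr dr0) -exprMn -real_normK ?num_real//.
    by rewrite ler_pXn2r ?nnegrE ?mulr_ge0 ?sqrtr_ge0 ?enorm_ge0.
  have := expR_second_order lYb; rewrite sqrrN exprMn.
  have := ler_wpM2l (sqr_ge0 lam) Y2; have := ler_wpM2l l0 Yl.
  rewrite /A; lra.
have mk k v : measurable_fun setT (fun w => (k * enorm ((P w)^T *m v))%:E).
  by under eq_fun do rewrite EFinM; exact: measurable_funeM.
have k0 k v w : 0 <= k -> (0 <= (k * enorm ((P w)^T *m v))%:E)%E.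
  by move=> k0; rewrite lee_fin mulr_ge0 ?enorm_ge0.
have fE : (\int[Pr]_w f w = \int[Pr]_w (expR (- (lam * progress (P w) g y)))%:E +
    \int[Pr]_w (lam * enorm ((P w)^T *m y))%:E)%E.
  by apply: ge0_integralD => // w _; exact: k0.
have hE : (\int[Pr]_w h w = \int[Pr]_w A%:E +
    \int[Pr]_w (2 * lam * enorm ((P w)^T *m (g - y)))%:E)%E.
  apply: ge0_integralD => //.
  by move=> w _; apply: k0; rewrite mulr_ge0.
have intZ k v : 0 <= k :> R -> (\int[Pr]_w (k * enorm ((P w)^T *m v))%:E = (k * (t *
    enorm v))%:E)%E.
  move=> kge0; under eq_integral do rewrite EFinM.
  rewrite ge0_integralZl//; last by move=> w _; rewrite lee_fin enorm_ge0.
  by rewrite (integral_haar_matrix_enorm r_gt0 haarP) -EFinM.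
move: fh; rewrite fE hE !intZ ?mulr_ge0// probability_integral_cst -EFinD.
rewrite -leeBrDr// -EFinB => h1; apply: le_trans h1 _.
by rewrite lee_fin /A; lra.
Qed.

End subspace_step.

(** * The supermartingale of the iterates *)

Section iterates.
Variables (R : realType) (d r : nat) (hr : (0 < r)%N) (hrd : (r <= d)%N).
Context (dX : measure_display) (Xi : measurableType dX) (D : probability Xi R).
Variables (g : 'cV[R]_d -> Xi -> 'cV[R]_d) (N : 'cV[R]_d -> 'cV[R]_d).
Hypothesis mg : measurable_fun setT (fun z : 'cV[R]_d * Xi => g z.1 z.2).
Hypothesis mN : measurable_fun setT N.
Variables (b : nat) (eta : R) (x0 : 'cV[R]_d).
Context (dO : measure_display) (Omega : measurableType dO) (Pr : probability Omega R).
Variables (P : nat -> {RV Pr >-> 'M[R]_(d, r)}) (xi : nat -> 'I_b -> {RV Pr >-> Xi}).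
Hypothesis hindep : mutually_independent Pr (draws_sigma P xi).

Let G := draws_sigma P xi.

Definition iterate k w := rs_nsgd g eta x0 (fun k => P k w) (fun k j => xi k j w) k.

Definition batch_grad k w := minibatch_grad g (fun j => xi k j w) (iterate k w).

Lemma iterateS k w : iterate k.+1 w = iterate k w -
  (eta / enorm ((P k w)^T *m batch_grad k w)) *:
  (P k w *m ((P k w)^T *m batch_grad k w)).
Proof. by rewrite -rs_nsgd_stepE. Qed.

(* The draws used before iteration [k], with the first [j] samples of
   iteration [k]. *)
Definition drawn (k j : nat) (i : nat + nat * 'I_b) : bool :=
  match i with
  | inl l => (l < k)%N
  | inr l => (l.1 < k)%N || (l.1 == k) && (l.2 < j)%N
  end.

Notation past k j := (known G (drawn k j)).

Lemma draws_measurable i : G i `<=` measurable.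
Proof. by case: i => [l|l] _ [A mA <-]; exact: measurable_funP. Qed.

Lemma draws_sigma_algebra i : sigma_algebra setT (G i).
Proof.
by case: i => l; apply: sigma_algebra_preimage; exact: sigma_algebra_measurable.
Qed.

Let measurable_g d0 (T : measurableType d0) (u : T -> 'cV[R]_d) (v : T -> Xi) :
  measurable_fun setT u -> measurable_fun setT v ->
  measurable_fun setT (fun t => g (u t) (v t)).
Proof. by move=> mu mv; exact: (measurableT_comp mg (measurable_fun_pair mu mv)). Qed.

(** The minibatch gradient is measurable with respect to draws that exclude [P k]: the matrix is
    fresh even once all samples of iteration k are known. *)
Lemma known_iterate_batch k :
  measurable_fun setT (iterate k : past k 0 -> 'cV[R]_d) /\
  measurable_fun setT (batch_grad k : past k b -> 'cV[R]_d).
Proof.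
have batch l : measurable_fun setT (iterate l : past l 0 -> 'cV[R]_d) ->
    measurable_fun setT (batch_grad l : past l b -> 'cV[R]_d).
  move=> mx; have mx' : measurable_fun setT (iterate l : past l b -> 'cV[R]_d).
    apply: sub_known mx => -[//|[m i]] /=.
    by rewrite ltn0 andbF orbF => ->.
  apply: measurable_scalemx => //; apply: measurable_summx => j.
  apply: measurable_g => //.
  by apply: (known_draw (j := inr (l, j))); rewrite //= eqxx ltn_ord orbT.
elim: k => [|k [mx mb]]; first by split; [|apply: batch]; exact: measurable_cst.
suff mx' : measurable_fun setT (iterate k.+1 : past k.+1 0 -> 'cV[R]_d).
  by split=> //; exact: batch.
have later j : subpred (drawn k j) (drawn k.+1 0).
  move=> [l|[l i]] /=; first exact: ltnW.
  by rewrite ltnS => /orP[/ltnW ->//|/andP[/eqP -> _]]; rewrite leqnn.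
have mxk := sub_known (@later 0) mx.
have mbk := sub_known (@later b) mb.
have mPk : measurable_fun setT (P k : past k.+1 0 -> 'M[R]_(d, r)).
  by apply: (known_draw (j := inl k)); rewrite //= ltnSn.
have mPg : measurable_fun setT
    ((fun w => (P k w)^T *m batch_grad k w) : past k.+1 0 -> 'cV[R]_r).
  by apply: measurable_mulmx => //; exact: measurable_trmx.
rewrite (_ : iterate k.+1 = fun w => iterate k w -
    (eta / enorm ((P k w)^T *m batch_grad k w)) *:
    (P k w *m ((P k w)^T *m batch_grad k w))); last by apply/funext => w; exact: iterateS.
apply: measurable_addmx => //; apply: measurable_oppmx.
apply: measurable_scalemx; last exact: measurable_mulmx.
apply: measurable_funM => //.
rewrite (_ : (fun w => _) = fun w => enorm ((P k w)^T *m batch_grad k w) `^ (- 1)); last first.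
  by apply/funext => w; rewrite -powR_inv1 ?enorm_ge0.
by apply: (measurableT_comp (measurable_powR (-1))); exact: measurable_enorm.
Qed.

Lemma measurable_iterate k : measurable_fun setT (iterate k).
Proof. by have [mx _] := known_iterate_batch k;
    exact: (measurable_known draws_measurable mx). Qed.

Variables (p sigma : R).
Hypotheses (p1 : 1 < p) (p2 : p <= 2) (sigma0 : 0 <= sigma).
Hypothesis hgint : forall x i, D.-integrable setT (fun z => (g x z i 0)%:E).
Hypothesis hgE : forall x i, (\int[D]_z (g x z i 0)%:E = (N x i 0)%:E)%E.
Hypothesis hmoment : forall x,
  (\int[D]_z (enorm (g x z - N x) `^ p)%:E <= (sigma `^ p)%:E)%E.
Hypothesis hxi : forall k j (A : set Xi), measurable A -> Pr (xi k j @^-1` A) = D A.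

Let integral_sample k j (h : Xi -> \bar R) : measurable_fun setT h ->
  (forall z, 0 <= h z)%E -> (\int[Pr]_w h (xi k j w) = \int[D]_z h z)%E.
Proof.
move=> mh h0; transitivity (\int[pushforward Pr (xi k j)]_z h z)%E.
  by rewrite ge0_integral_pushforward.
by apply: eq_measure_integral => A mA _; exact: hxi.
Qed.

Let noise_sum k j w : 'cV[R]_d :=
  \sum_(i < b | (i < j)%N) (g (iterate k w) (xi k i w) - N (iterate k w)).

Let noise_sumS k (j : 'I_b) w : noise_sum k j.+1 w =
  noise_sum k j w + (g (iterate k w) (xi k j w) - N (iterate k w)).
Proof.
rewrite /noise_sum (bigD1 j)//= addrC; congr (_ + _).
by apply: eq_bigl => i; rewrite ltnS ltn_neqAle andbC.
Qed.

Let known_noise_sum k j :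
  measurable_fun setT (noise_sum k j : past k j -> 'cV[R]_d).
Proof.
have [mx _] := known_iterate_batch k.
have mx' : measurable_fun setT (iterate k : past k j -> 'cV[R]_d).
  apply: sub_known mx => -[//|[m i]] /=.
  by rewrite ltn0 andbF orbF => ->.
apply: measurable_fun_mx => i i'.
rewrite (_ : (fun w => _) = fun w => \sum_(l < b)
    (if (l < j)%N then (g (iterate k w) (xi k l w) - N (iterate k w)) i i' else 0));
        last first.
  by apply/funext => w; rewrite /noise_sum summxE big_mkcond.
apply: measurable_sum => l; case: ltnP => [lj|_]; last exact: measurable_cst.
apply: measurable_coord; apply: measurable_addmx.
  apply: measurable_g => //; apply: (known_draw (j := inr (k, l))) => //=.
  by rewrite eqxx lj orbT.
by apply: measurable_oppmx; exact: (measurableT_comp mN mx').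
Qed.

Let sp := (1 + p) * sigma `^ p.

Let sp0 : 0 <= sp.
Proof. by rewrite mulr_ge0 ?powR_ge0// addr_ge0// ltW// (lt_trans _ p1). Qed.

Let integral_shift k j (x s : 'cV[R]_d) :
  (\int[Pr]_w (enorm (s + (g x (xi k j w) - N x)) `^ p)%:E <=
   (enorm s `^ p + sp)%:E)%E.
Proof.
have mgx : measurable_fun setT (fun z => g x z - N x).
  by apply: measurable_addmx => //; exact: measurable_g.
rewrite (@integral_sample k j (fun z => (enorm (s + (g x z - N x)) `^ p)%:E)); last 2 first.
- apply/measurable_EFinP; apply: (measurableT_comp (measurable_powR p)).
  by apply: measurable_enorm; exact: measurable_addmx.
- by move=> z; rewrite lee_fin powR_ge0.
have icst i : D.-integrable setT (EFin \o cst (N x i 0)).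
  apply: measurable_bounded_integrable => //; last exact: bounded_cst.
  exact: le_lt_trans (probability_le1 D measurableT) (ltry _).
have E i : (fun z => ((g x z - N x) i 0)%:E) =
    ((fun z => (g x z i 0%R)%:E) \- (EFin \o cst (N x i 0%R)))%E.
  by apply/funext => z; rewrite !mxE EFinB.
apply: integral_powR_shift => //.
- by move=> i; rewrite E; exact: integrableB.
- move=> i; rewrite E integralB// hgE [X in (_ - X)%E](probability_integral_cst D).
  by rewrite subee.
Qed.

(** Induction on the number of samples, each fresh given the earlier ones. The nonnegative weight
    [V], known before iteration k, stands for conditioning on the past. *)
Let noise_powR k (V : Omega -> R) j : (j <= b)%N ->
  measurable_fun setT (V : past k 0 -> R) -> (forall w, 0 <= V w) ->
  (\int[Pr]_w (V w * enorm (noise_sum k j w) `^ p)%:E <=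
   (j%:R * sp)%:E * \int[Pr]_w (V w)%:E)%E.
Proof.
move=> jb mV V0; elim: j jb => [_|j IH jb].
  rewrite mul0r mul0e (_ : (fun w => _) = fun=> 0%E) ?integral0//.
  apply/funext => w; rewrite /noise_sum big_pred0 => [|i]; last by rewrite ltn0.
  by rewrite enorm0 powR0 ?mulr0// gt_eqF// (lt_trans _ p1).
pose jo := Ordinal jb.
have [mx _] := known_iterate_batch k.
have grow j' : subpred (drawn k 0) (drawn k j').
  by move=> [//|[m i]] /=; rewrite ltn0 andbF orbF => ->.
have mV' := sub_known (@grow j) mV; have mx' := sub_known (@grow j) mx.
have mS := @known_noise_sum k j.
(* The absolute value is [V w] at the arguments used and keeps [f] nonnegative on the whole product
   space. *)
pose f (z : (R * ('cV[R]_d * 'cV[R]_d)) * Xi) : \bar R :=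
  (`|z.1.1| * enorm (z.1.2.2 + (g z.1.2.1 z.2 - N z.1.2.1)) `^ p)%:E.
pose h (z : R * ('cV[R]_d * 'cV[R]_d)) : \bar R :=
  (`|z.1| * (enorm z.2.2 `^ p + sp))%:E.
have mpow d1 (T : measurableType d1) (u : T -> 'cV[R]_d) : measurable_fun setT u ->
    measurable_fun setT (fun z => enorm (u z) `^ p).
  move=> mu; apply: (measurableT_comp (measurable_powR p)).
  exact: measurable_enorm.
have m21 : measurable_fun setT (fun z : R * ('cV[R]_d * 'cV[R]_d) => z.2.1).
  exact: (measurableT_comp measurable_fst measurable_snd).
have m22 : measurable_fun setT (fun z : R * ('cV[R]_d * 'cV[R]_d) => z.2.2).
  exact: (measurableT_comp measurable_snd measurable_snd).
have m11 : measurable_fun setT (fun z : R * ('cV[R]_d * 'cV[R]_d) => `|z.1|).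
  by apply: measurableT_comp => //; exact: measurable_fst.
have mf : measurable_fun setT f.
  have c1 := measurable_fst : measurable_fun setT (fst : (R * ('cV[R]_d * 'cV[R]_d)) * Xi
      -> _).
  apply/measurable_EFinP; apply: measurable_funM.
    exact: (measurableT_comp m11 c1).
  apply: mpow; apply: measurable_addmx; first exact: (measurableT_comp m22 c1).
  apply: measurable_addmx.
    by apply: measurable_g; [exact: (measurableT_comp m21 c1)|exact: measurable_snd].
  by apply: measurable_oppmx; exact: (measurableT_comp mN (measurableT_comp m21 c1)).
have mh : measurable_fun setT h.
  apply/measurable_EFinP; apply: measurable_funM => //.
  by apply: measurable_funD => //; exact: mpow.
pose X (w : Omega) : R * ('cV[R]_d * 'cV[R]_d) := (V w, (iterate k w, noise_sum k j w)).
have fE w : f (X w, xi k jo w) = (V w * enorm (noise_sum k j.+1 w) `^ p)%:E.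
  by rewrite /f /X /= (noise_sumS k jo) ger0_norm.
under [leLHS]eq_integral do rewrite -fE.
have step := @le_integral_draw R dO Omega Pr _ G draws_measurable draws_sigma_algebra
  hindep (drawn k j) (inr (k, jo)) _ _ _ _ X (xi k jo) f h.
apply: (le_trans (step _ _ _ mf _ mh _)).
- by rewrite /= ltnn eqxx /= ltnn.
- by [].
- by apply: measurable_fun_pair => //; exact: measurable_fun_pair.
- by move=> z; rewrite lee_fin mulr_ge0 ?powR_ge0.
- move=> [v [x s]]; rewrite /f /h /=.
  under eq_integral do rewrite EFinM.
  rewrite ge0_integralZl//.
  + by rewrite EFinM lee_wpmul2l ?lee_fin// integral_shift.
  + apply/measurable_EFinP; apply: mpow; apply: measurable_addmx => //.
    by apply: measurable_addmx => //; exact: measurable_g.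
  + by move=> w _; rewrite lee_fin powR_ge0.
have mVO := measurable_known draws_measurable mV.
have mSO := measurable_known draws_measurable mS.
rewrite (_ : (fun w => h _) = (fun w => (V w * enorm (noise_sum k j w) `^ p)%:E + sp%:E *
    (V w)%:E)%E); last first.
  by apply/funext => w; rewrite /h /= ger0_norm// -EFinM -EFinD; congr EFin; ring.
rewrite ge0_integralD//; last 4 first.
- by move=> w _; rewrite lee_fin mulr_ge0 ?powR_ge0.
- by apply/measurable_EFinP; apply: measurable_funM => //; exact: mpow.
- by move=> w _; rewrite -EFinM lee_fin mulr_ge0.
- by apply: measurable_funeM; exact/measurable_EFinP.
rewrite ge0_integralZl//; last 2 first.
- exact/measurable_EFinP.
- by move=> w _; rewrite lee_fin.
apply: le_trans (leeD2r _ (IH (ltnW jb))) _.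
rewrite -ge0_muleDl ?lee_fin ?(mulr_ge0 (ler0n _ j) sp0)//.
rewrite lee_wpmul2r//; first by apply: integral_ge0 => w _; rewrite lee_fin.
by rewrite -EFinD lee_fin -natr1 mulrDl mul1r.
Qed.

(** From the p-th moment to the first, under the unnormalized measure V dPr: Bernoulli gives |S| <=
    c (1 - 1/p) + (c/p) (|S|/c)^p, and the assumption on c makes the two parts add up to c. *)
Let noise_le k (V : Omega -> R) c : 0 < c -> b%:R * sp <= c `^ p ->
  measurable_fun setT (V : past k 0 -> R) -> (forall w, 0 <= V w) ->
  (\int[Pr]_w (V w * enorm (noise_sum k b w))%:E <=
   c%:E * \int[Pr]_w (V w)%:E)%E.
Proof.
move=> c0 bc mV V0; have p0 : 0 < p by exact: lt_trans p1.
have cp0 : 0 < c `^ p by rewrite powR_gt0.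
have cV : c^-1 `^ p = (c `^ p)^-1 by rewrite -(powR_inv1 (ltW c0)) -powRrM mulN1r powRN.
have ip1 : p^-1 <= 1 by rewrite invf_le1// ltW.
have ip0 : 0 < p^-1 by rewrite invr_gt0.
have mVO := measurable_known draws_measurable mV.
have mS := measurable_known draws_measurable (@known_noise_sum k b).
have mSn := measurable_enorm mS.
have A0 : 0 <= c * (1 - p^-1) by rewrite mulr_ge0 ?subr_ge0// ltW.
have B0 : 0 <= c * p^-1 / c `^ p by rewrite !mulr_ge0 ?invr_ge0// ltW.
have mSp : measurable_fun setT (fun w => enorm (noise_sum k b w) `^ p).
  exact: (measurableT_comp (measurable_powR p)).
apply: (@le_trans _ _ (\int[Pr]_w ((c * (1 - p^-1))%:E * (V w)%:E +
    (c * p^-1 / c `^ p)%:E * (V w * enorm (noise_sum k b w) `^ p)%:E))%E).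
  apply: ge0_le_integral => //.
  - by move=> w _; rewrite lee_fin mulr_ge0 ?enorm_ge0.
  - by apply/measurable_EFinP; exact: measurable_funM.
  - apply: emeasurable_funD; apply: measurable_funeM; apply/measurable_EFinP => //.
    exact: measurable_funM.
  - move=> w _; rewrite -!EFinM -EFinD lee_fin.
    have S0 : 0 <= enorm (noise_sum k b w) / c by rewrite divr_ge0 ?enorm_ge0// ltW.
    have := powR_bernoulli (powR_ge0 (enorm (noise_sum k b w) / c) p) ip0 ip1.
    rewrite -powRrM divff ?gt_eqF// powRr1// powRM ?enorm_ge0 ?invr_ge0 ?(ltW c0)//.
    rewrite cV ler_pdivrMr// => h.
    apply: le_trans (ler_wpM2l (V0 w) h) _.
    by rewrite le_eqVlt; apply/orP; left; apply/eqP; ring.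
rewrite ge0_integralD//; last 4 first.
- by move=> w _; rewrite -EFinM lee_fin mulr_ge0.
- by apply: measurable_funeM; exact/measurable_EFinP.
- by move=> w _; rewrite -EFinM lee_fin; apply: mulr_ge0 => //; rewrite mulr_ge0 ?powR_ge0.
- by apply: measurable_funeM; apply/measurable_EFinP; exact: measurable_funM.
rewrite !ge0_integralZl//; last 4 first.
- by apply/measurable_EFinP; exact: measurable_funM.
- by move=> w _; rewrite lee_fin mulr_ge0 ?powR_ge0.
- exact/measurable_EFinP.
- by move=> w _; rewrite lee_fin.
have I0 : (0 <= \int[Pr]_w (V w)%:E)%E by apply: integral_ge0 => w _; rewrite lee_fin.
have B0' : (0 <= (c * p^-1 / c `^ p)%:E)%E by rewrite lee_fin.
apply: le_trans (leeD2l _ (lee_wpmul2l B0' (noise_powR (leqnn b) mV V0))) _.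
rewrite muleA -ge0_muleDl ?lee_fin//; last first.
  by rewrite mulr_ge0// (mulr_ge0 (ler0n _ b) sp0).
rewrite lee_wpmul2r// -EFinD lee_fin.
have h : c * p^-1 / c `^ p * (b%:R * sp) <= c * p^-1.
  by rewrite mulrAC ler_pdivrMr// ler_wpM2l// mulr_ge0// ltW.
by rewrite mulrBr mulr1; lra.
Qed.

Hypothesis b0 : (0 < b)%N.

Let noise k w := enorm (batch_grad k w - N (iterate k w)).

Let noiseE k w : noise k w = b%:R^-1 * enorm (noise_sum k b w).
Proof.
have bN0 : (b%:R : R) != 0 by rewrite pnatr_eq0 -lt0n.
have {1}<- : `|b%:R^-1 : R| = b%:R^-1 by rewrite ger0_norm// invr_ge0.
rewrite /noise -enormZ; congr enorm.
rewrite /noise_sum (eq_bigl xpredT) => [|i]; last by rewrite ltn_ord.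
rewrite sumrB sumr_const card_ord scalerBr -[N _ *+ b]scaler_nat scalerA mulVf//.
by rewrite scale1r.
Qed.

Definition noise_level : R := 2 * sigma * b%:R `^ p^-1 / b%:R.

Lemma integral_noise_le k (V : Omega -> R) :
  measurable_fun setT (V : past k 0 -> R) -> (forall w, 0 <= V w) ->
  (\int[Pr]_w (V w)%:E < +oo)%E ->
  (\int[Pr]_w (V w * enorm (batch_grad k w - N (iterate k w)))%:E <=
   noise_level%:E * \int[Pr]_w (V w)%:E)%E.
Proof.
move=> mV V0 Vfin; have p0 : 0 < p by exact: lt_trans p1.
have bpos : 0 < (b%:R : R) by rewrite ltr0n.
have mVO := measurable_known draws_measurable mV.
have mS := measurable_known draws_measurable (@known_noise_sum k b).
under eq_integral => w _ do rewrite -/(noise k w) noiseE mulrCA EFinM.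
rewrite ge0_integralZl//; last 2 first.
- by apply/measurable_EFinP; apply: measurable_funM => //; exact: measurable_enorm.
- by move=> w _; rewrite lee_fin mulr_ge0 ?enorm_ge0.
rewrite /noise_level mulrC EFinM -muleA lee_wpmul2l ?lee_fin ?invr_ge0 ?(ltW bpos)//.
have I0 : (0 <= \int[Pr]_w (V w)%:E)%E by apply: integral_ge0 => w _; rewrite lee_fin.
have /fineK IE : (\int[Pr]_w (V w)%:E)%E \is a fin_num by rewrite ge0_fin_numE.
have v0 := fine_ge0 I0; rewrite -IE in I0 *.
set v := fine _ in v0 I0 IE *.
(* Bernoulli with exponent 1/p: (1 + p)^(1/p) <= 1 + p/p = 2. This is the factor 2 of
   [noise_level]. *)
have p12 : 1 + p <= 2 `^ p.
  have h : (1 + p) `^ p^-1 <= 2.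
    apply: le_trans (powR_bernoulli _ _ _) _; rewrite ?invr_gt0 ?invf_le1 ?(ltW p1)//.
      by rewrite addr_ge0// ltW.
    by rewrite [1 + p]addrC addrK mulVf ?gt_eqF//; lra.
  rewrite [leLHS](_ : _ = ((1 + p) `^ p^-1) `^ p); last first.
    by rewrite -powRrM mulVf ?gt_eqF// powRr1// addr_ge0// ltW.
  by rewrite ge0_ler_powR ?nnegrE ?powR_ge0// ltW.
(* [noise_le] needs c > 0, while 2 sigma b^(1/p) is 0 for sigma = 0. The increment e / (v + 1) costs
   at most e after multiplication by the integral v of [V]. *)
apply/lee_addgt0Pr => e e0.
have c0 : 0 < 2 * sigma * b%:R `^ p^-1 + e / (v + 1).
  by rewrite ltr_wpDl ?divr_gt0 ?ltr_wpDl// !mulr_ge0 ?powR_ge0.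
apply: le_trans (noise_le c0 _ mV V0) _; last first.
  rewrite -[X in (_ * X)%E]IE -EFinM -EFinD lee_fin mulrDl lerD2l.
  by rewrite mulrAC ler_pdivrMr ?ltr_wpDl// ler_wpM2l ?(ltW e0)// lerDl.
apply: (@le_trans _ _ ((2 * sigma * b%:R `^ p^-1) `^ p)).
  rewrite !powRM ?mulr_ge0 ?powR_ge0// -powRrM mulVf ?gt_eqF// powRr1//.
  by rewrite /sp mulrC ler_wpM2r// ler_wpM2r ?powR_ge0.
rewrite ge0_ler_powR ?nnegrE ?(ltW p0) ?(ltW c0)//.
  by rewrite !mulr_ge0 ?powR_ge0.
by rewrite lerDl divr_ge0 ?addr_ge0 ?(ltW e0).
Qed.

Hypothesis hP : forall k, haar_matrix hrd Pr (P k).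
Variables lam M : R.
Let dr : R := d%:R / r%:R.
Let t := tau R d r.
Hypotheses (lam0 : 0 < lam) (lamM : lam * Num.sqrt dr * M <= 4^-1).

(** 1 + [drift] bounds the mean of exp(-lam Y_k) given x_k, once the noise is replaced by
    [noise_level]. *)
Let drift x := - (lam * t * enorm (N x)) + lam ^+ 2 * dr * enorm (N x) ^+ 2
  + 2 * lam * t * noise_level.

Definition step_progress k w := progress (P k w) (batch_grad k w) (N (iterate k w)).

Let small x := enorm (N x) <= M.

(* Vanishing where the gradient is large makes the weights integrable; the
   iterates never get there. *)
Let compensator x := if small x then expR (- drift x) else 0.

Fixpoint weight k w := if k is l.+1 then
  weight l w * compensator (iterate l w) * expR (- (lam * step_progress l w)) else 1.

Let measurable_enormN d1 (S : measurableType d1) (y : S -> 'cV[R]_d) :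
  measurable_fun setT y -> measurable_fun setT (fun z => enorm (N (y z))).
Proof. by move=> my; apply: measurable_enorm; exact: measurableT_comp my. Qed.

Let measurable_small d1 (S : measurableType d1) (y : S -> 'cV[R]_d) :
  measurable_fun setT y -> measurable_fun setT (fun z => small (y z)).
Proof. by move=> my; apply: measurable_fun_ler; [exact: measurable_enormN|]. Qed.

Let compensator_ge0 x : 0 <= compensator x.
Proof. by rewrite /compensator; case: ifP => // _; exact: expR_ge0. Qed.

Let t0 : 0 < t.
Proof. by have /andP[] := haar_tau_bounds hr (hP 0). Qed.

Let t_sqrt : t <= Num.sqrt dr.
Proof. by have /andP[] := haar_tau_bounds hr (hP 0). Qed.

Let dr0 : 0 <= dr.
Proof. by rewrite divr_ge0. Qed.

Let noise_level_ge0 : 0 <= noise_level.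
Proof. by rewrite /noise_level divr_ge0// !mulr_ge0// powR_ge0. Qed.

Let lamt0 : 0 <= 2 * lam * t.
Proof. by apply: mulr_ge0 (ltW t0); apply: mulr_ge0 (ltW lam0). Qed.

Let small_lam x : small x -> lam * t * enorm (N x) <= 4^-1.
Proof.
move=> sx; apply: le_trans lamM.
apply: (@le_trans _ _ (lam * Num.sqrt dr * enorm (N x))).
  by rewrite ler_wpM2r ?enorm_ge0// ler_wpM2l// ltW.
by rewrite ler_wpM2l// mulr_ge0 ?sqrtr_ge0// ltW.
Qed.

Let compensator_le x : compensator x <= expR 4^-1.
Proof.
rewrite /compensator; case: ifPn => [sx|_]; last exact: expR_ge0.
rewrite ler_expR /drift.
have h1 : 0 <= lam ^+ 2 * dr * enorm (N x) ^+ 2 by rewrite !mulr_ge0 ?exprn_ge0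
    ?enorm_ge0// ltW.
have h2 : 0 <= 2 * lam * t * noise_level by exact: mulr_ge0 lamt0 noise_level_ge0.
by have h3 := small_lam sx; lra.
Qed.

Let compensator_drift x : compensator x * (1 + drift x) <= 1.
Proof.
rewrite /compensator; case: ifPn => [sx|_]; last by rewrite mul0r.
rewrite -[leRHS](expRxMexpNx_1 (drift x)) mulrC ler_wpM2r ?expR_ge0//.
exact: expR_ge1Dx.
Qed.

Lemma weight_ge0 k w : 0 <= weight k w.
Proof.
elim: k => [|k IH]; first exact: ler01.
exact: mulr_ge0 (mulr_ge0 IH (compensator_ge0 _)) (expR_ge0 _).
Qed.

Let measurable_compensator d1 (S : measurableType d1) (y : S -> 'cV[R]_d) :
  measurable_fun setT y -> measurable_fun setT (fun z => compensator (y z)).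
Proof.
move=> my; apply: measurable_fun_ifT => //; first exact: measurable_small.
apply: measurableT_comp => //; apply: measurableT_comp => //.
have me := measurable_enormN my.
apply: measurable_funD => //; apply: measurable_funD.
  by apply: measurableT_comp => //; exact: measurable_funM.
by apply: measurable_funM => //; exact: measurable_funX.
Qed.

Let known_weight k : measurable_fun setT (weight k : past k 0 -> R).
Proof.
elim: k => [|k IH]; first exact: measurable_cst.
have [mx mb] := known_iterate_batch k.
have later j : subpred (drawn k j) (drawn k.+1 0).
  move=> [l|[l i]] /=; first exact: ltnW.
  by rewrite ltnS => /orP[/ltnW ->//|/andP[/eqP -> _]]; rewrite leqnn.
have mxk := sub_known (@later 0) mx.
have mbk := sub_known (@later b) mb.
have mWk := sub_known (@later 0) IH.
have mPk : measurable_fun setT (P k : past k.+1 0 -> 'M[R]_(d, r)).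
  by apply: (known_draw (j := inl k)); rewrite //= ltnSn.
apply: measurable_funM; first by apply: measurable_funM => //; exact: measurable_compensator.
apply: measurableT_comp => //; apply: measurableT_comp => //; apply: measurable_funM => //.
by apply: measurable_progress => //; exact: (measurableT_comp mN mxk).
Qed.

(** Within an iteration [P k] is integrated first, with the samples frozen, then the samples against
    the weight [V]. The result is 1 + [drift], which the compensator cancels by exp(-z) (1 + z) <=
    1. *)
Lemma integral_weight_le k : (\int[Pr]_w (weight k w)%:E <= 1%:E)%E.
Proof.
elim: k => [|k IH]; first by rewrite probability_integral_cst.
pose V w := weight k w * compensator (iterate k w).
have V0 w : 0 <= V w by rewrite mulr_ge0 ?weight_ge0 ?compensator_ge0.
have [mx mb] := known_iterate_batch k.
have mV : measurable_fun setT (V : past k 0 -> R).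
  by apply: measurable_funM; [exact: known_weight|exact: measurable_compensator].
have mVO := measurable_known draws_measurable mV.
have mxO := measurable_known draws_measurable mx.
have mbO := measurable_known draws_measurable mb.
have mWO := measurable_known draws_measurable (known_weight (k := k)).
have Vfin : (\int[Pr]_w (V w)%:E < +oo)%E.
  apply: (@le_lt_trans _ _ (\int[Pr]_w ((expR 4^-1)%:E * (weight k w)%:E))%E).
    apply: ge0_le_integral => //.
    - by move=> w _; rewrite lee_fin.
    - exact/measurable_EFinP.
    - by apply: measurable_funeM; exact/measurable_EFinP.
    - by move=> w _; rewrite -EFinM lee_fin mulrC;
        exact: ler_wpM2l (weight_ge0 _ _) _ _ (compensator_le _).
  rewrite ge0_integralZl//; last 2 first.
  - exact/measurable_EFinP.
  - by move=> w _; rewrite lee_fin weight_ge0.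
  by apply: le_lt_trans (lee_wpmul2l _ IH) _; rewrite ?lee_fin ?expR_ge0// -EFinM ltry.
pose f (z : (R * ('cV[R]_d * 'cV[R]_d)) * 'M[R]_(d, r)) : \bar R :=
  (if small z.1.2.1 then
     `|z.1.1| * expR (- (lam * progress z.2 z.1.2.2 (N z.1.2.1))) else 0)%:E.
pose dev (y gg : 'cV[R]_d) := 1 - lam * t * enorm (N y) + lam ^+ 2 * dr * enorm (N y) ^+ 2
  + 2 * lam * t * enorm (gg - N y).
pose h (z : R * ('cV[R]_d * 'cV[R]_d)) : \bar R :=
  (if small z.2.1 then `|z.1| * dev z.2.1 z.2.2 else 0)%:E.
pose X (w : Omega) : R * ('cV[R]_d * 'cV[R]_d) := (V w, (iterate k w, batch_grad k w)).
have fE w : f (X w, P k w) = (weight k.+1 w)%:E.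
  rewrite /f /X /=; case: ifPn => [_|sx]; first by rewrite ger0_norm.
  by rewrite /compensator (negbTE sx) mulr0 mul0r.
have hE w : h (X w) = (V w * dev (iterate k w) (batch_grad k w))%:E.
  rewrite /h /X /=; case: ifPn => [_|sx]; first by rewrite ger0_norm.
  by rewrite /V /compensator (negbTE sx) mulr0 mul0r.
have m1 : measurable_fun setT (fun z : R * ('cV[R]_d * 'cV[R]_d) => `|z.1|).
  by apply: measurableT_comp => //; exact: measurable_fst.
have m21 : measurable_fun setT (fun z : R * ('cV[R]_d * 'cV[R]_d) => z.2.1).
  exact: (measurableT_comp measurable_fst measurable_snd).
have m22 : measurable_fun setT (fun z : R * ('cV[R]_d * 'cV[R]_d) => z.2.2).
  exact: (measurableT_comp measurable_snd measurable_snd).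
have c1 := measurable_fst : measurable_fun setT
  (fst : (R * ('cV[R]_d * 'cV[R]_d)) * 'M[R]_(d, r) -> _).
have mf : measurable_fun setT f.
  apply/measurable_EFinP; apply: measurable_fun_ifT => //.
    exact: (measurable_small (measurableT_comp m21 c1)).
  apply: measurable_funM; first exact: (measurableT_comp m1 c1).
  apply: measurableT_comp => //; apply: measurableT_comp => //; apply: measurable_funM => //.
  apply: measurable_progress; [exact: measurable_snd|exact: (measurableT_comp m22 c1)|].
  exact: (measurableT_comp mN (measurableT_comp m21 c1)).
have mdev d1 (S : measurableType d1) (y gg : S -> 'cV[R]_d) : measurable_fun setT y ->
    measurable_fun setT gg -> measurable_fun setT (fun z => dev (y z) (gg z)).
  move=> my mgg; have me := measurable_enormN my.
  apply: measurable_funD; last first.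
    apply: measurable_funM => //; apply: measurable_enorm; apply: measurable_addmx => //.
    by apply: measurable_oppmx; exact: (measurableT_comp mN my).
  apply: measurable_funD; last by apply: measurable_funM => //; exact: measurable_funX.
  by apply: measurable_funB => //; exact: measurable_funM.
have mh : measurable_fun setT h.
  apply/measurable_EFinP; apply: measurable_fun_ifT => //; first exact: measurable_small.
  by apply: measurable_funM => //; exact: mdev.
under [leLHS]eq_integral do rewrite -fE.
have step := @le_integral_draw R dO Omega Pr _ G draws_measurable draws_sigma_algebra
  hindep (drawn k b) (inl k) _ _ _ _ X (P k) f h.
apply: (le_trans (step _ _ _ mf _ mh _)).
- by rewrite /= ltnn.
- by [].
- have grow : subpred (drawn k 0) (drawn k b).
    by move=> [//|[m i]] /=; rewrite ltn0 andbF orbF => ->.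
  have mV' := sub_known grow mV; have mx' := sub_known grow mx.
  by apply: measurable_fun_pair => //; exact: measurable_fun_pair.
- by move=> z; rewrite lee_fin; case: ifP => // _; rewrite mulr_ge0 ?expR_ge0.
- move=> [v [y gg]]; rewrite /f /h /=; case: ifPn => [sy|_]; last first.
    by rewrite probability_integral_cst.
  under eq_integral do rewrite EFinM.
  rewrite ge0_integralZl//.
  + rewrite EFinM lee_wpmul2l ?lee_fin//; apply: (integral_expR_progress hr (hP k)) => //.
    by apply: le_trans lamM; rewrite ler_wpM2l// mulr_ge0 ?sqrtr_ge0// ltW.
  + apply/measurable_EFinP; apply: measurableT_comp => //; apply: measurableT_comp => //.
    by apply: measurable_funM => //; exact: measurable_progress.
under eq_integral do rewrite hE.
(* The part of [dev] free of noise. Where [V] is nonzero, lam t |N| <= 1/4 makes it nonnegative, so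
   the integral splits without integrability questions. *)
pose A y := 1 - lam * t * enorm (N y) + lam ^+ 2 * dr * enorm (N y) ^+ 2.
have VA0 w : 0 <= V w * A (iterate k w).
  rewrite /V /compensator; case: ifPn => [sx|_]; last by rewrite mulr0 mul0r.
  rewrite !mulr_ge0 ?weight_ge0 ?expR_ge0// /A.
  have := small_lam sx.
  have : 0 <= lam ^+ 2 * dr * enorm (N (iterate k w)) ^+ 2.
    by rewrite !mulr_ge0 ?exprn_ge0 ?enorm_ge0// ltW.
  lra.
have mA : measurable_fun setT (fun w => V w * A (iterate k w)).
  apply: measurable_funM => //; have me := measurable_enormN mxO.
  apply: measurable_funD; last by apply: measurable_funM => //; exact: measurable_funX.
  by apply: measurable_funB => //; exact: measurable_funM.
have mdist : measurable_fun setT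
    (fun w => V w * enorm (batch_grad k w - N (iterate k w))).
  apply: measurable_funM => //; apply: measurable_enorm; apply: measurable_addmx => //.
  by apply: measurable_oppmx; exact: (measurableT_comp mN mxO).
rewrite (_ : (fun w => _) = (fun w => (V w * A (iterate k w))%:E +
    (2 * lam * t)%:E * (V w * enorm (batch_grad k w - N (iterate k w)))%:E)%E); last first.
  by apply/funext => w; rewrite -EFinM -EFinD /dev /A; congr EFin; ring.
rewrite ge0_integralD//; last 4 first.
- by move=> w _; rewrite lee_fin.
- exact/measurable_EFinP.
- by move=> w _; rewrite -EFinM lee_fin mulr_ge0// mulr_ge0 ?enorm_ge0.
- by apply: measurable_funeM; exact/measurable_EFinP.
rewrite [X in (_ + X)%E]ge0_integralZl//; last 2 first.
- exact/measurable_EFinP.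
- by move=> w _; rewrite lee_fin mulr_ge0 ?enorm_ge0.
apply: le_trans (leeD2l _ (lee_wpmul2l _ (integral_noise_le mV V0 Vfin))) _.
  by rewrite lee_fin.
have VsE : ((2 * lam * t)%:E * (noise_level%:E * \int[Pr]_w (V w)%:E) =
    \int[Pr]_w (2 * lam * t * noise_level * V w)%:E)%E.
  rewrite muleA -EFinM -ge0_integralZl//.
  - exact/measurable_EFinP.
  - by move=> w _; rewrite lee_fin.
  - by rewrite lee_fin mulr_ge0 ?noise_level_ge0.
rewrite VsE -ge0_integralD//; last 4 first.
- by move=> w _; rewrite lee_fin.
- exact/measurable_EFinP.
- by move=> w _; rewrite lee_fin mulr_ge0// mulr_ge0 ?noise_level_ge0.
- by apply/measurable_EFinP; exact: measurable_funM.
apply: le_trans IH; apply: ge0_le_integral => //.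
- move=> w _; rewrite -EFinD lee_fin addr_ge0// mulr_ge0//.
  by exact: mulr_ge0 lamt0 noise_level_ge0.
- by apply: emeasurable_funD; apply/measurable_EFinP => //; exact: measurable_funM.
- exact/measurable_EFinP.
move=> w _; rewrite -EFinD lee_fin.
rewrite (_ : _ + _ = weight k w * (compensator (iterate k w) * (1 + drift (iterate k w)))).
  by rewrite ler_piMr ?weight_ge0 ?compensator_drift.
by rewrite /V /A /drift; ring.
Qed.

Lemma weight_expR k w :
  (forall l, (l < k)%N -> enorm (N (iterate l w)) <= M) ->
  weight k w = expR (\sum_(l < k) (- drift (iterate l w) - lam * step_progress l w)).
Proof.
elim: k => [|k IH] sk; first by rewrite big_ord0 expR0.
rewrite big_ord_recr /= IH => [|l lk]; last by apply: sk; exact: ltnW.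
by rewrite /compensator /small (sk k (ltnSn k)) -mulrA -!expRD.
Qed.

Lemma weight_lt_probability k delta : 0 < delta ->
  measurable [set w | weight k w < delta^-1] /\
  ((1 - delta)%:E <= Pr [set w | (weight k w < delta^-1)%R])%E.
Proof.
move=> de0; have mW := measurable_known draws_measurable (known_weight (k := k)).
have mlt : measurable [set w | weight k w < delta^-1].
  have := measurable_fun_ltr mW (measurable_cst delta^-1).
  by move=> /(_ measurableT [set true] I); rewrite setTI.
split=> //; pose A := [set w | weight k w < delta^-1].
have mAC : measurable (~` A) by exact: measurableC.
have tail : (Pr (~` A) <= delta%:E)%E.
  have h : ((delta^-1)%:E * Pr (~` A) <= 1)%E.
    apply: le_trans (integral_weight_le k).
    rewrite -integral_cst//; apply: (@le_trans _ _ (\int[Pr]_(w in ~` A) (weight k w)%:E)%E).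
      apply: ge0_le_integral => //.
      - by move=> w _; rewrite lee_fin invr_ge0 ltW.
      - by apply/measurable_EFinP; exact: measurable_funTS.
      - by move=> w /negP; rewrite -leNgt lee_fin.
    apply: ge0_subset_integral => //; first exact/measurable_EFinP.
    by move=> w _; rewrite lee_fin weight_ge0.
  have := lee_wpmul2l (ltW de0 : (0 <= delta%:E)%E) h.
  by rewrite muleA -EFinM mulfV ?gt_eqF// mul1e mule1.
have := probability_setC Pr mAC; rewrite setCK => ->.
by rewrite EFinB leeB.
Qed.

End iterates.

(** * The rate *)

(** Deterministic. The choice of [lam] makes the quadratic term at most a quarter of lam t n_k, so
    3/4 of the linear term survives: every constant carries the resulting 4/3, times 1, 1/2, 2 and 4
    respectively. *)
Lemma average_gradient_bound (R : realType) (T : nat) (n y : nat -> R)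
    (t dr L eta Delta0 s ell M : R) :
  (0 < T)%N -> 0 < t -> 0 < dr -> 0 < eta -> 0 < M ->
  let lam := t / (4 * dr * M) in
  (forall k, (k < T)%N -> 0 <= n k <= M) ->
  eta * (\sum_(k < T) y k) <= Delta0 + T%:R * (L / 2 * eta ^+ 2 * dr) ->
  \sum_(k < T) (- (- (lam * t * n k) + lam ^+ 2 * dr * n k ^+ 2 + 2 * lam * t * s)
    - lam * y k) <= ell ->
  T%:R^-1 * (\sum_(k < T) n k) <= 4 / 3 * (Delta0 / (t * eta * T%:R))
    + 2 / 3 * (dr * eta * L / t) + 8 / 3 * s
    + 16 / 3 * (dr * M * ell / (t ^+ 2 * T%:R)).
Proof.
move=> T0 t0 dr0 eta0 M0 lam nM sumy sumW.
have TR : 0 < T%:R :> R by rewrite ltr0n.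
have lam0 : 0 < lam by rewrite divr_gt0 ?mulr_gt0.
have lamE : lam ^+ 2 * dr * M = lam * (t / 4).
  by rewrite /lam; field; rewrite !gt_eqF.
have lamV : lam = t / (4 * dr * M) by [].
clearbody lam; set S := \sum_(k < T) n k; set Y := \sum_(k < T) y k in sumy.
have low : lam * (3 / 4 * t * S - 2 * t * s * T%:R - Y) <= ell.
  apply: le_trans sumW.
  rewrite [leLHS](_ : _ = \sum_(k < T) (lam * (3 / 4 * t * n k - 2 * t * s - y k))).
    apply: ler_sum => k _; have /andP[n0 nkM] := nM k (ltn_ord k).
    have h : lam ^+ 2 * dr * n k ^+ 2 <= lam * (t / 4) * n k.
      rewrite -lamE [n k ^+ 2]expr2 mulrA ler_wpM2r// ler_wpM2l//.
      by rewrite mulr_ge0 ?exprn_ge0 ?(ltW lam0) ?(ltW dr0).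
    lra.
  rewrite -mulr_sumr !sumrB -mulr_sumr -/S -/Y; congr (lam * (_ - _ - _)).
  by rewrite sumr_const card_ord mulr_natr.
have {}low : 3 / 4 * t * S <= 2 * t * s * T%:R + Y + ell / lam.
  move: low; rewrite mulrC -ler_pdivlMr//; lra.
have Yle : Y <= Delta0 / eta + T%:R * (L / 2 * eta * dr).
  rewrite -(ler_pM2l eta0); apply: le_trans sumy _.
  by rewrite le_eqVlt; apply/orP; left; apply/eqP; field; rewrite gt_eqF.
have Sle : S <= 4 / 3 * (2 * s * T%:R + Delta0 / (eta * t) + T%:R * (L / 2 * eta * dr / t)
    + 4 * dr * M * ell / t ^+ 2).
  have c0 : 0 < 3 / 4 * t by rewrite mulr_gt0// divr_gt0.
  rewrite -(ler_pM2l c0); apply: le_trans low _.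
  apply: (@le_trans _ _ (2 * t * s * T%:R + (Delta0 / eta + T%:R * (L / 2 * eta * dr)) +
      ell / lam)).
    by rewrite lerD2r lerD2l.
  by rewrite le_eqVlt; apply/orP; left; apply/eqP; rewrite lamV; field; rewrite !gt_eqF.
rewrite ler_pdivrMl//; apply: le_trans Sle _.
by rewrite le_eqVlt; apply/orP; left; apply/eqP; field; rewrite !gt_eqF.
Qed.

(** * Deterministic estimates along one path *)

Section nsgd_path.
Variables (R : realType) (d r : nat).
Variables (F : 'cV[R]_d -> R) (L : R).
Hypothesis dF : forall x, differentiable F x.
Hypothesis lipF : forall x y, enorm (grad F x - grad F y) <= L * enorm (x - y).
Hypothesis L0 : 0 < L.
Variables (x gg : nat -> 'cV[R]_d) (P : nat -> 'M[R]_(d, r)) (eta c : R) (T : nat).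
Hypotheses (eta0 : 0 <= eta) (c0 : 0 <= c).
Hypothesis xS : forall k, x k.+1 = x k - (eta / enorm ((P k)^T *m gg k)) *:
  (P k *m ((P k)^T *m gg k)).
Hypothesis PP : forall k, (k < T)%N -> (P k)^T *m P k = c%:M.

Lemma path_gradient_le k : (k <= T)%N ->
  enorm (grad F (x k)) <= enorm (grad F (x 0)) + L * eta * k%:R * Num.sqrt c.
Proof.
elim: k => [_|k IH kT]; first by rewrite mulr0 mul0r addr0.
apply: (@le_trans _ _ (enorm (grad F (x k)) + L * (eta * Num.sqrt c))).
  rewrite -[grad F (x k.+1)](subrK (grad F (x k))) addrC.
  apply: le_trans (ler_enormD _ _) _; rewrite lerD2l.
  apply: le_trans (lipF _ _) _; rewrite ler_wpM2l ?(ltW L0)//.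
  rewrite xS addrC addKr enormN.
  exact: rs_nsgd_step_length (PP kT) eta0.
apply: le_trans (lerD (IH (ltnW kT)) (lexx _)) _.
by rewrite le_eqVlt -natr1; apply/orP; left; apply/eqP; ring.
Qed.

Lemma path_progress_le m : (forall y, m <= F y) ->
  eta * (\sum_(k < T) progress (P k) (gg k) (grad F (x k))) <=
  F (x 0) - m + T%:R * (L / 2 * eta ^+ 2 * c).
Proof.
move=> mF.
suff h k : (k <= T)%N ->
    F (x k) + eta * (\sum_(l < k) progress (P l) (gg l) (grad F (x l))) <=
    F (x 0) + k%:R * (L / 2 * eta ^+ 2 * c).
  by have := h T (leqnn T); have := mF (x T); lra.
elim: k => [_|k IH kT]; first by rewrite big_ord0 mulr0 mul0r.
have step := smooth_descent dF lipF (x k) (x k.+1 - x k).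
rewrite addrC subrK in step.
have dotE : dot (grad F (x k)) (x k.+1 - x k) =
    - (eta * progress (P k) (gg k) (grad F (x k))).
  by rewrite xS addrC addKr dotNr dotZr /progress; ring.
have len : enorm (x k.+1 - x k) ^+ 2 <= eta ^+ 2 * c.
  rewrite -[c in leRHS]sqr_sqrtr// -exprMn xS addrC addKr enormN.
  rewrite ler_pXn2r ?nnegrE ?enorm_ge0 ?mulr_ge0 ?sqrtr_ge0//.
  exact: rs_nsgd_step_length (PP kT) eta0.
have {}len : L / 2 * enorm (x k.+1 - x k) ^+ 2 <= L / 2 * eta ^+ 2 * c.
  by rewrite -[leRHS]mulrA ler_wpM2l// divr_ge0// ltW.
rewrite big_ord_recr /= mulrDr -natr1.
by have := IH (ltnW kT); rewrite dotE in step; lra.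
Qed.

End nsgd_path.

(** Rounding of constants: 4/3 <= 2, 2/3 <= 1, and 8/3 times 2 is at most 8. With sqrt 2 <= 3/2, the
    logarithmic terms have coefficients 8 <= 17 and 16/3 <= 12. The batch size enters as
    b^(-(p-1)/p), which decreases in b. *)
Lemma rate_bound (R : realType) (T : nat) (eta u t dr L Delta0 sigma p ell mx b step : R) :
  (0 < T)%N -> 0 < eta -> 0 < t -> 0 < dr -> 0 < L -> 0 <= Delta0 ->
  0 <= sigma -> 1 < p -> 0 <= ell -> 0 < mx -> mx <= b ->
  step = eta * T%:R `^ (- u) ->
  4 / 3 * (Delta0 / (t * step * T%:R)) + 2 / 3 * (dr * step * L / t)
    + 8 / 3 * (2 * sigma * b `^ p^-1 / b)
    + 16 / 3 * (dr * (Num.sqrt (2 * L * Delta0) + L * step * T%:R * Num.sqrt dr)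
                * ell / (t ^+ 2 * T%:R)) <=
  2 * Delta0 / (t * eta * T%:R `^ (1 - u))
    + 17 * (dr * Num.sqrt (Delta0 * L) / (t ^+ 2 * T%:R)) * ell
    + dr * eta * L / (t * T%:R `^ u) * (1 + 12 * (Num.sqrt dr / t) * ell)
    + 8 * sigma / mx `^ ((p - 1) / p).
Proof.
move=> T0 eta0 t0 dr0 L0 D0 s0 p1 ell0 mx0 mxb stepE.
have TR : 0 < T%:R :> R by rewrite ltr0n.
have v0 : 0 < T%:R `^ u :> R by rewrite powR_gt0.
have -> : T%:R `^ (1 - u) = T%:R / T%:R `^ u :> R.
  by rewrite powRB ?powRr1 ?(ltW TR)//; apply/implyP => _; rewrite gt_eqF.
rewrite powRN in stepE.
move: (T%:R `^ u) v0 stepE => v v0 -> {step}.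
have b0 : 0 < b by exact: lt_le_trans mxb.
have p0 : 0 < p by exact: lt_trans p1.
have noise : 8 / 3 * (2 * sigma * b `^ p^-1 / b) <= 8 * sigma / mx `^ ((p - 1) / p).
  have e0 : 0 <= (p - 1) / p by rewrite divr_ge0// ?subr_ge0 ltW.
  rewrite -(mulrA (2 * sigma)).
  have -> : b `^ p^-1 / b = (b `^ ((p - 1) / p))^-1.
    have -> : (p - 1) / p = 1 - p^-1 by field; rewrite gt_eqF.
    rewrite powRB; last by apply/implyP => _; rewrite gt_eqF.
    by rewrite powRr1 ?(ltW b0)// invf_div.
  have i0 : 0 < mx `^ ((p - 1) / p) by rewrite powR_gt0.
  have h : (b `^ ((p - 1) / p))^-1 <= (mx `^ ((p - 1) / p))^-1.
    by rewrite lef_pV2 ?posrE ?powR_gt0// ge0_ler_powR ?nnegrE ?(ltW mx0) ?(ltW b0).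
  have := ler_wpM2l s0 h.
  have : 0 <= sigma / mx `^ ((p - 1) / p) by rewrite divr_ge0// ltW.
  lra.
have sqrt2 : Num.sqrt (2 * L * Delta0) <= 3 / 2 * Num.sqrt (Delta0 * L).
  rewrite -(ger0_norm (_ : 0 <= 3 / 2 :> R)); last lra.
  rewrite -sqrtr_sqr -sqrtrM ?sqr_ge0// ler_wsqrtr//.
  have := mulr_ge0 (ltW L0) D0; lra.
have gen : 16 / 3 * (dr * (Num.sqrt (2 * L * Delta0) + L * (eta / v) * T%:R * Num.sqrt dr)
    * ell / (t ^+ 2 * T%:R)) <=
  17 * (dr * Num.sqrt (Delta0 * L) / (t ^+ 2 * T%:R)) * ell
  + dr * eta * L / (t * v) * (12 * (Num.sqrt dr / t) * ell).
  set q := Num.sqrt (Delta0 * L) in sqrt2 *; set w := Num.sqrt dr.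
  have q0 : 0 <= q by exact: sqrtr_ge0.
  have w0 : 0 <= w by exact: sqrtr_ge0.
  apply: (@le_trans _ _ (16 / 3 * (dr * (3 / 2 * q + L * (eta / v) * T%:R * w)
    * ell / (t ^+ 2 * T%:R)))).
    apply: ler_wpM2l; first by rewrite divr_ge0.
    apply: ler_wpM2r; first by rewrite invr_ge0 mulr_ge0 ?sqr_ge0 ?(ltW TR).
    by apply: ler_wpM2r => //; apply: ler_wpM2l (ltW dr0) _ _ _; rewrite lerD2r.
  have a0 : 0 <= dr * q / (t ^+ 2 * T%:R) * ell.
    apply: mulr_ge0 => //; apply: divr_ge0; first by rewrite mulr_ge0// ltW.
    by rewrite mulr_ge0 ?sqr_ge0// ltW.
  have c0 : 0 <= dr * eta * L / (t * v) * ((w / t) * ell).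
    apply: mulr_ge0; last by rewrite mulr_ge0// divr_ge0// ltW.
    by apply: divr_ge0; rewrite !mulr_ge0 ?(ltW dr0) ?(ltW eta0) ?(ltW L0) ?(ltW t0) ?(ltW v0).
  have -> : 16 / 3 * (dr * (3 / 2 * q + L * (eta / v) * T%:R * w) * ell / (t ^+ 2 * T%:R)) =
     8 * (dr * q / (t ^+ 2 * T%:R) * ell) + 16 / 3 * (dr * eta * L / (t * v) * ((w / t) *
         ell)).
    by field; rewrite !gt_eqF.
  lra.
have first : 4 / 3 * (Delta0 / (t * (eta / v) * T%:R)) <= 2 * Delta0 / (t * eta * (T%:R / v)).
  have h : 0 <= Delta0 / (t * (eta / v) * T%:R).
    by apply: divr_ge0 => //; rewrite !mulr_ge0 ?invr_ge0 ?(ltW eta0) ?(ltW t0) ?(ltW v0)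
        ?(ltW TR).
  have -> : 2 * Delta0 / (t * eta * (T%:R / v)) = 2 * (Delta0 / (t * (eta / v) * T%:R)).
    by field; rewrite !gt_eqF.
  lra.
have second : 2 / 3 * (dr * (eta / v) * L / t) <= dr * eta * L / (t * v).
  have h : 0 <= dr * eta * L / (t * v).
    by apply: divr_ge0; rewrite !mulr_ge0 ?(ltW dr0) ?(ltW eta0) ?(ltW L0) ?(ltW t0) ?(ltW v0).
  have -> : dr * (eta / v) * L / t = dr * eta * L / (t * v) by field; rewrite !gt_eqF.
  lra.
by rewrite [in leRHS]mulrDr mulr1; lra.
Qed.

Theorem theorem5p5 (R : realType) (d r : nat) (hr : (0 < r)%N) (hrd : (r <= d)%N)
  (dX : measure_display) (Xi : measurableType dX) (D : probability Xi R)
  (f : 'cV[R]_d -> Xi -> R) (F : 'cV[R]_d -> R)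
  (hfdiff : forall x xi, differentiable (f^~ xi) x)
  (hfmeas : measurable_fun [set: 'cV[R]_d * Xi]
     (fun z : 'cV[R]_d * Xi => grad (f^~ z.2) z.1))
  (hFint : forall x, D.-integrable setT (fun xi => (f x xi)%:E))
  (hFE : forall x, (F x)%:E = (\int[D]_xi (f x xi)%:E)%E)
  (hFdiff : forall x, differentiable F x)
  (hFlb : has_lbound (range F))
  (L : R) (hL : 0 < L)
  (hLsmooth : forall x y, enorm (grad F x - grad F y) <= L * enorm (x - y))
  (hgint : forall x (i : 'I_d),
     D.-integrable setT (fun xi => (grad (f^~ xi) x i 0)%:E))
  (hgE : forall x (i : 'I_d),
     (\int[D]_xi (grad (f^~ xi) x i 0)%:E)%E = (grad F x i 0)%:E)
  (p sigma : R) (hp1 : 1 < p) (hp2 : p <= 2) (hsigma : 0 <= sigma)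
  (hmoment : forall x,
     (\int[D]_xi (enorm (grad (f^~ xi) x - grad F x) `^ p)%:E
       <= (sigma `^ p)%:E)%E)
  (T : nat) (hT : (0 < T)%N) (B q eta u : R)
  (hB : 0 < B) (hq : 0 < q) (heta : 0 < eta) (hu0 : 0 < u) (hu1 : u < 1)
  (dO : measure_display) (Omega : measurableType dO) (Pr : probability Omega R)
  (x0 : 'cV[R]_d)
  (P : nat -> {RV Pr >-> 'M[R]_(d, r)})
  (xi : nat -> 'I_(batch_size B q T) -> {RV Pr >-> Xi})
  (hP : forall k, haar_matrix hrd Pr (P k))
  (hxi : forall k j (A : set Xi), measurable A -> Pr (xi k j @^-1` A) = D A)
  (hindep : mutually_independent Pr (draws_sigma P xi))
  (delta : R) (hd0 : 0 < delta) (hd1 : delta < 1) :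
  let x (k : nat) (w : Omega) : 'cV[R]_d :=
    rs_nsgd (fun y s => grad (f^~ s) y) (eta * T%:R `^ (- u)) x0
      (fun k => P k w) (fun k j => xi k j w) k in
  let Delta0 : R := F x0 - inf (range F) in
  let dr : R := d%:R / r%:R in
  let t : R := tau R d r in
  let E : set Omega := [set w |
    T%:R^-1 * (\sum_(k < T) enorm (grad F (x k w))) <=
      2 * Delta0 / (t * eta * T%:R `^ (1 - u))
      + 17 * (dr * Num.sqrt (Delta0 * L) / (t ^+ 2 * T%:R)) * ln (1 / delta)
      + dr * eta * L / (t * T%:R `^ u)
        * (1 + 12 * (Num.sqrt dr / t) * ln (1 / delta))
      + 8 * sigma / (Num.max 1 (B * T%:R `^ q)) `^ ((p - 1) / p)] in
  measurable E /\ ((1 - delta)%:E <= Pr E)%E.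
Proof.
move=> x Delta0 dr t E.
have d_gt0 : (0 < d)%N by exact: (leq_trans hr hrd).
have dr0 : 0 < dr by rewrite divr_gt0// ltr0n.
have TR : 0 < T%:R :> R by rewrite ltr0n.
have max1 : 1 <= Num.max 1 (B * T%:R `^ q) by rewrite le_max lexx.
have maxb : Num.max 1 (B * T%:R `^ q) <= (batch_size B q T)%:R.
  rewrite /batch_size natr_absz ger0_norm; first exact: ceil_ge.
  by rewrite -(ler_int R); apply: le_trans (ceil_ge _); apply: le_trans max1.
have b0 : (0 < batch_size B q T)%N.
  by rewrite -(ltr0n R); apply: lt_le_trans maxb; apply: lt_le_trans max1.
have mF y : inf (range F) <= F y by apply: ge_inf => //; exists y.
have D0 : 0 <= Delta0 by rewrite subr_ge0.
have /andP[t0 t_sqrt] := haar_tau_bounds hr (hP 0).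
rewrite -/t -/dr in t0 t_sqrt.
pose step := eta * T%:R `^ (- u).
have step0 : 0 < step by rewrite mulr_gt0// powR_gt0.
have sdr0 : 0 < Num.sqrt dr by rewrite sqrtr_gt0.
(* The initial gradient bound, plus L times the length of T steps. *)
pose M := Num.sqrt (2 * L * Delta0) + L * step * T%:R * Num.sqrt dr.
have M0 : 0 < M.
  exact: ltr_wpDl (sqrtr_ge0 _) (mulr_gt0 (mulr_gt0 (mulr_gt0 hL step0) TR) sdr0).
(* Largest choice for which [lam ^+ 2 * dr * N ^+ 2] is at most a quarter of
   [lam * t * N] when [N <= M]; then also [lam * Y <= 1 / 4]. *)
pose lam := t / (4 * dr * M).
have lam0 : 0 < lam by apply: divr_gt0 t0 (mulr_gt0 (mulr_gt0 _ dr0) M0).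
have lamM : lam * Num.sqrt dr * M <= 4^-1.
  have -> : lam * Num.sqrt dr * M = 4^-1 * (t * Num.sqrt dr / dr).
    rewrite /lam; move: dr M t dr0 M0 {t0 t_sqrt step0 sdr0 E lam lam0} => c K s c0 K0.
    by field; rewrite !gt_eqF.
  rewrite ler_piMr// ler_pdivrMr// mul1r -[leRHS]sqr_sqrtr ?(ltW dr0)// expr2.
  by rewrite ler_wpM2r// ltW.
have mN : measurable_fun setT (grad F).
  apply: measurable_fun_mx => i j; rewrite ord1; apply: continuous_mx_measurable.
  exact: (lipschitz_continuous (ltW hL) (lipschitz_grad_coord hLsmooth i)).
have [mA prA] := weight_lt_probability hr hfmeas mN step x0 hindep hp1 hp2 hsigma hgint hgE
  hmoment hxi b0 hP lam0 lamM T hd0.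
set A := [set w | _] in mA prA.
have mE : measurable E.
  have mS : measurable_fun setT (fun w => T%:R^-1 * (\sum_(k < T) enorm (grad F (x k w)))).
    apply: measurable_funM => //; apply: measurable_sum => k.
    by apply: measurable_enorm; exact: (measurableT_comp mN (measurable_iterate hfmeas _
        _ _ _ k)).
  rewrite /E; move: (_ + _ + _ + _) => C.
  have := measurable_fun_ler mS (measurable_cst C).
  by move=> /(_ measurableT [set true] I); rewrite setTI.
split=> //.
(* Orthogonality of the columns is only almost sure, whereas the path estimates need it at every
   iteration; the countable union of exceptions is null and is added to [E]. *)
pose bad k := ~` [set w | (P k w)^T *m P k w = dr%:M].
have mgood k : measurable [set w | (P k w)^T *m P k w = dr%:M].
  have := measurable_funPT (P k).
  by move=> /(_ measurableT _ (@measurable_stiefel R d r dr)); rewrite setTI.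
have mbad k : measurable (bad k) by exact: measurableC.
have bad0 : Pr (\bigcup_k bad k) = 0%E.
  apply: measure_negligible; first exact: bigcupT_measurable.
  apply: negligible_bigcup => k; exists (bad k); split=> //.
  by have := probability_setC Pr (mgood k); rewrite (haar_matrix_stiefel (hP k)) subee.
have sub : A `<=` E `|` \bigcup_k bad k.
  move=> w Aw; have [wb|wb] := pselect ((\bigcup_k bad k) w); [by right|left].
  have PP k : (P k w)^T *m P k w = dr%:M.
    by apply/not_notP => nP; apply: wb; exists k.
  have xS k := iterateS (fun y s => grad (f^~ s) y) step x0 P xi k w.
  have grad0 : enorm (grad F x0) <= Num.sqrt (2 * L * Delta0).
    rewrite -(ger0_norm (enorm_ge0 _)) -sqrtr_sqr ler_wsqrtr//.
    exact: sqr_grad_le.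
  have small k : (k < T)%N -> enorm (grad F (x k w)) <= M.
    move=> kT; apply: le_trans
      (path_gradient_le hLsmooth hL (ltW step0) (ltW dr0) xS (fun l _ => PP l) (ltnW kT)) _.
    apply: lerD => //; apply: ler_wpM2r; first exact: sqrtr_ge0.
    by apply: ler_wpM2l; [exact: mulr_ge0 (ltW hL) (ltW step0)|rewrite ler_nat ltnW].
  have descent := path_progress_le hFdiff hLsmooth hL (ltW step0) (ltW dr0) xS
    (fun l (_ : (l < T)%N) => PP l) mF.
  have ell0 : 0 <= ln (1 / delta) by rewrite ln_ge0// div1r invf_ge1// ltW.
  move: Aw; rewrite /A /= weight_expR// => Aw.
  have sumW := ltW Aw.
  rewrite -[leRHS]lnK ?posrE ?invr_gt0// ler_expR -[delta^-1]div1r in sumW.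
  have n_bounds k : (k < T)%N -> 0 <= enorm (grad F (x k w)) <= M.
    by move=> kT; rewrite enorm_ge0 small.
  have avg := @average_gradient_bound R T (fun k => enorm (grad F (x k w)))
    (fun k => step_progress (fun y s => grad (f^~ s) y) (grad F) step x0 P xi k w)
    t dr L step Delta0 (noise_level (batch_size B q T) p sigma) (ln (1 / delta)) M hT t0
        dr0 step0 M0 n_bounds descent sumW.
  apply: le_trans avg _; apply: rate_bound => //; exact: lt_le_trans max1.
apply: le_trans prA _.
apply: (@le_trans _ _ (Pr (E `|` \bigcup_k bad k))).
  apply: le_measure => //; rewrite ?inE//.
  by apply: measurableU => //; exact: bigcupT_measurable.
have -> : (Pr E = Pr E + Pr (\bigcup_k bad k))%E by rewrite bad0 adde0.
by apply: measureU2 => //; exact: bigcupT_measurable.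
Qed.
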